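(* Let $q$ be a prime power and let $\mathcal{X}$ be a non-singular, irreducible, non-linear, $\mathbf{F}_q$-Frobenius non-classical plane curve of degree $d$ defined over $\mathbf{F}_q$. Let $\epsilon$ be the order of contact of $\mathcal{X}$ with its tangent line at a general point. If $$d(d-1)<(q+1)\epsilon,$$ then the set $\mathcal{X}(\mathbf{F}_q)$ of $\mathbf{F}_q$-rational points of $\mathcal{X}$ is a complete $(k,d)$-arc in $\mathbf{P}^2(\mathbf{F}_q)$, where $k=\#\mathcal{X}(\mathbf{F}_q)=d(q-d+2)$.
   Context: $\mathbf{F}_q$ is the finite field with $q$ elements and $\overline{\mathbf{F}}_q$ its algebraic closure. A $(k,d)$-arc in $\mathbf{P}^2(\mathbf{F}_q)$ is a set $\mathcal{K}$ of exactly $k$ points of $\mathbf{P}^2(\mathbf{F}_q)$ such that no line of $\mathbf{P}^2(\mathbf{F}_q)$ meets $\mathcal{K}$ in more than $d$ points; it is complete if it is not contained in any $(k+1,d)$-arc. Plane curves are irreducible, non-linear curves $\mathcal{X}\subseteq\mathbf{P}^2(\overline{\mathbf{F}}_q)$ defined over $\mathbf{F}_q$. Let $x_0,x_1,x_2$ be the coordinate functions of $\mathbf{P}^2(\overline{\mathbf{F}}_q)$ on $\mathcal{X}$, let $t$ be a separating variable of the function field extension $\mathbf{F}_q(\mathcal{X})|\mathbf{F}_q$, and let $D^i=D^i_t$ be the $i$-th Hasse derivative on $\mathcal{X}$ with respect to $t$. The number $\epsilon=\epsilon(\mathcal{X})$ is the least integer $\epsilon>1$ such that $$\det\begin{pmatrix}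 x_0 & x_1 & x_2\\ D^1x_0 & D^1x_1 & D^1x_2\\ D^\epsilon x_0 & D^\epsilon x_1 & D^\epsilon x_2\end{pmatrix}\neq 0;$$ geometrically, $\epsilon$ is the intersection multiplicity of $\mathcal{X}$ with its tangent line at a general point of $\mathcal{X}$. Let $\nu=\nu(\mathcal{X},q)$ be the least integer $\nu>0$ such that $$\det\begin{pmatrix} x_0^q & x_1^q & x_2^q\\ x_0 & x_1 & x_2\\ D^\nu x_0 & D^\nu x_1 & D^\nu x_2\end{pmatrix}\neq 0.$$ One has $\nu\in\{1,\epsilon\}$. The curve $\mathcal{X}$ is called $\mathbf{F}_q$-Frobenius non-classical if $\nu=\epsilon$ (equivalently $\nu>1$); equivalently, the image of $P$ under the $\mathbf{F}_q$-Frobenius morphism (raising coordinates to the $q$-th power) lies on the tangent line of $\mathcal{X}$ at $P$ for every non-singular point $P\in\mathcal{X}$. *)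

(* Defs.v *)
From HB Require Import structures.
From mathcomp Require Import all_boot all_order all_algebra all_field.
From mathcomp Require Import mpoly.

Set Implicit Arguments.
Unset Strict Implicit.
Unset Printing Implicit Defensive.

Import GRing.Theory.
Local Open Scope ring_scope.

(* The projective plane over a finite field F: the one-dimensional subspaces
   of F^3, each represented by the finite set of its vectors. *)
Definition is_point (F : finFieldType) (U : {set 'rV[F]_3}) : bool :=
  [exists v : 'rV[F]_3, (v != 0) && (U == [set a *: v | a : F])].

Definition P2 (F : finFieldType) := {U : {set 'rV[F]_3} | is_point U}.

(* The line with equation [v *m l = 0]; it is a line only if [l != 0]. *)
Definition line (F : finFieldType) (l : 'cV[F]_3) : {set P2 F} :=
  [set P : P2 F | [forall v in val P, v *m l == 0]].

Definition is_arc (F : finFieldType) (k d : nat) (A : {set P2 F}) : Prop :=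
  #|A| = k /\ forall l : 'cV[F]_3, l != 0 -> (#|A :&: line l| <= d)%N.

Definition is_complete_arc (F : finFieldType) (k d : nat) (A : {set P2 F}) :
    Prop :=
  is_arc k d A /\
  ~ (exists B : {set P2 F}, is_arc k.+1 d B /\ A \subset B).

(* A plane curve is given by a homogeneous equation f with coefficients in F;
   [evalf phi f v] is the value of f at a vector v of E^3, E being an extension
   of F through phi. *)
Definition evalf (F E : fieldType) (phi : {rmorphism F -> E})
    (f : {mpoly F[3]}) (v : 'rV[E]_3) : E :=
  (map_mpoly phi f).@[v 0].

Definition rational_points (F : finFieldType) (f : {mpoly F[3]}) :
    {set P2 F} :=
  [set P : P2 F | [forall v in val P, f.@[v 0] == 0]].

Definition irreducible_mpoly (E : fieldType) (n : nat) (p : {mpoly E[n]}) :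
    Prop :=
  [/\ p != 0, p \isn't a GRing.unit
    & forall g h : {mpoly E[n]}, p = g * h ->
        (g \is a GRing.unit) || (h \is a GRing.unit)].

Definition is_algebraic_closure (F : fieldType) (Fbar : closedFieldType)
    (iota : {rmorphism F -> Fbar}) : Prop :=
  forall u : Fbar, algebraicOver iota u.

Definition irreducible_curve (F : fieldType) (Fbar : closedFieldType)
    (iota : {rmorphism F -> Fbar}) (f : {mpoly F[3]}) : Prop :=
  irreducible_mpoly (map_mpoly iota f).

Definition nonsingular_curve (F : fieldType) (Fbar : closedFieldType)
    (iota : {rmorphism F -> Fbar}) (f : {mpoly F[3]}) : Prop :=
  forall v : 'rV[Fbar]_3, v != 0 -> evalf iota f v = 0 ->
    exists i : 'I_3, evalf iota (mderiv i f) v != 0.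

(* K, an extension of F through phi, is the function field over F of the curve
   f = 0, and x is a vector of homogeneous coordinate functions of the curve:
   the forms vanishing at x are the multiples of f, and K consists of the
   quotients of forms of equal degree evaluated at x.  As usual for homogeneous
   coordinates, x is only determined up to a factor in K^*; normalising one of
   its entries to 1 gives the affine coordinate functions. *)
Definition is_function_field (F K : fieldType) (phi : {rmorphism F -> K})
    (f : {mpoly F[3]}) (x : 'rV[K]_3) : Prop :=
  (forall (m : nat) (g : {mpoly F[3]}), g \is m.-homog ->
     (evalf phi g x = 0 <-> exists h : {mpoly F[3]}, g = h * f)) /\
  (forall y : K, exists (m : nat) (g h : {mpoly F[3]}),
     [/\ g \is m.-homog, h \is m.-homog, evalf phi h x != 0
       & y = evalf phi g x / evalf phi h x]).

(* Membership in the subfield F(t) of K. *)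
Definition in_adjoin (F K : fieldType) (phi : {rmorphism F -> K}) (t z : K) :
    Prop :=
  exists g h : {poly F}, (map_poly phi h).[t] != 0 /\
    z = (map_poly phi g).[t] / (map_poly phi h).[t].

(* t is transcendental over F and K is separable algebraic over F(t).
   Finiteness of K over F(t) is automatic when K is finitely generated. *)
Definition separating_variable (F K : fieldType) (phi : {rmorphism F -> K})
    (t : K) : Prop :=
  ~ algebraicOver phi t /\
  forall y : K, exists p : {poly K},
    [/\ forall i : nat, in_adjoin phi t p`_i, separable_poly p & root p y].

(* D i is the i-th Hasse derivative on K with respect to t.  These properties
   determine D on F(t), and on K when t is a separating variable. *)
Definition is_hasse_derivative (F K : fieldType) (phi : {rmorphism F -> K})
    (t : K) (D : nat -> K -> K) : Prop :=
  [/\ forall y : K, D 0 y = y,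
      forall (i : nat) (a : F) (y z : K),
        D i (phi a * y + z) = phi a * D i y + D i z,
      forall (i : nat) (y z : K),
        D i (y * z) = \sum_(j < i.+1) D j y * D (i - j)%N z
    & forall i j : nat, D i (t ^+ j) = t ^+ (j - i) *+ 'C(j, i)].

Definition det3 (K : fieldType) (u v w : 'rV[K]_3) : K :=
  \det (col_mx u (col_mx v w) : 'M[K]_3).

Definition is_least (P : nat -> Prop) (n : nat) : Prop :=
  P n /\ forall m : nat, P m -> (n <= m)%N.

Definition is_epsilon (K : fieldType) (D : nat -> K -> K) (x : 'rV[K]_3)
    (eps : nat) : Prop :=
  is_least (fun e => (1 < e)%N /\
    det3 x (map_mx (D 1) x) (map_mx (D e) x) != 0) eps.

Definition is_nu (q : nat) (K : fieldType) (D : nat -> K -> K)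
    (x : 'rV[K]_3) (nu : nat) : Prop :=
  is_least (fun n => (0 < n)%N /\
    det3 (map_mx (fun z => z ^+ q) x) x (map_mx (D n) x) != 0) nu.

Definition frobenius_nonclassical (q : nat) (K : fieldType)
    (D : nat -> K -> K) (x : 'rV[K]_3) : Prop :=
  exists nu eps : nat, [/\ is_nu q D x nu, is_epsilon D x eps & nu = eps].

(* Main.v *)
Require Import Defs.
From HB Require Import structures.
From mathcomp Require Import all_boot all_order all_algebra all_field.
From mathcomp Require Import mpoly.
From mathcomp Require Import pgroup abelian ring zify.

(** Write X for the generic point, X^q for its Frobenius image and G for the
    gradient of f.  Frobenius non-classicality says that G.X^q = 0 on the
    curve; as also G.X = 0, the form X x X^q is a multiple of G on the curve,
    and vanishes exactly at the rational points, where it is transversal.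

    Intersections with the curve are counted without intersection theory: for
    Q off the curve, projection from Q makes the curve a d-sheeted cover of the
    pencil of lines through Q, and the norm of a form g along it is a polynomial
    of degree at most d (deg g) whose zeros are the lines of the pencil that
    pass through a common point of f = 0 and g = 0.

    Number of points: take a line joining Q to its Frobenius image, with Q, Q^q
    and Q^(q^2) independent; then no F-line passes through Q.  On the curve the
    forms det(Q, X, X^q) and Q.G differ by the factor (X x X^q) / G, so the
    norms of these forms, of degrees d (q+1) and d (d-1), differ by one simple
    zero for each rational point.

    Completeness: let Q be rational and off the curve.  A point P of an F-line
    through Q satisfies P = P^q or has that line as its tangent, so that an
    F-line through Q that is nowhere tangent has d rational points.  It remains
    to see that the q+1 F-lines through Q are not all tangent.  Let n be the
    multiple of G with one coordinate equal to 1.  As n is orthogonal to X, to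
    X^q and to the derivatives of X of order < eps, its own derivatives of
    order 0 < j < eps vanish, whence n is an e-th power with e >= eps a power
    of p.  Hence all zeros of the norm of Q.G have multiplicity divisible by e,
    and there are at most d (d-1) / eps < q+1 of them. *)

Set Implicit Arguments.
Unset Strict Implicit.
Unset Printing Implicit Defensive.

Import GRing.Theory.
Local Open Scope ring_scope.

(** * Vectors and substitution *)

Lemma sum3E (V : nmodType) (u : 'I_3 -> V) : \sum_i u i = u 0 + u 1 + u 2.
Proof.
rewrite !big_ord_recl big_ord0 addr0 addrA.
by congr (u _ + u _ + u _); apply: val_inj.
Qed.

Lemma ord3_ind (P : 'I_3 -> Prop) : P 0 -> P 1 -> P 2 -> forall i, P i.
Proof.
move=> P0 P1 P2 [[|[|[|m]]] lt_m3] //.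
- by rewrite (_ : Ordinal _ = 0) //; apply: val_inj.
- by rewrite (_ : Ordinal _ = 1) //; apply: val_inj.
- by rewrite (_ : Ordinal _ = 2) //; apply: val_inj.
Qed.

Section Vectors.
Variable A : comNzRingType.
Implicit Types u v w : 'I_3 -> A.

Definition dot u v : A := u 0 * v 0 + u 1 * v 1 + u 2 * v 2.

Definition cross u v : 'I_3 -> A :=
  fun i => u (i + 1) * v (i + 2) - u (i + 2) * v (i + 1).

Definition det u v w : A := dot u (cross v w).

Lemma cross0E u v : cross u v 0 = u 1 * v 2 - u 2 * v 1.
Proof. by rewrite /cross !add0r. Qed.

Lemma cross1E u v : cross u v 1 = u 2 * v 0 - u 0 * v 2.
Proof.
by rewrite /cross; congr (u _ * v _ - u _ * v _); apply: val_inj.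
Qed.

Lemma cross2E u v : cross u v 2 = u 0 * v 1 - u 1 * v 0.
Proof.
by rewrite /cross; congr (u _ * v _ - u _ * v _); apply: val_inj.
Qed.

Definition crossE := (cross0E, cross1E, cross2E).

Lemma dotE u v : dot u v = \sum_i u i * v i.
Proof. by rewrite sum3E. Qed.

Lemma dotC u v : dot u v = dot v u.
Proof. by rewrite /dot; ring. Qed.

Lemma dotZr u v a : dot u (fun i => a * v i) = a * dot u v.
Proof. by rewrite /dot; ring. Qed.

Lemma dot_combr u v w a b :
  dot u (fun i => a * v i + b * w i) = a * dot u v + b * dot u w.
Proof. by rewrite /dot; ring. Qed.

(** Multiplication by the adjugate of the matrix with rows u, v, w. It serves to show that only n =
    0 is orthogonal to three independent vectors. *)
Lemma ortho3 u v w n (i : 'I_3) :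
  dot n u = 0 -> dot n v = 0 -> dot n w = 0 -> n i * det u v w = 0.
Proof.
move=> nu nv nw.
suff ->: n i * det u v w =
  dot n u * cross v w i + dot n v * cross w u i + dot n w * cross u v i.
  by rewrite nu nv nw !mul0r !addr0.
by elim/ord3_ind: i; rewrite /det /dot !crossE; ring.
Qed.

(** The double product n x (u x v) = (n.v) u - (n.u) v vanishes, so n is parallel to u x v; the
    cross-multiplied form makes sense in any commutative ring. *)
Lemma ortho2 u v n (i j : 'I_3) :
  dot n u = 0 -> dot n v = 0 -> n i * cross u v j = n j * cross u v i.
Proof.
move=> nu nv.
have E k : cross n (cross u v) k = 0.
  suff ->: cross n (cross u v) k = dot n v * u k - dot n u * v k.
    by rewrite nu nv !mul0r subrr.
  by elim/ord3_ind: k; rewrite !crossE /dot; ring.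
have := (E 0, E 1, E 2); rewrite !(cross0E n) !(cross1E n) !(cross2E n).
move=> [[/eqP]]; rewrite subr_eq0 => /eqP E0 /eqP; rewrite subr_eq0 => /eqP E1.
move=> /eqP; rewrite subr_eq0 => /eqP E2.
elim/ord3_ind: i; elim/ord3_ind: j; congruence.
Qed.

Lemma eq_dot u u' v v' : u =1 u' -> v =1 v' -> dot u v = dot u' v'.
Proof. by rewrite /dot => eu ev; rewrite !eu !ev. Qed.

Lemma eq_cross u u' v v' : u =1 u' -> v =1 v' -> cross u v =1 cross u' v'.
Proof. by move=> eu ev i; rewrite /cross !eu !ev. Qed.

Lemma eq_det u u' v v' w w' :
  u =1 u' -> v =1 v' -> w =1 w' -> det u v w = det u' v' w'.
Proof. by move=> eu ev ew; apply/eq_dot/eq_cross. Qed.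

End Vectors.

Lemma mpoly_ring_ind (n : nat) (R : nzRingType) (P : {mpoly R[n]} -> Prop) :
  (forall c, P c%:MP) -> (forall i, P 'X_i) ->
  (forall g h, P g -> P h -> P (g + h)) ->
  (forall g h, P g -> P h -> P (g * h)) -> forall g, P g.
Proof.
move=> PC PX PD PM g.
have P1 : P 1 by rewrite -mpolyC1; apply: PC.
have P0 : P 0 by rewrite -mpolyC0; apply: PC.
rewrite [g]mpolyE; elim/big_rec: _ => // m h _ Ph.
apply: PD => //; rewrite -mul_mpolyC; apply: (PM) => //.
rewrite mpolyXE_id; elim/big_rec: _ => // i k _ Pk.
apply: (PM) => //; elim: (m i) => [|e IHe]; first by rewrite expr0.
by rewrite exprS; apply: (PM).
Qed.

Section Substitution.
Variables (n : nat) (R A : comNzRingType) (phi : {rmorphism R -> A}).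
Implicit Types (g : {mpoly R[n]}) (u : 'I_n -> A).

Lemma mmapXU u i : mmap phi u 'X_i = u i.
Proof. by rewrite mmapX mmap1U. Qed.

Lemma eq_mmap u u' g : u =1 u' -> mmap phi u g = mmap phi u' g.
Proof. by move=> eu; apply: eq_bigr => m _; congr (_ * _); apply: mmap1_eq. Qed.

Lemma map_mpoly_mmap u g : (map_mpoly phi g).@[u] = mmap phi u g.
Proof.
elim/mpoly_ring_ind: g => [c|i|g h IHg IHh|g h IHg IHh].
- by rewrite map_mpolyC // mevalC mmapC.
- by rewrite map_mpolyX mevalXU mmapXU.
- by rewrite rmorphD /= mevalD IHg IHh rmorphD.
- by rewrite rmorphM /= mevalM IHg IHh rmorphM.
Qed.

Lemma mmap_homog u g (m : nat) a :
  g \is m.-homog -> mmap phi (fun i => a * u i) g = a ^+ m * mmap phi u g.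
Proof.
move=> /dhomogP g_m; rewrite /mmap big_seq [in RHS]big_seq mulr_sumr.
apply: eq_bigr => mm /g_m /= <-; rewrite mulrCA; congr (_ * _).
rewrite /mmap1 /= mdegE -prodrXr -big_split /=.
by apply: eq_bigr => i _; rewrite exprMn.
Qed.

(** Chain rule for a derivation that kills the constants. It serves both for the formal derivative
    of polynomials and for the first Hasse derivative. *)
Lemma mmap_deriv u g (D : A -> A) :
  (forall a b, D (a + b) = D a + D b) ->
  (forall a b, D (a * b) = D a * b + a * D b) ->
  (forall c, D (phi c) = 0) ->
  D (mmap phi u g) = \sum_i mmap phi u g^`M(i) * D (u i).
Proof.
move=> DD DM DC; elim/mpoly_ring_ind: g => [c|i|g h IHg IHh|g h IHg IHh].
- by rewrite mmapC DC big1 // => i _; rewrite mderivC raddf0 mul0r.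
- rewrite mmapXU (bigD1 i) //= big1 => [|j ji].
    rewrite mderivX mnm1E eqxx scale1r addr0.
    rewrite (_ : U_(i) - U_(i) = 0)%MM; last by apply/mnmP => j; rewrite mnmBE subnn mnm0E.
    by rewrite mpolyX0 rmorph1 mul1r.
  by rewrite mderivX mnm1E eq_sym (negPf ji) scale0r raddf0 mul0r.
- rewrite rmorphD /= DD IHg IHh -big_split /=.
  by apply: eq_bigr => i _; rewrite mderivD rmorphD /= mulrDl.
- rewrite rmorphM /= DM IHg IHh mulr_suml mulr_sumr -big_split /=.
  apply: eq_bigr => i _; rewrite mderivM rmorphD /= !rmorphM /=; ring.
Qed.

End Substitution.

Lemma mmap_comp (n : nat) (R A A' : comNzRingType) (phi : {rmorphism R -> A})
    (psi : {rmorphism A -> A'}) (u : 'I_n -> A) (g : {mpoly R[n]}) :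
  psi (mmap phi u g) = mmap (psi \o phi) (psi \o u) g.
Proof.
elim/mpoly_ring_ind: g => [c|i|g h IHg IHh|g h IHg IHh].
- by rewrite !mmapC.
- by rewrite !mmapXU.
- by rewrite !rmorphD IHg IHh.
- by rewrite !rmorphM IHg IHh.
Qed.

Lemma mmap_map (n : nat) (R R' A : comNzRingType) (phi : {rmorphism R -> R'})
    (psi : {rmorphism R' -> A}) (u : 'I_n -> A) (g : {mpoly R[n]}) :
  mmap psi u (map_mpoly phi g) = mmap (psi \o phi) u g.
Proof.
elim/mpoly_ring_ind: g => [c|i|g h IHg IHh|g h IHg IHh].
- by rewrite map_mpolyC // !mmapC.
- by rewrite map_mpolyX !mmapXU.
- by rewrite !rmorphD /= IHg IHh.
- by rewrite !rmorphM /= IHg IHh.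
Qed.

Lemma mderiv_map (n : nat) (R R' : nzRingType) (phi : {rmorphism R -> R'}) i
    (g : {mpoly R[n]}) :
  (map_mpoly phi g)^`M(i) = map_mpoly phi g^`M(i).
Proof.
apply/mpolyP => m; rewrite mcoeff_mderiv !mcoeff_map_mpoly mcoeff_mderiv.
by rewrite raddfMn.
Qed.

Lemma mderiv_homog (n : nat) (R : nzRingType) m i (g : {mpoly R[n]}) :
  g \is m.-homog -> g^`M(i) \is m.-1.-homog.
Proof.
move=> g_m; apply/dhomogP => mm; rewrite mcoeff_msupp mcoeff_mderiv => nz.
have /(dhomogP _ _ _ g_m) : (mm + U_(i))%MM \in msupp g.
  by rewrite mcoeff_msupp; apply: contraNneq nz => ->; rewrite mul0rn.
by rewrite /= mdegD mdeg1 addn1 => <-.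
Qed.

Lemma euler_homog (n : nat) (R : comNzRingType) m (g : {mpoly R[n]}) :
  g \is m.-homog -> \sum_i 'X_i * g^`M(i) = g *+ m.
Proof.
move=> g_m; pose T (h : {mpoly R[n]}) := \sum_i 'X_i * h^`M(i).
have TE (h : {mpoly R[n]}) mm : T (h@_mm *: 'X_[mm]) = (h@_mm *: 'X_[mm]) *+ mdeg mm.
  rewrite mdegE /= /T -sumrMnr; apply: eq_bigr => i _.
  rewrite mderivZ mderivX; case: (posnP (mm i)) => [-> |mmi].
    by rewrite scale0r scaler0 mulr0 mulr0n.
  rewrite -!scalerAr -mpolyXD addmC submK //; last first.
    by apply/mnm_lepP => j; rewrite mnm1E; case: eqP => [<-|].
  by rewrite scaler_nat scalerMnr.
have: T g = \sum_(mm <- msupp g) T (g@_mm *: 'X_[mm]).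
  rewrite /T {1}[g]mpolyE exchange_big; apply: eq_bigr => i _ /=.
  by rewrite raddf_sum mulr_sumr.
rewrite /T => ->; rewrite big_seq [in RHS](mpolyE g) -sumrMnl [RHS]big_seq.
apply: eq_bigr => mm /(dhomogP _ _ _ g_m) /= Emm.
by rewrite -/(T _) TE Emm.
Qed.

(** * Norms *)

Section Along.
Variables (k A : comNzRingType) (phi : {rmorphism k -> A}).
Implicit Types (u v : 'I_3 -> A) (g : {mpoly k[3]}).

(** The restriction of g to the line parametrised by u + y v, as a polynomial in y. *)
Definition along u v g : {poly A} :=
  mmap (polyC \o phi) (fun i => (u i)%:P + (v i)%:P * 'X) g.

HB.instance Definition _ u v := GRing.RMorphism.copy (along u v)
  (mmap (polyC \o phi) (fun i => (u i)%:P + (v i)%:P * 'X)).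

Lemma alongC u v c : along u v c%:MP = (phi c)%:P.
Proof. exact: mmapC. Qed.

Lemma horner_along u v g y :
  (along u v g).[y] = mmap phi (fun i => u i + y * v i) g.
Proof.
rewrite /along -/(horner_eval y _) mmap_comp.
have -> : mmap phi (fun i => u i + y * v i) g =
  mmap phi (horner_eval y \o (fun i => (u i)%:P + (v i)%:P * 'X)) g.
  by apply: eq_mmap => i; rewrite /= /horner_eval !hornerE mulrC.
by apply: eq_bigr => m _ /=; rewrite /horner_eval hornerC.
Qed.

Lemma deriv_along u v g :
  (along u v g)^`() = \sum_i (v i)%:P * along u v g^`M(i).
Proof.
rewrite /along (@mmap_deriv _ _ _ _ _ _ (@deriv A)).
- by apply: eq_bigr => i _; rewrite !derivE mulr1 add0r mulrC.
- exact: derivD.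
- exact: derivM.
- by move=> c; rewrite /= derivC.
Qed.

Lemma along_monomial u v (mm : 'X_{1..3}) :
  let g := mmap1 (fun i => (u i)%:P + (v i)%:P * 'X : {poly A}) mm in
  (size g <= (mdeg mm).+1)%N /\ g`_(mdeg mm) = mmap1 v mm.
Proof.
(* The value c may be 0: [low] bounds the degree by e and records the coefficient at e, which is
   multiplicative over any ring. *)
pose low (g : {poly A}) e c := (size g <= e.+1)%N /\ g`_e = c.
have lowM (g h : {poly A}) e e' c c' : low g e c -> low h e' c' -> low (g * h) (e + e')%N (c * c').
  move=> [sg gc] [sh hc]; split.
    apply: leq_trans (size_polyMleq _ _) _.
    by lia.
  rewrite coefM (bigD1 (inord e)) //= inordK ?ltnS ?leq_addr // addKn gc hc.
  rewrite big1 ?addr0 // => i ie; case: (ltngtP i e) => [ie'|ie'|ie'].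
  - by rewrite [h`_ _]nth_default ?mulr0 // (leq_trans sh) //; lia.
  - by rewrite [g`_ _]nth_default ?mul0r // (leq_trans sg).
  - by case/eqP: ie; apply: val_inj; rewrite /= inordK ?ltnS ?leq_addr.
have low1 : low 1 0%N 1 by rewrite /low size_poly1 coef1.
have lowX (g : {poly A}) e c j : low g e c -> low (g ^+ j) (e * j)%N (c ^+ j).
  move=> lg; elim: j => [|j IHj]; first by rewrite muln0.
  by rewrite !exprS mulnS; apply: lowM.
rewrite /mmap1 mdegE -/(low _ _ _).
elim/big_rec3: _ => // i c e g _ lg; apply: lowM lg.
rewrite -{2}[mm i]mul1n; apply: lowX; split; last by rewrite coefD coefC coefCM coefX mulr1 add0r.
apply: leq_trans (size_polyD _ _) _; rewrite geq_max.
rewrite (leq_trans (size_polyC_leq1 _)) //.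
by rewrite (leq_trans (size_polyMleq _ _)) // size_polyX size_polyC; case: (_ != 0).
Qed.

Lemma along_homog u v g m : g \is m.-homog ->
  (size (along u v g) <= m.+1)%N /\ (along u v g)`_m = mmap phi v g.
Proof.
move=> /dhomogP g_m; rewrite /along /mmap coef_sum; split.
  apply: leq_trans (size_sum _ _ _) _; apply/bigmax_leqP_seq => mm /g_m /= Em _.
  apply: leq_trans (size_polyMleq _ _) _; have [+ _] := along_monomial u v mm.
  rewrite Em size_polyC; case: (_ != 0) => sz; rewrite ?add1n ?add0n //=.
  exact: leq_trans (leq_pred _) sz.
rewrite big_seq [RHS]big_seq; apply: eq_bigr => mm /g_m /= Em.
by rewrite coefCM; congr (_ * _); have [_] := along_monomial u v mm; rewrite Em.
Qed.

End Along.

Lemma map_along (k A A' : comNzRingType) (phi : {rmorphism k -> A})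
    (psi : {rmorphism A -> A'}) u v (g : {mpoly k[3]}) :
  map_poly psi (along phi u v g) = along (psi \o phi) (psi \o u) (psi \o v) g.
Proof.
rewrite /along mmap_comp.
rewrite (@eq_mmap _ _ _ _ _ (fun i => ((psi \o u) i)%:P + ((psi \o v) i)%:P * 'X)).
  by apply: eq_bigr => m _; rewrite /= map_polyC.
by move=> i /=; rewrite rmorphD rmorphM /= !map_polyC map_polyX.
Qed.

Section Norm.
Variables (A : comNzRingType) (n : nat).
Implicit Types p g h : {poly A}.

(** For p monic of degree n + 1 this is the companion matrix, acting on row vectors as
    multiplication by y in the basis 1, y, ..., y^n. The dimension is a parameter and is not read
    off from p, so that ring morphisms commute with the construction. *)
Definition root_mx p : 'M[A]_n.+1 :=
  \matrix_(i, j) if (i == n :> nat) then - p`_j else (i.+1 == j :> nat)%:R.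

(* The norm to A of the class of g in the free A-algebra A[y]/(p), p monic. *)
Definition nrm p g : A := \det (horner_mx (root_mx p) g).

Lemma nrm1 p : nrm p 1 = 1.
Proof. by rewrite /nrm rmorph1 det1. Qed.

Lemma nrmM p g h : nrm p (g * h) = nrm p g * nrm p h.
Proof. by rewrite /nrm rmorphM /= -det_mulmx. Qed.

Lemma nrmX p g e : nrm p (g ^+ e) = nrm p g ^+ e.
Proof. by elim: e => [|e IHe]; rewrite ?nrm1 // !exprS nrmM IHe. Qed.

Lemma nrmC p c : nrm p c%:P = c ^+ n.+1.
Proof. by rewrite /nrm horner_mx_C det_scalar. Qed.

Section Monic.
Variable p : {poly A}.
Hypotheses (p_mon : p \is monic) (p_size : size p = n.+2).

Lemma char_poly_root_mx : char_poly (root_mx p) = p.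
Proof.
rewrite -[RHS](companionmxK p_mon).
suff E m (e : m = n.+1) : char_poly ((\matrix_(i < m, j < m)
    if (i == m.-1 :> nat) then - p`_j else (i.+1 == j :> nat)%:R) : 'M[A]_m) =
    char_poly (root_mx p) by rewrite -(E (size p).-1) // p_size.
by rewrite e.
Qed.

Lemma horner_root_mx : horner_mx (root_mx p) p = 0.
Proof.
have := Cayley_Hamilton (root_mx p); by rewrite char_poly_root_mx.
Qed.

Lemma nrm_modr g h : nrm p (g + h * p) = nrm p g.
Proof. by rewrite /nrm rmorphD rmorphM /= horner_root_mx mulr0 addr0. Qed.

Lemma nrm_CsubX c : nrm p (c%:P - 'X) = p.[c].
Proof.
rewrite -[in RHS]char_poly_root_mx -/(horner_eval c _) -det_map_mx.
rewrite /nrm; congr (\det _); apply/matrixP => i j.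
rewrite rmorphB /= horner_mx_C horner_mx_X !mxE /=.
by rewrite /horner_eval hornerD hornerN hornerC hornerMn hornerX.
Qed.

End Monic.
End Norm.

Lemma nrm_map (A A' : comNzRingType) (psi : {rmorphism A -> A'}) n
    (p g : {poly A}) :
  psi (nrm n p g) = nrm n (map_poly psi p) (map_poly psi g).
Proof.
rewrite /nrm -det_map_mx; congr (\det _).
rewrite map_horner_mx; congr (horner_mx _ _).
apply/matrixP => i j; rewrite !mxE coef_map /=.
by case: ifP; rewrite ?rmorphN ?rmorph_nat.
Qed.

(** * Norms over an algebraically closed field *)

Definition alg_closed (k : fieldType) : Prop :=
  forall p : {poly k}, size p != 1%N -> exists r, root p r.

Section ClosedPoly.
Variable k : fieldType.
Hypothesis closed : alg_closed k.
Implicit Types (p : {poly k}) (s : seq k).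

Lemma closed_normal p :
  exists rs, p = lead_coef p *: \prod_(r <- rs) ('X - r%:P).
Proof.
have [N] := ubnP (size p); elim: N p => // N IHN p leN.
have [p1|/closed[r]] := boolP (size p == 1%N).
  exists [::]; rewrite big_nil -mul_polyC mulr1 /lead_coef (eqP p1).
  by rewrite [LHS]size1_polyC ?(eqP p1).
have [->|p_nz] := eqVneq p 0.
  by exists [::]; rewrite lead_coef0 scale0r.
move=> /factor_theorem[h Eh]; have [|rs Ers] := IHN h.
  have h_nz : h != 0 by apply: contraNneq p_nz => h0; rewrite Eh h0 mul0r.
  by move: leN; rewrite Eh size_Mmonic ?monicXsubC // size_XsubC addn2.
exists (r :: rs); rewrite big_cons {1}Eh {1}Ers Eh lead_coef_Mmonic ?monicXsubC //.
by rewrite -scalerAl mulrC.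
Qed.

Lemma exists_nonroot p : p != 0 -> exists c, ~~ root p c.
Proof.
move=> p_nz; have [p1|p1] := boolP (size p == 1%N).
  exists 0; move: p_nz; rewrite [p]size1_polyC ?(eqP p1) // rootC.
  by apply: contraNN => /eqP->.
(* At a root of p - 1 the value of p is 1. *)
have [|r] := closed (p := p - 1).
  have p_gt1 : (1 < size p)%N by rewrite ltn_neqAle eq_sym p1 size_poly_gt0.
  by rewrite size_polyDl // size_polyN size_poly1.
rewrite /root !hornerE subr_eq0 => /eqP Ep.
by exists r; rewrite Ep oner_eq0.
Qed.

End ClosedPoly.

Section ClosedNorm.
Variables (k : fieldType) (n : nat).
Hypothesis closed : alg_closed k.
Implicit Types (p g : {poly k}) (rs : seq k).

Lemma closed_split p : p \is monic -> size p = n.+2 ->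
  exists rs, p = \prod_(r <- rs) ('X - r%:P) /\ size rs = n.+1.
Proof.
move=> p_mon p_size; have [rs] := closed_normal closed p.
rewrite (monicP p_mon) scale1r => Ep; exists rs; split => //.
by move: p_size; rewrite Ep size_prod_XsubC => -[].
Qed.

(** Both sides are multiplicative in g, and g splits into a constant and linear factors; for a
    factor s - y the norm is the characteristic polynomial of the companion matrix at s, that is,
    p(s). *)
Lemma nrm_roots rs g : size rs = n.+1 ->
  nrm n (\prod_(r <- rs) ('X - r%:P)) g = \prod_(r <- rs) g.[r].
Proof.
move=> size_rs; set p := \prod_(r <- rs) _.
have p_mon : p \is monic by apply: monic_prod_XsubC.
have p_size : size p = n.+2 by rewrite size_prod_XsubC size_rs.
have [ss ->] := closed_normal closed g; set c := lead_coef g.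
under [RHS]eq_bigr do rewrite hornerZ horner_prod.
rewrite -mul_polyC nrmM nrmC big_split /= big_const_seq count_predT size_rs.
rewrite iter_mulr_1; congr (_ * _); rewrite exchange_big /=.
elim: ss => [|s ss IHss]; first by rewrite !big_nil nrm1.
rewrite !big_cons nrmM IHss; congr (_ * _).
rewrite (_ : 'X - s%:P = (-1)%:P * (s%:P - 'X)); last first.
  by rewrite polyCN polyC1 mulN1r opprB.
rewrite nrmM nrmC nrm_CsubX // /p horner_prod -size_rs.
rewrite -[_ ^+ size rs]iter_mulr_1 -count_predT -big_const_seq -big_split /=.
by apply: eq_bigr => r _; rewrite !hornerE mulN1r opprB.
Qed.

Lemma nrm_eq0 p g : p \is monic -> size p = n.+2 ->
  nrm n p g = 0 <-> exists2 r, root p r & root g r.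
Proof.
move=> p_mon p_size; have [rs [-> size_rs]] := closed_split p_mon p_size.
rewrite nrm_roots //; split=> [/eqP|[r pr gr]].
  by rewrite prodf_seq_eq0 => /hasP[r r_rs gr]; exists r; rewrite ?root_prod_XsubC.
by apply/eqP; rewrite prodf_seq_eq0; apply/hasP; exists r; rewrite -?root_prod_XsubC.
Qed.

End ClosedNorm.

(** * Multiplicities of norms *)

Section ClosedPoly.
Variable k : fieldType.
Hypothesis closed : alg_closed k.
Implicit Types (p : {poly k}) (s : seq k).

Lemma closed_poly_ext p1 p2 : (forall c, c != 0 -> p1.[c] = p2.[c]) -> p1 = p2.
Proof.
move=> eq12; apply/eqP; rewrite -subr_eq0; apply/negPn/negP => nz.
have /(exists_nonroot closed)[c] : 'X * (p1 - p2) != 0 by rewrite mulf_neq0 ?polyX_eq0.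
rewrite rootM negb_or => /andP[]; rewrite /root hornerX => c_nz.
by rewrite hornerD hornerN eq12 // subrr eqxx.
Qed.

Lemma exists_nonvanishing (T : eqType) (s : seq T) (P : T -> {poly k}) :
  {in s, forall x, P x != 0} -> exists c, {in s, forall x, (P x).[c] != 0}.
Proof.
move=> P_nz; have /(exists_nonroot closed)[c] : \prod_(x <- s) P x != 0.
  by rewrite prodf_seq_neq0; apply/allP => x /P_nz Px; apply/implyP.
rewrite /root horner_prod prodf_seq_neq0 => /allP c_nz.
by exists c => x /c_nz /=.
Qed.

(** Take c = (1, t, t^2): its product with a non-zero vector is a non-zero polynomial in t, and some
    t avoids the roots of all of these. *)
Lemma exists_dot_neq0 (s : seq ('I_3 -> k)) :
  (forall j, (j < size s)%N -> exists i, nth (fun=> 0) s j i != 0) ->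
  exists c : 'I_3 -> k,
    forall j, (j < size s)%N -> dot c (nth (fun=> 0) s j) != 0.
Proof.
move=> s_nz; pose P j : {poly k} :=
  (nth (fun=> 0) s j 0)%:P + (nth (fun=> 0) s j 1)%:P * 'X + (nth (fun=> 0) s j 2)%:P * 'X^2.
have [|t t_nz] := @exists_nonvanishing nat (iota 0 (size s)) P.
  move=> j; rewrite mem_iota add0n => /s_nz [i nz]; apply: contraNneq nz => P0.
  have E m : (P j)`_m = 0 by rewrite P0 coef0.
  elim/ord3_ind: i; [have := E 0%N | have := E 1%N | have := E 2%N];
  by rewrite !coefD !coefCM coefC coefX coefXn /= ?mulr0 ?mulr1 ?addr0 ?add0r => ->.
exists (fun i => [:: 1; t; t ^+ 2]`_i) => j j_s.
have := t_nz j; rewrite mem_iota add0n => /(_ j_s).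
suff <- : (P j).[t] = dot (fun i => [:: 1; t; t ^+ 2]`_i) (nth (fun=> 0) s j) by [].
by rewrite /P /dot !hornerE /=; ring.
Qed.

(** A default value; because of it, a positive multiplicity shows that a polynomial is non-zero. *)
Lemma mup0 (c : k) : mup c 0 = 0%N.
Proof.
apply/eqP; rewrite -leqn0 -ltnS /mup -[X in (_ < X)%N](congr1 S (size_poly0 k)).
exact: ltn_ord.
Qed.

(** The polynomials are reversals of each other with respect to D. As p2 has no degree bound at
    first, it is reversed with respect to its own size e, and 'X^e p1 is compared with 'X^D R. *)
Lemma size_reversal (D : nat) p1 p2 :
  (forall c, c != 0 -> p1.[c] = c ^+ D * p2.[c^-1]) ->
  (size p1 <= D.+1)%N /\ p1`_D = p2`_0.
Proof.
move=> E; pose e := size p2; pose R := \poly_(i < e.+1) p2`_(e - i).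
have ER : 'X^e * p1 = 'X^D * R.
  apply: closed_poly_ext => c c_nz; rewrite !hornerE E // mulrCA.
  congr (_ * _); rewrite horner_poly (@horner_coef_wide _ e.+1) // mulr_sumr.
  rewrite (reindex_inj rev_ord_inj) /=; apply: eq_bigr => i _.
  rewrite subSS mulrCA; congr (_ * _).
  by rewrite exprVn -expfB_cond ?(negPf c_nz) ?leq_subr // subKn // -ltnS.
have Ec j : p1`_(D + j) = R`_(e + j).
  have := congr1 (fun g : {poly k} => g`_(e + (D + j))) ER.
  rewrite /= !coefXnM; have [-> ->] : (e + (D + j) < e)%N = false /\ (e + (D + j) < D)%N = false by lia.
  by have [-> ->] : (e + (D + j) - e = D + j)%N /\ (e + (D + j) - D = e + j)%N by lia.
split; last by have := Ec 0%N; rewrite !addn0 coef_poly ltnSn subnn.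
apply/leq_sizeP => j Dj; rewrite -(subnKC Dj) addSnnS Ec coef_poly addnS.
by rewrite ltnS ltnNge leq_addr.
Qed.

End ClosedPoly.

(** * Simple zeros of norms at transversal intersections *)

Section Transversal.
Variables (k : fieldType) (n : nat) (a b : k).
Hypothesis closed : alg_closed k.
Implicit Types (p g h : {poly {poly k}}).

Local Notation fiber := (map_poly (horner_eval a)).

Lemma horner_fiber g (c : {poly k}) : (fiber g).[c.[a]] = g.[c].[a].
Proof. by rewrite -[g.[c].[a]]/(horner_eval a _) -horner_map. Qed.

Lemma horner_fiberC g (c : k) : (fiber g).[c] = g.[c%:P].[a].
Proof. by rewrite -horner_fiber hornerC. Qed.

(** Division by y - b leaves the remainder g(x, b), which is divisible by x - a. The values of the
    two quotients at (a, b) are the partial derivatives. *)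
Lemma linear_part g : g.[b%:P].[a] = 0 -> exists S1 S2,
  [/\ g = S1 * ('X - b%:P%:P) + (S2 * ('X - a%:P))%:P,
      S1.[b%:P].[a] = (fiber g)^`().[b] & S2.[a] = (g.[b%:P])^`().[a]].
Proof.
move=> g0; have /factor_theorem[S2 ES2] : root g.[b%:P] a by apply/eqP.
have /factor_theorem[S1 ES1] : root (g - (g.[b%:P])%:P) b%:P.
  by rewrite /root !hornerE subrr.
exists S1, S2; rewrite -ES2 -ES1 subrK; split=> //.
  rewrite -[g in RHS](subrK (g.[b%:P])%:P) ES1 rmorphD rmorphM rmorphB /=.
  rewrite !map_polyC map_polyX /= derivD derivC addr0 derivM derivXsubC.
  rewrite -horner_fiberC /horner_eval hornerC !hornerE.
  by rewrite subrr mulr0 add0r.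
by rewrite ES2 derivM derivXsubC !hornerE subrr mulr0 add0r.
Qed.

(* g is compared with the line [l = (y - b) - c (x - a)], c chosen so that l is
   not tangent to [p = 0] at (a, b): modulo p, [g u' = l u] with u invertible on
   the fiber of a, and the norm of l is the value of p along the line. *)
Lemma mup_nrm_transversal p g : p \is monic -> size p = n.+2 ->
  p.[b%:P].[a] = 0 -> g.[b%:P].[a] = 0 ->
  (fiber p)^`().[b] != 0 ->
  (p.[b%:P])^`().[a] * (fiber g)^`().[b] -
    (fiber p)^`().[b] * (g.[b%:P])^`().[a] != 0 ->
  (forall r, root (fiber p) r -> root (fiber g) r -> r = b) ->
  mup a (nrm n p g) = 1%N.
Proof.
move=> p_mon p_size p0 g0 py_nz jac uniq_root.
have [G [H [Ep EG EH]]] := linear_part p0.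
have [S1 [S2 [Eg ES1 ES2]]] := linear_part g0.
move: EG EH ES1 ES2 py_nz jac.
move: (fiber p)^`().[b] (p.[b%:P])^`().[a] (fiber g)^`().[b] (g.[b%:P])^`().[a].
move=> py px gy gx EG EH ES1 ES2 py_nz jac.
have fp_mon : fiber p \is monic by rewrite monic_map.
have fp_size : size (fiber p) = n.+2 by rewrite size_map_poly_id0 ?(monicP p_mon) ?rmorph1 ?oner_eq0.
have [rs [Ers _]] := closed_split closed fp_mon fp_size.
(* With this slope, p restricted to the line y = L(x) has derivative px + c py = 1 at a. *)
pose c := (1 - px) / py.
have Ec : c * py = 1 - px by rewrite /c mulfVK.
pose L : {poly k} := b%:P + c%:P * ('X - a%:P).
pose l : {poly {poly k}} := 'X - L%:P.
(* In terms of l, p = G l + E0 (x - a) and g = S1 l + (c S1 + S2) (x - a); eliminating x - a gives g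
   E0 = l T modulo p. *)
pose E0 := c%:P%:P * G + H%:P.
pose T := S1 * E0 - G * (c%:P%:P * S1 + S2%:P).
(* Adding w g l to both sides of g E0 = l T replaces T by T + w g and E0 by E0 + w l. At the other
   points of the fiber g does not vanish, so a suitable w makes T + w g non-zero there; at b its
   value is that of T, the Jacobian. *)
have [w w_nz] : exists w, {in [seq r <- rs | r != b],
    forall r, ((fiber T).[r]%:P + (fiber g).[r]%:P * 'X).[w] != 0}.
  apply: (exists_nonvanishing closed) => r; rewrite mem_filter => /andP[rb r_rs].
  have : (fiber g).[r] != 0.
    apply: contraNneq rb => gr; apply/eqP/uniq_root; last exact/eqP.
    by rewrite Ers root_prod_XsubC.
  apply: contraNneq => P0; have := congr1 (fun h : {poly k} => h`_1) P0.
  by rewrite /= coefD coefC coefCM coefX mulr1 add0r coef0 => ->.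
pose u := T + w%:P%:P * g; pose u' := E0 + w%:P%:P * l.
have gE0 : g * E0 = l * T + (c%:P%:P * S1 + S2%:P) * p.
  by rewrite Ep Eg /T /E0 /l /L !(polyCD, polyCM, polyCB); ring.
have key : nrm n p g * nrm n p u' = nrm n p l * nrm n p u.
  rewrite -!nrmM -[RHS](nrm_modr p_mon p_size _ (c%:P%:P * S1 + S2%:P)).
  by congr nrm; rewrite /u /u' mulrDr gE0; ring.
have uP : ~~ root (nrm n p u) a.
  rewrite /root -[_.[a]]/(horner_eval a _) nrm_map.
  apply/eqP => /(nrm_eq0 closed _ fp_mon fp_size)[r pr].
  rewrite /root /u rmorphD rmorphM /= map_polyC /=.
  rewrite /horner_eval hornerC hornerD hornerCM.
  have [-> {r pr}|rb] := eqVneq r b.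
    rewrite !horner_fiberC g0 mulr0 addr0 /T /E0 !hornerE EG EH ES1 ES2.
    rewrite Ec subrK mulr1 => E; case/negP: jac; rewrite -(eqP E).
    rewrite mulrDr mulrA [py * c]mulrC Ec; apply/eqP; ring.
  have := w_nz r; rewrite mem_filter rb -root_prod_XsubC -Ers pr => /(_ isT).
  by rewrite !hornerE mulrC => /negPf ->.
have lP : nrm n p l = (-1) ^+ n.+1 * p.[L].
  rewrite -(nrm_CsubX p_mon p_size) (_ : l = (-1)%:P * (L%:P - 'X)).
    by rewrite nrmM nrmC.
  by rewrite /l polyCN polyC1 mulN1r opprB.
have pLE : p.[L] = ('X - a%:P) * (c%:P * G.[L] + H).
  by rewrite {1}Ep !hornerE /L; ring.
have pLa : ~~ root (c%:P * G.[L] + H) a.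
  rewrite /root !hornerE -horner_fiber EH.
  have -> : L.[a] = b by rewrite /L !hornerE subrr mulr0 addr0.
  by rewrite horner_fiberC EG Ec subrK oner_eq0.
have l_mup : mup a (nrm n p l) = 1%N.
  rewrite lP mupMr; last first.
    rewrite /root (_ : (-1) ^+ n.+1 = ((-1) ^+ n.+1)%:P); last by rewrite rmorphXn rmorphN1.
    by rewrite hornerC expf_eq0 oppr_eq0 oner_eq0.
  by rewrite pLE mupMl // -['X - _]expr1 mup_XsubCX eqxx.
have nz1 : nrm n p l * nrm n p u != 0.
  rewrite mulf_neq0 //.
    by apply: contra_eq_neq l_mup => ->; rewrite mup0.
  by apply: contraNneq uP => ->; rewrite root0.
have : mup a (nrm n p g * nrm n p u') = 1%N by rewrite key mupMl // l_mup.
have := nz1; rewrite -key mulf_eq0 negb_or => /andP[g_nz u'_nz].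
rewrite mupM //.
(* The multiplicities for g and u' add up to 1, so it is enough that the first is positive. *)
have : (0 < mup a (nrm n p g))%N.
  rewrite -XsubC_dvd // dvdp_XsubCl /root -[_.[a]]/(horner_eval a _) nrm_map.
  apply/eqP/(nrm_eq0 closed _ fp_mon fp_size); exists b.
    by rewrite /root horner_fiberC p0.
  by rewrite /root horner_fiberC g0.
by lia.
Qed.

End Transversal.

(** * Norms along a pencil of lines *)

Lemma eq_mmap_morph (n : nat) (R A : comNzRingType) (phi phi' : R -> A)
    (u u' : 'I_n -> A) (g : {mpoly R[n]}) :
  phi =1 phi' -> u =1 u' -> mmap phi u g = mmap phi' u' g.
Proof.
by move=> ep eu; apply: eq_bigr => m _; rewrite ep; congr (_ * _); apply: mmap1_eq.
Qed.

Lemma mmap_meval (n : nat) (R A : comNzRingType) (phi : {rmorphism R -> A})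
    (u : 'I_n -> R) (g : {mpoly R[n]}) :
  mmap phi (phi \o u) g = phi g.@[u].
Proof.
rewrite -map_mpoly_mmap; elim/mpoly_ring_ind: g => [c|i|g h IHg IHh|g h IHg IHh].
- by rewrite map_mpolyC // !mevalC.
- by rewrite map_mpolyX !mevalXU.
- by rewrite rmorphD /= !mevalD rmorphD IHg IHh.
- by rewrite rmorphM /= !mevalM rmorphM IHg IHh.
Qed.

Lemma meval_homog (n : nat) (R : comNzRingType) (u : 'I_n -> R) (g : {mpoly R[n]}) m a :
  g \is m.-homog -> g.@[fun i => a * u i] = a ^+ m * g.@[u].
Proof. exact: (@mmap_homog n R R idfun). Qed.

Definition pencil (k : nzRingType) (V W : 'I_3 -> k) : 'I_3 -> {poly k} :=
  fun i => (V i)%:P + (W i)%:P * 'X.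

(* Its roots y correspond to the points U + y Q of the curve f = 0 on the line
   through U and Q. *)
Definition fiber_eq (k : fieldType) (f : {mpoly k[3]}) (Q : 'I_3 -> k)
    (A : comNzRingType) (phi : {rmorphism k -> A}) (U : 'I_3 -> A) : {poly A} :=
  (phi f.@[Q]^-1)%:P * along phi U (phi \o Q) f.

(* Locked, lest unification unfold the determinant. *)
HB.lock Definition fnorm (k : fieldType) (n : nat) (f : {mpoly k[3]})
    (Q : 'I_3 -> k) (A : comNzRingType) (phi : {rmorphism k -> A})
    (U : 'I_3 -> A) (g : {mpoly k[3]}) : A :=
  nrm n (fiber_eq f Q phi U) (along phi U (phi \o Q) g).

Canonical fnorm_unlock := Unlockable fnorm.unlock.

Section FiberNorm.
Variables (k : fieldType) (n : nat) (f : {mpoly k[3]}) (Q : 'I_3 -> k).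

Local Notation fiber_eq := (fiber_eq f Q).
Local Notation fnorm := (fnorm n f Q).

Section Morphism.
Variables (A : comNzRingType) (phi : {rmorphism k -> A}).
Implicit Types (U : 'I_3 -> A) (g h : {mpoly k[3]}).

Local Notation fiber_eq := (fiber_eq phi).
Local Notation fnorm := (fnorm phi).

Lemma fnormM U g h : fnorm U (g * h) = fnorm U g * fnorm U h.
Proof. by rewrite unlock rmorphM /= nrmM. Qed.

Lemma fnormX U g e : fnorm U (g ^+ e) = fnorm U g ^+ e.
Proof. by rewrite unlock rmorphXn /= nrmX. Qed.

Hypotheses (f_hom : f \is n.+1.-homog) (fQ : f.@[Q] != 0).

Lemma fiber_eq_monic U : fiber_eq U \is monic /\ size (fiber_eq U) = n.+2.
Proof.
have [sz co] := along_homog phi U (phi \o Q) f_hom.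
have co1 : (fiber_eq U)`_n.+1 = 1.
  by rewrite coefCM co mmap_meval -rmorphM mulVf ?rmorph1.
have sz' : size (fiber_eq U) = n.+2.
  apply/eqP; rewrite eqn_leq; apply/andP; split.
    apply: leq_trans (size_polyMleq _ _) _; rewrite size_polyC.
    by case: (_ != 0); rewrite ?add1n ?add0n //= (leq_trans (leq_pred _)).
  by rewrite ltnNge; apply/leq_sizeP => /(_ n.+1 (leqnn _))/eqP; rewrite co1 oner_eq0.
by rewrite monicE /lead_coef sz' /= co1.
Qed.

Lemma fnorm_modr U g h : fnorm U (g + h * f) = fnorm U g.
Proof.
have [mon sz] := fiber_eq_monic U.
rewrite unlock rmorphD rmorphM /= -[RHS](nrm_modr mon sz _ ((phi f.@[Q])%:P * along phi U (phi \o Q) h)).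
have E : (phi f.@[Q])%:P * (phi f.@[Q]^-1)%:P = 1 by rewrite -polyCM -rmorphM divff // rmorph1.
by congr (nrm _ _ (_ + _)); rewrite /fiber_eq mulrACA E mul1r.
Qed.

End Morphism.

Lemma eq_fnorm (A : comNzRingType) (phi phi' : {rmorphism k -> A})
    (U U' : 'I_3 -> A) g :
  phi =1 phi' -> U =1 U' -> fnorm phi U g = fnorm phi' U' g.
Proof.
move=> ep eU; have eal h : along phi U (phi \o Q) h = along phi' U' (phi' \o Q) h.
  by apply: eq_mmap_morph => [c|i] /=; rewrite ?ep ?eU.
by rewrite unlock /fiber_eq !eal ep.
Qed.

Lemma fnorm_map (A A' : comNzRingType) (phi : {rmorphism k -> A})
    (psi : {rmorphism A -> A'}) (U : 'I_3 -> A) g :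
  psi (fnorm phi U g) = fnorm (psi \o phi) (psi \o U) g.
Proof.
by rewrite unlock nrm_map /fiber_eq rmorphM /= map_polyC /= !map_along.
Qed.

Definition norm_at (U : 'I_3 -> k) g : k := fnorm idfun U g.

(** The norm as a polynomial in the parameter x of the pencil, whose member at x is the line through
    Q and V + x W; W gives the member at infinity. *)
Definition norm_pencil (V W : 'I_3 -> k) g : {poly k} :=
  fnorm polyC (pencil V W) g.

Lemma eq_norm_at U U' g : U =1 U' -> norm_at U g = norm_at U' g.
Proof. exact: eq_fnorm. Qed.

Lemma norm_pencilM V W g h :
  norm_pencil V W (g * h) = norm_pencil V W g * norm_pencil V W h.
Proof. exact: fnormM. Qed.

Lemma norm_pencilX V W g e : norm_pencil V W (g ^+ e) = norm_pencil V W g ^+ e.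
Proof. exact: fnormX. Qed.

Lemma norm_pencil_modr V W g h : f \is n.+1.-homog -> f.@[Q] != 0 ->
  norm_pencil V W (g + h * f) = norm_pencil V W g.
Proof. by move=> f_hom fQ; apply: fnorm_modr. Qed.

Lemma horner_norm_pencil (V W : 'I_3 -> k) a g :
  (norm_pencil V W g).[a] = norm_at (fun i => V i + a * W i) g.
Proof.
rewrite -[_.[a]]/(horner_eval a _) fnorm_map; apply: eq_fnorm => [c|i] /=.
  by rewrite /horner_eval hornerC.
by rewrite /horner_eval /pencil !hornerE mulrC.
Qed.

End FiberNorm.

Lemma fnorm_base (F k : fieldType) (iota : {rmorphism F -> k}) n
    (f : {mpoly F[3]}) (Q : 'I_3 -> F) (A : comNzRingType)
    (phi : {rmorphism k -> A}) (U : 'I_3 -> A) (g : {mpoly F[3]}) :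
  fnorm n (map_mpoly iota f) (iota \o Q) phi U (map_mpoly iota g) =
  fnorm n f Q (phi \o iota) U g.
Proof.
have eal h : along phi U (phi \o (iota \o Q)) (map_mpoly iota h) =
    along (phi \o iota) U ((phi \o iota) \o Q) h.
  by rewrite /along mmap_map; apply: eq_mmap_morph.
rewrite unlock /fiber_eq !eal; congr (nrm _ (_%:P * _) _).
by rewrite map_mpoly_mmap mmap_meval -fmorphV.
Qed.

Section ClosedFiberNorm.
Variables (k : fieldType) (n : nat) (f : {mpoly k[3]}) (Q : 'I_3 -> k).
Hypothesis closed : alg_closed k.
Hypotheses (f_hom : f \is n.+1.-homog) (fQ : f.@[Q] != 0).
Implicit Types (U V W : 'I_3 -> k) (g : {mpoly k[3]}).

Lemma horner_fiber_eq U y :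
  (fiber_eq f Q idfun U).[y] = f.@[Q]^-1 * f.@[fun i => U i + y * Q i].
Proof. by rewrite hornerM hornerC horner_along. Qed.

Lemma root_fiber_eq U y :
  root (fiber_eq f Q idfun U) y = (f.@[fun i => U i + y * Q i] == 0).
Proof. by rewrite /root horner_fiber_eq mulf_eq0 invr_eq0 (negPf fQ). Qed.

Lemma norm_at_eq0 U g : norm_at n f Q U g = 0 <->
  exists y, f.@[fun i => U i + y * Q i] = 0 /\ g.@[fun i => U i + y * Q i] = 0.
Proof.
have [mon sz] := fiber_eq_monic idfun f_hom fQ U.
have := @nrm_eq0 k n closed _ (along idfun U (idfun \o Q) g) mon sz.
rewrite /norm_at unlock => E; split=> [/E[y]|[y [fy gy]]].
  by rewrite root_fiber_eq /root horner_along => /eqP fy /eqP gy; exists y.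
by apply/E; exists y; rewrite ?root_fiber_eq ?fy // /root horner_along; apply/eqP.
Qed.

(** Replacing U by c U multiplies the n + 1 roots y of the fiber by c, hence each factor g(U + y Q)
    of the norm by c^m. *)
Lemma norm_at_scale U g m c : c != 0 -> g \is m.-homog ->
  norm_at n f Q (fun i => c * U i) g = c ^+ (n.+1 * m) * norm_at n f Q U g.
Proof.
move=> c_nz g_hom; have [mon sz] := fiber_eq_monic idfun f_hom fQ U.
have [rs [Ers size_rs]] := closed_split closed mon sz.
have scaled y : (fun i => c * U i + y * Q i) =1 (fun i => c * (U i + y / c * Q i)).
  by move=> i; field.
have Ers' : fiber_eq f Q idfun (fun i => c * U i) =
    \prod_(r <- [seq c * r | r <- rs]) ('X - r%:P).
  apply: (closed_poly_ext closed) => y _; rewrite horner_fiber_eq (meval_eq _ (scaled y)).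
  rewrite (meval_homog _ _ f_hom) mulrCA -horner_fiber_eq Ers !horner_prod.
  rewrite big_map -size_rs -[_ ^+ size rs]iter_mulr_1 -count_predT -big_const_seq.
  rewrite -big_split /=; apply: eq_bigr => r _.
  by rewrite !hornerE mulrBr mulrC mulfVK.
rewrite /norm_at unlock Ers Ers' !nrm_roots ?size_map // big_map mulnC exprM -size_rs.
rewrite -[_ ^+ size rs]iter_mulr_1 -count_predT -big_const_seq -big_split /=.
apply: eq_bigr => r _; rewrite !horner_along -(mmap_homog _ _ _ g_hom).
by apply: eq_mmap => i /=; ring.
Qed.

(** Since V + c W = c (W + c^-1 V), exchanging V and W reverses the polynomial; its coefficient in
    top degree is the norm at the member W at infinity. *)
Lemma size_norm_pencil V W g m : g \is m.-homog ->
  (size (norm_pencil n f Q V W g) <= (n.+1 * m).+1)%N /\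
  (norm_pencil n f Q V W g)`_(n.+1 * m) = norm_at n f Q W g.
Proof.
move=> g_hom; have [|sz ->] := @size_reversal k closed (n.+1 * m)
  (norm_pencil n f Q V W g) (norm_pencil n f Q W V g).
  move=> c c_nz.
  rewrite horner_norm_pencil.
  rewrite horner_norm_pencil.
  rewrite -(norm_at_scale (fun i => W i + c^-1 * V i) c_nz g_hom).
  apply: eq_norm_at => i.
  by rewrite mulrDr mulVKf // addrC.
split=> //; rewrite -horner_coef0 horner_norm_pencil; apply: eq_norm_at => i.
by rewrite mul0r addr0.
Qed.

End ClosedFiberNorm.

(** * Hasse derivatives and p-th powers *)

Lemma pchar_expn (R : comNzRingType) p s :
  p \in [pchar R] -> [pchar R].-nat (p ^ s)%N.
Proof.
move=> pR; rewrite (eq_pnat _ (pcharf_eq pR)).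
by rewrite pnatX pnat_id ?(pcharf_prime pR).
Qed.

Lemma sum_exp_pchar (R : comNzRingType) p s (I : Type) (r : seq I) (P : pred I)
    (F : I -> R) :
  p \in [pchar R] ->
  (\sum_(i <- r | P i) F i) ^+ (p ^ s) = \sum_(i <- r | P i) F i ^+ (p ^ s).
Proof.
move=> pR; apply: (big_morph (fun z : R => z ^+ (p ^ s))).
  by move=> a b; rewrite exprDn_pchar ?pchar_expn.
by rewrite expr0n expn_eq0 eqn0Ngt prime_gt0 ?(pcharf_prime pR).
Qed.

Lemma exp_pchar_inj (R : idomainType) p s : p \in [pchar R] ->
  injective (fun z : R => z ^+ (p ^ s)).
Proof.
move=> pR a b /= /eqP; rewrite -subr_eq0.
rewrite (_ : a ^+ _ - b ^+ _ = (a - b) ^+ (p ^ s)).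
  by rewrite expf_eq0 => /andP[_]; rewrite subr_eq0 => /eqP.
have := exprDn_pchar (a - b) b (pchar_expn s pR).
by rewrite subrK => ->; rewrite addrK.
Qed.

(** * Elements both separable and purely inseparable over a subfield *)

Section SubfieldDescent.
(* A subfield of K given by a predicate that need not be decidable. *)
Variables (K : fieldType) (B : K -> Prop).
Hypotheses (B1 : B 1) (BB : forall a b, B a -> B b -> B (a - b)).
Hypotheses (BM : forall a b, B a -> B b -> B (a * b)).
Hypotheses (BV : forall a, B a -> B a^-1).

Local Notation polyB p := (forall i : nat, B p`_i).

Lemma subfield0 : B 0. Proof. by rewrite -(subrr 1); apply: BB. Qed.

Lemma subfieldN a : B a -> B (- a).
Proof. by move=> Ba; rewrite -[- a]add0r; apply: BB => //; apply: subfield0. Qed.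

Lemma subfieldD a b : B a -> B b -> B (a + b).
Proof. by move=> Ba Bb; rewrite -[b]opprK; apply: BB => //; apply: subfieldN. Qed.

Lemma subfieldX a e : B a -> B (a ^+ e).
Proof. by move=> Ba; elim: e => [|e IHe]; rewrite ?expr0 // exprS; apply: BM. Qed.

Lemma subfield_sum I (r : seq I) (P : pred I) F :
  (forall i, P i -> B (F i)) -> B (\sum_(i <- r | P i) F i).
Proof. by move=> BF; elim/big_rec: _ => [|i a /BF Ba]; [exact: subfield0 | exact: subfieldD]. Qed.

Lemma polyB_sub_mul (p q : {poly K}) c e : polyB p -> polyB q -> B c ->
  polyB (p - c *: 'X^e * q).
Proof.
move=> Bp Bq Bc i; rewrite coefB -scalerAl coefZ coefXnM; apply: BB => //.
by apply: BM => //; case: ifP => // _; apply: subfield0.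
Qed.

(** Euclid's algorithm, one cancellation of leading terms at a time, keeps the coefficients in B.
    The result agrees with [gcdp] only up to a constant of K. *)
Lemma gcdp_descent (p q : {poly K}) : polyB p -> polyB q ->
  exists2 g : {poly K}, polyB g & g %= gcdp p q.
Proof.
have [N] := ubnP (size p + size q); elim: N p q => // N IHN p q leN Bp Bq.
wlog le_qp : p q leN Bp Bq / (size q <= size p)%N => [IHw|].
  have [|/ltnW le_pq] := leqP (size q) (size p); first exact: IHw.
  have leN' : (size q + size p < N.+1)%N by rewrite addnC.
  have [g Bg Eg] := IHw q p leN' Bq Bp le_pq.
  by exists g => //; apply: eqp_trans Eg (gcdpC _ _).
have [->|q_nz] := eqVneq q 0; first by exists p => //; rewrite gcdp0 eqpxx.
have [p0|p_nz] := eqVneq p 0.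
  by move: le_qp; rewrite p0 size_poly0 leqn0 size_poly_eq0 (negPf q_nz).
pose m := lead_coef p / lead_coef q *: 'X^(size p - size q) * q.
have Bc : B (lead_coef p / lead_coef q) by apply: BM (Bp _) (BV (Bq _)).
have size_m : size m = size p.
  rewrite /m -scalerAl size_scale; last by rewrite mulf_neq0 ?invr_eq0 ?lead_coef_eq0.
  by rewrite mulrC size_mulXn // subnK.
have lead_m : m`_(size p).-1 = lead_coef p.
  have : lead_coef m = lead_coef p.
    by rewrite /m lead_coefM lead_coefZ lead_coefXn mulr1 mulfVK ?lead_coef_eq0.
  by rewrite {1}/lead_coef size_m.
have [|||g Bg Eg] := IHN (p - m) q.
- apply: (@leq_trans (size p + size q)%N); last by rewrite -ltnS.
  rewrite ltn_add2r.
  have p_gt0 : (0 < size p)%N by rewrite size_poly_gt0.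
  rewrite -(prednK p_gt0) ltnS; apply/leq_sizeP => j; rewrite leq_eqVlt.
  case/predU1P => [<-|lt_j]; first by rewrite coefB lead_m subrr.
  have le_j : (size p <= j)%N by rewrite -(prednK p_gt0).
  by rewrite coefB !nth_default ?subrr // size_m.
- exact: polyB_sub_mul.
- by [].
exists g => //; apply: eqp_trans Eg _.
apply: eqp_trans (gcdpC _ _) _; rewrite eqp_sym.
apply: eqp_trans (gcdpC _ _) _; rewrite eqp_sym /m addrC -mulNr.
exact: gcdp_addl_mul.
Qed.

(** The gcd of P and X^p - y^p = (X - y)^p is a power of X - y, and separability of P leaves only
    the first power. As the gcd has a multiple with coefficients in B, its root y lies in B. *)
Lemma purely_inseparable_separable p y (P : {poly K}) :
  p \in [pchar K] -> B (y ^+ p) -> polyB P -> separable_poly P -> root P y ->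
  B y.
Proof.
move=> pK Byp BP sepP Py; have pr_p := pcharf_prime pK.
have EX : ('X - y%:P) ^+ p = 'X^p - (y ^+ p)%:P.
  have pX : p \in [pchar {poly K}] by rewrite pchar_poly.
  have p_nat : [pchar {poly K}].-nat p by rewrite -[p]expn1 pchar_expn.
  by rewrite exprDn_pchar // exprNn_pchar // rmorphXn.
have [||g Bg Eg] := @gcdp_descent P ('X^p - (y ^+ p)%:P) => //.
  move=> i; rewrite coefB coefXn coefC; apply: BB.
    by case: (i == p) => //; exact: subfield0.
  by case: (i == 0%N) => //; exact: subfield0.
have /dvdp_exp_XsubCP[m _ Em] : g %| ('X - y%:P) ^+ p.
  by rewrite EX (eqp_dvdl _ Eg) dvdp_gcdr.
have m_gt0 : (0 < m)%N.
  have : 'X - y%:P %| ('X - y%:P) ^+ m.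
    rewrite -(eqp_dvdr _ Em) (eqp_dvdr _ Eg) dvdp_gcd -EX dvdp_XsubCl Py /=.
    by rewrite dvdp_exp // prime_gt0.
  by case: (m) => //; rewrite expr0 dvdp1 size_XsubC.
have m_le1 : (m <= 1)%N.
  rewrite leqNgt; apply/negP => m_gt1.
  have : ('X - y%:P) * ('X - y%:P) %| P.
    rewrite -expr2 (dvdp_trans (dvdp_exp2l _ m_gt1)) //.
    by rewrite -(eqp_dvdl _ Em) (eqp_dvdl _ Eg) dvdp_gcdl.
  move/(separable_coprime sepP).
  by rewrite coprimepp size_XsubC.
have {m m_gt0 m_le1 Em} /eqpP[[c1 c2] /= /andP[c1_nz c2_nz] Ec] : g %= 'X - y%:P.
  by case: m m_gt0 m_le1 Em => [|[|]].
have E0 : c1 * g`_0 = - (c2 * y).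
  have := congr1 (fun h : {poly K} => h`_0) Ec.
  by rewrite /= !coefZ coefB coefX coefC /= sub0r mulrN.
have E1 : c1 * g`_1 = c2.
  have := congr1 (fun h : {poly K} => h`_1) Ec.
  by rewrite /= !coefZ coefB coefX coefC /= subr0 mulr1.
have g1_nz : g`_1 != 0 by apply: contraNneq c2_nz => g1; rewrite -E1 g1 mulr0.
have -> : y = - (g`_0 / g`_1).
  by apply: (mulfI c2_nz); rewrite -[LHS]opprK -E0 -E1; field.
by apply: subfieldN; apply: BM => //; apply: BV.
Qed.

End SubfieldDescent.

(** The Leibniz rule says that the Taylor expansion sum_j (D_j y) T^j is multiplicative in y;
    truncation at N does not affect the coefficients below N. *)
Lemma coef_exp_hasse (K : comNzRingType) (D : nat -> K -> K) N e y i :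
  (forall i (y z : K), D i (y * z) = \sum_(j < i.+1) D j y * D (i - j)%N z) ->
  (forall i, D i 1 = (i == 0%N)%:R) ->
  (i < N)%N -> ((\poly_(j < N) D j y) ^+ e)`_i = D i (y ^+ e).
Proof.
move=> DM D1; elim: e i => [|e IHe] i lt_iN; first by rewrite !expr0 coef1 D1.
rewrite !exprS coefM DM; apply: eq_bigr => j _.
rewrite IHe ?coef_poly; last by rewrite (leq_ltn_trans (leq_subr _ _)).
by rewrite (leq_trans (ltn_ord j)).
Qed.

Section Hasse.
Variables (F : finFieldType) (K : fieldType) (phi : {rmorphism F -> K}).
Variables (t : K) (D : nat -> K -> K).
Hypotheses (ht : separating_variable phi t) (hD : is_hasse_derivative phi t D).
Variables (p : nat) (pF : p \in [pchar F]).

Let pK : p \in [pchar K]. Proof. by rewrite (fmorph_pchar phi). Qed.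
Let p_pr : prime p. Proof. exact: pcharf_prime pF. Qed.

Lemma hasse0 y : D 0 y = y.
Proof. by have [D0 _ _ _] := hD; apply: D0. Qed.

Lemma hasseM i y z : D i (y * z) = \sum_(j < i.+1) D j y * D (i - j)%N z.
Proof. by have [_ _ DM _] := hD; apply: DM. Qed.

Lemma hasse_at0 i : D i 0 = 0.
Proof.
have [_ lin _ _] := hD; have := lin i 1 0 0.
by rewrite rmorph1 !mul1r addr0 => /esym/eqP; rewrite -subr_eq0 addrK => /eqP.
Qed.

Lemma hasseD i y z : D i (y + z) = D i y + D i z.
Proof.
by have [_ lin _ _] := hD; have := lin i 1 y z; rewrite rmorph1 !mul1r.
Qed.

Lemma hasse_sum i (I : Type) (r : seq I) (P : pred I) (G : I -> K) :
  D i (\sum_(j <- r | P j) G j) = \sum_(j <- r | P j) D i (G j).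
Proof. exact: (big_morph _ (hasseD i) (hasse_at0 i)). Qed.

Lemma hasse_t i j : D i (t ^+ j) = t ^+ (j - i) *+ 'C(j, i).
Proof. by have [_ _ _ Dt] := hD; apply: Dt. Qed.

Lemma hasse1 i : D i 1 = (i == 0%N)%:R.
Proof. by rewrite -(expr0 t) hasse_t; case: i => [|i]; rewrite ?bin0n. Qed.

Lemma hasse_phi i a : (0 < i)%N -> D i (phi a) = 0.
Proof.
move=> i_gt0; have [_ lin _ _] := hD; have := lin i a 1 0.
by rewrite mulr1 !addr0 hasse_at0 hasse1 => ->; case: i i_gt0 => // i; rewrite mulr0 addr0.
Qed.

(** The Taylor expansion of y^(p^s) is the p^s-th power of that of y, and this power is taken term
    by term in characteristic p. *)
Lemma hasse_expp s j y :
  D j (y ^+ (p ^ s)) =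
    if (p ^ s %| j)%N then D (j %/ p ^ s) y ^+ (p ^ s) else 0.
Proof.
set e := (p ^ s)%N; have e_gt0 : (0 < e)%N by rewrite expn_gt0 prime_gt0.
rewrite -(@coef_exp_hasse _ _ j.+1 _ _ _ hasseM hasse1) // poly_def.
have pKX : p \in [pchar {poly K}] by rewrite pchar_poly.
rewrite sum_exp_pchar // coef_sum -/e.
under eq_bigr do rewrite exprZn -exprM coefZ coefXn.
case: ifP => [/dvdnP[i Ei]|e_j].
  have lt_i : (i < j.+1)%N by rewrite ltnS Ei leq_pmulr.
  rewrite (bigD1 (Ordinal lt_i)) //= {1}Ei eqxx mulr1 big1 ?addr0 => [|l li].
    by rewrite Ei mulnK.
  case: eqP => [E|_]; last by rewrite mulr0.
  case/eqP: li; apply: val_inj; apply/eqP.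
  by rewrite -(eqn_pmul2r e_gt0) /= -E Ei.
rewrite big1 // => l _; case: eqP => [E|_]; last by rewrite mulr0.
by rewrite E dvdn_mull in e_j.
Qed.

Lemma hasse_expp_mul s j y z : (j < p ^ s)%N ->
  D j (y ^+ (p ^ s) * z) = y ^+ (p ^ s) * D j z.
Proof.
move=> lt_j; rewrite hasseM big_ord_recl subn0 big1 ?addr0 => [|i _].
  by rewrite hasse0.
rewrite hasse_expp lift0 gtnNdvd ?mul0r //.
exact: leq_ltn_trans lt_j.
Qed.

(** The ring K^p[t], with coefficients written as p-th powers. It is a field because a^-1 = a^(p-1)
    (a^-1)^p. *)
Definition in_Kpt (y : K) : Prop :=
  exists c : {poly K}, y = (map_poly (pFrobenius_aut pK) c).[t].

Lemma in_Kpt_expp y : in_Kpt (y ^+ p).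
Proof. by exists y%:P; rewrite map_polyC hornerC. Qed.

Lemma in_Kpt_t : in_Kpt t.
Proof. by exists 'X; rewrite map_polyX hornerX. Qed.

Lemma in_Kpt1 : in_Kpt 1.
Proof. by exists 1; rewrite rmorph1 hornerC. Qed.

Lemma in_KptB a b : in_Kpt a -> in_Kpt b -> in_Kpt (a - b).
Proof.
by move=> [c ->] [c' ->]; exists (c - c'); rewrite rmorphB hornerD hornerN.
Qed.

Lemma in_KptM a b : in_Kpt a -> in_Kpt b -> in_Kpt (a * b).
Proof. by move=> [c ->] [c' ->]; exists (c * c'); rewrite rmorphM hornerM. Qed.

Lemma in_KptV a : in_Kpt a -> in_Kpt a^-1.
Proof.
have [->|a_nz] := eqVneq a 0; first by rewrite invr0.
move=> Ba; have -> : a^-1 = a ^+ p.-1 * a^-1 ^+ p.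
  apply: (mulfI a_nz); rewrite divff // mulrA -exprS prednK ?prime_gt0 //.
  by rewrite -exprMn divff // expr1n.
by apply: in_KptM (in_Kpt_expp _); apply: (subfieldX in_Kpt1 in_KptM).
Qed.

Lemma in_Kpt_phi a : in_Kpt (phi a).
Proof.
have [r _ rK] : bijective (pFrobenius_aut pF) by apply/injF_bij/fmorph_inj.
by rewrite -[a]rK pFrobenius_autE rmorphXn; apply: in_Kpt_expp.
Qed.

Lemma in_Kpt_adjoin z : in_adjoin phi t z -> in_Kpt z.
Proof.
have poly_Kpt (g : {poly F}) : in_Kpt (map_poly phi g).[t].
  rewrite horner_coef; apply: (subfield_sum in_Kpt1 in_KptB) => i _.
  rewrite coef_map; apply: in_KptM (in_Kpt_phi _) _.
  by apply: (subfieldX in_Kpt1 in_KptM); exact: in_Kpt_t.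
by move=> [g [h [_ ->]]]; apply: in_KptM (poly_Kpt g) (in_KptV (poly_Kpt h)).
Qed.

(** Over K^p(t) the element y is purely inseparable, as y^p lies in K^p, and separable, as t is a
    separating variable and F, being perfect, lies in K^p. *)
Lemma in_KptT y : in_Kpt y.
Proof.
have [_ /(_ y)[P [P_ad sepP Py]]] := ht.
apply: (purely_inseparable_separable in_Kpt1 in_KptB in_KptM in_KptV pK _ _ sepP Py).
  exact: in_Kpt_expp.
by move=> i; apply/in_Kpt_adjoin/P_ad.
Qed.

Lemma pbasis_expansion y : exists c : nat -> K, y = \sum_(i < p) c i ^+ p * t ^+ i.
Proof.
have [c ->] := in_KptT y; rewrite horner_coef.
have sumD (I : Type) (r : seq I) (G : I -> K) :
    (forall i, exists c : nat -> K, G i = \sum_(j < p) c j ^+ p * t ^+ j) ->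
    exists c : nat -> K, \sum_(i <- r) G i = \sum_(j < p) c j ^+ p * t ^+ j.
  move=> GE; elim/big_rec: _ => [|i z _ [cz ->]].
    exists (fun=> 0); rewrite big1 // => j _.
    by rewrite expr0n eqn0Ngt prime_gt0 // mul0r.
  have [ci ->] := GE i; exists (fun j => ci j + cz j); rewrite -big_split.
  apply: eq_bigr => j _ /=; rewrite -mulrDl; congr (_ * _).
  by rewrite -[in LHS](pFrobenius_autE pK) -[cz j ^+ p](pFrobenius_autE pK) -rmorphD.
apply: sumD => i; rewrite coef_map /= pFrobenius_autE.
exists (fun j => if j == (i %% p)%N then c`_i * t ^+ (i %/ p) else 0).
have lt_i : (i %% p < p)%N by rewrite ltn_mod prime_gt0.
rewrite (bigD1 (Ordinal lt_i)) //= eqxx big1 ?addr0.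
  by rewrite {2}(divn_eq i p) exprMn exprD -exprM mulrA.
move=> j ji; rewrite ifN; last by apply: contraNneq ji => E; apply/eqP/val_inj.
by rewrite expr0n eqn0Ngt prime_gt0 // mul0r.
Qed.

(** In the expansion z = sum_(i < p) c_i^p t^i the derivatives of order below p treat the c_i^p as
    constants, and D_1 z = 0 forces c_i = 0 for i > 0. *)
Lemma hasse1_kernel z : D 1 z = 0 -> exists u, z = u ^+ p.
Proof.
have [c ->] := pbasis_expansion z => Dz.
have p_gt0 := prime_gt0 p_pr.
have linD j (a : nat -> K) : (j < p)%N ->
    D j (\sum_(i < p) c i ^+ p * a i) = \sum_(i < p) c i ^+ p * D j (a i).
  move=> lt_j; rewrite hasse_sum; apply: eq_bigr => i _.
  by have := @hasse_expp_mul 1 j (c i) (a i); rewrite expn1; apply.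
(* Downward induction on i, m being the number of top indices already reached: D_(i-1) D_1 t^l is 0
   for l < i and equals i for l = i, so that D_(i-1) D_1 z = i c_i^p once the higher c_l vanish; i
   is invertible since 0 < i < p. *)
have c0 m i : (p - m <= i < p)%N -> (0 < i)%N -> c i = 0.
  elim: m i => [|m IHm] i /andP[le_i lt_i] i_gt0; first by move: le_i; rewrite subn0 leqNgt lt_i.
  have [le_i'|lt_i'] := leqP (p - m) i; first by apply: IHm; rewrite ?le_i'.
  have lt_i1 : (i.-1 < p)%N by apply: leq_ltn_trans lt_i; apply: leq_pred.
  have := congr1 (D i.-1) Dz; rewrite hasse_at0 (linD 1%N (fun l => t ^+ l)) ?prime_gt1 //.
  rewrite (linD _ (fun l => D 1 (t ^+ l))) //.
  rewrite (bigD1 (Ordinal lt_i)) //= [X in _ + X]big1 => [|l li].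
    rewrite addr0 hasse_t bin1 (_ : t ^+ (i - 1) *+ i = phi i%:R * t ^+ i.-1 + 0); last first.
      by rewrite addr0 rmorph_nat mulr_natl subn1.
    have [_ lin _ _] := hD; rewrite lin hasse_at0 addr0 hasse_t subnn binn expr0 rmorph_nat mulr1n mulr1.
    move/eqP; rewrite mulf_eq0 expf_eq0 p_gt0 /= => /orP[/eqP //|].
    by rewrite -(dvdn_pcharf pK) gtnNdvd.
  have [l0|l_gt0] := posnP l.
    by rewrite hasse_t l0 bin_small // mulr0n hasse_at0 mulr0.
  have [lt_li|lt_il|El] := ltngtP l i; last by case/eqP: li; apply: val_inj.
    rewrite hasse_t bin1 (_ : t ^+ (l - 1) *+ l = phi l%:R * t ^+ l.-1 + 0); last first.
      by rewrite addr0 rmorph_nat mulr_natl subn1.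
    have [_ lin _ _] := hD; rewrite lin hasse_at0 addr0 hasse_t bin_small ?mulr0n ?mulr0 //.
    by case: (nat_of_ord l) l_gt0 lt_li => // l'; case: (i) i_gt0.
  rewrite IHm ?expr0n ?eqn0Ngt ?p_gt0 ?mul0r // ltn_ord andbT.
  by move: le_i lt_i' lt_il; lia.
exists (c 0%N); rewrite (bigD1 (Ordinal p_gt0)) //= mulr1 big1 ?addr0 // => i i_nz.
have i_gt0 : (0 < i)%N by rewrite lt0n; apply: contraNneq i_nz => E; apply/eqP/val_inj.
by rewrite (c0 p) ?subnn ?ltn_ord // expr0n eqn0Ngt p_gt0 mul0r.
Qed.

(** Once z = u^(p^r), the derivative D_(p^r) z is (D_1 u)^(p^r), so its vanishing makes u a p-th
    power. *)
Lemma hasse_kernel r z :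
  (forall i, (i < r)%N -> D (p ^ i) z = 0) -> exists u, z = u ^+ (p ^ r).
Proof.
elim: r => [|r IHr] Dz; first by exists z.
have [i lt_i|u Eu] := IHr; first by apply: Dz; apply: ltnW.
have := Dz r (ltnSn r); rewrite Eu hasse_expp dvdnn divnn expn_gt0 prime_gt0 //.
move/eqP; rewrite expf_eq0 => /andP[_ /eqP /hasse1_kernel[w ->]].
by exists w; rewrite -exprM -expnS.
Qed.

End Hasse.

(** * The function field of the curve *)

Lemma det_mx33 (R : comNzRingType) (M : 'M[R]_3) :
  \det M = det (M 0) (M 1) (M 2).
Proof.
pose e i j := M (inord i) (inord j).
have eE i j : M i j = e i j by rewrite /e !inord_val.
rewrite (expand_det_row _ 0) sum3E /cofactor.
rewrite !(expand_det_row _ ord0) !big_ord_recl !big_ord0 /cofactor !det_mx11.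
rewrite /det /dot !crossE !mxE !eE /= /bump /=.
rewrite !addr0 !add0n !expr0 !expr1; ring.
Qed.

Lemma det3E (K : fieldType) (u v w : 'rV[K]_3) :
  det3 u v w = det (u 0) (v 0) (w 0).
Proof.
rewrite /det3 det_mx33; apply: eq_det => i; rewrite !mxE.
- by case: splitP => // j; rewrite ord1.
- case: splitP => j /= Ej; first by case: j Ej => [[]].
  rewrite !mxE; case: splitP => l /= El; first by rewrite ord1.
  by move: Ej; rewrite El.
- case: splitP => j /= Ej; first by case: j Ej => [[]].
  rewrite !mxE; case: splitP => l /= El; last by rewrite ord1.
  by move: Ej; rewrite El ord1.
Qed.

Section Proportional.
Variable A : idomainType.
Implicit Types u v w n c : 'I_3 -> A.

Lemma cross_eq0 u v : (forall i, cross u v i = 0) -> forall i j, u i * v j = u j * v i.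
Proof.
move=> c0; have := (c0 0, c0 1, c0 2); rewrite cross0E cross1E cross2E.
move=> [[/eqP]]; rewrite subr_eq0 => /eqP E0 /eqP; rewrite subr_eq0 => /eqP E1.
move=> /eqP; rewrite subr_eq0 => /eqP E2.
by move=> i j; elim/ord3_ind: i; elim/ord3_ind: j;
  first [ done | exact: E0 | exact: E1 | exact: E2
        | exact: (esym E0) | exact: (esym E1) | exact: (esym E2)].
Qed.

Lemma dot_proportional n c u k : (forall i, n i * c k = n k * c i) ->
  c k != 0 -> dot c u = 0 -> dot n u = 0.
Proof.
move=> nc ck cu; apply: (mulfI ck); rewrite mulr0.
have -> : c k * dot n u = n k * dot c u.
  by rewrite /dot !mulrDr !mulrA ![c k * _]mulrC !nc.
by rewrite cu mulr0.
Qed.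

End Proportional.

Lemma linear_form_homog (R : nzRingType) (a : 'I_3 -> R) :
  \sum_i a i *: 'X_i \is [in R[3], 1.-homog].
Proof. by apply: rpred_sum => i _; apply: dhomogZ; rewrite dhomogX /= mdeg1. Qed.

Section FixedByFrobenius.
Variables (F : finFieldType) (K : fieldType) (phi : {rmorphism F -> K}).

Lemma frob_fixed z : z ^+ #|F| = z -> exists a, z = phi a.
Proof.
move=> zq; have : root (map_poly phi ('X^#|F| - 'X)) z.
  by rewrite rmorphB /= map_polyXn map_polyX /root !hornerE zq subrr.
rewrite finField_genPoly rmorph_prod /root horner_prod => /prodf_eq0[a _].
rewrite -/(root _ z) rmorphB /= map_polyX map_polyC root_XsubC => /eqP.
by exists a.
Qed.

Lemma frob_phi a : phi a ^+ #|F| = phi a.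
Proof. by rewrite -rmorphXn expf_card. Qed.

End FixedByFrobenius.

Section Curve.
Variables (F : finFieldType) (K : fieldType) (phi : {rmorphism F -> K}).
Variables (d : nat) (f : {mpoly F[3]}) (X : 'I_3 -> K).
Hypotheses (f_hom : f \is d.-homog) (d_gt1 : (1 < d)%N) (f_nz : f != 0).
Hypothesis vanishP : forall m g, g \is m.-homog ->
  (mmap phi X g = 0 <-> exists h, g = h * f).

Lemma mmap_small_neq0 m g : g \is m.-homog -> (m < d)%N -> g != 0 ->
  mmap phi X g != 0.
Proof.
move=> g_hom lt_md g_nz; apply/eqP => /(vanishP g_hom)[h Eh].
have h_nz : h != 0 by apply: contraNneq g_nz => h0; rewrite Eh h0 mul0r.
have size_hom e (l : {mpoly F[3]}) : l != 0 -> l \is e.-homog -> msize l = e.+1.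
  move=> l_nz l_hom; have := dhomog_uniq l_nz l_hom (dhomog_msize l_hom).
  by move=> /= ->; rewrite prednK // lt0n msize_poly_eq0.
have := msizeM h_nz f_nz; rewrite -Eh (size_hom m g) // (size_hom d f) //.
have : (0 < msize h)%N by rewrite lt0n msize_poly_eq0.
case: (msize h) => // s _. rewrite addSn addnS /= => -[Em].
by move: lt_md; rewrite Em ltnNge leq_addl.
Qed.

Lemma linear_form_neq0 (a : 'I_3 -> F) i : a i != 0 ->
  \sum_j phi (a j) * X j != 0.
Proof.
move=> ai; have <- : mmap phi X (\sum_j a j *: 'X_j) = \sum_j phi (a j) * X j.
  by rewrite rmorph_sum; apply: eq_bigr => j _; rewrite /= mmapZ mmapXU.
apply: mmap_small_neq0 d_gt1 _; first exact: linear_form_homog.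
apply: contraNneq ai => a0; have := congr1 (mcoeff U_(i)) a0.
rewrite mcoeff0 raddf_sum (bigD1 i) //= mcoeffZ mcoeffX eqxx mulr1 big1 ?addr0.
  by move->.
move=> j ji; rewrite mcoeffZ mcoeffX; case: eqP => [/eqP|]; last by rewrite mulr0.
by rewrite eq_mnm1 (negPf ji).
Qed.

Lemma coord_neq0 i : X i != 0.
Proof.
have /= := @linear_form_neq0 (fun j => (j == i)%:R) i; rewrite eqxx oner_eq0.
move=> /(_ isT); rewrite (bigD1 i) //= eqxx rmorph1 mul1r big1 ?addr0 // => j /negPf->.
by rewrite rmorph0 mul0r.
Qed.

(** If X and X^q were parallel, X_1 / X_0 would be fixed by Frobenius, hence lie in F, and a linear
    form would vanish on a curve of degree d > 1. *)
Lemma cross_frob_neq0 : exists i, cross X (fun i => X i ^+ #|F|) i != 0.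
Proof.
apply/existsP; rewrite -negb_forall; apply/negP => /forallP c0.
have := @cross_eq0 K X (fun i => X i ^+ #|F|) (fun i => eqP (c0 i)) 0 1.
move=> E; have [a Ea] : exists a, X 1 / X 0 = phi a.
  apply: frob_fixed; rewrite expr_div_n; apply: (mulfI (coord_neq0 0)).
  rewrite mulrA E mulfK ?expf_neq0 ?coord_neq0 //; rewrite mulrCA divff ?mulr1 //.
  exact: coord_neq0.
have := @linear_form_neq0 (fun j => [:: a; -1; 0]`_j) 1.
rewrite oppr_eq0 oner_eq0 => /(_ isT); rewrite sum3E /=.
by rewrite -Ea divfK ?coord_neq0 // rmorphN1 rmorph0 mulN1r mul0r addr0 subrr eqxx.
Qed.

End Curve.

Lemma dot_exp (R : comNzRingType) p s (u v : 'I_3 -> R) : p \in [pchar R] ->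
  dot u v ^+ (p ^ s) = dot (fun i => u i ^+ (p ^ s)) (fun i => v i ^+ (p ^ s)).
Proof.
move=> pR; rewrite !dotE sum_exp_pchar //.
by apply: eq_bigr => i _; rewrite exprMn.
Qed.

Lemma cross_exp (R : comNzRingType) p s (u v : 'I_3 -> R) i : p \in [pchar R] ->
  cross u v i ^+ (p ^ s) =
  cross (fun i => u i ^+ (p ^ s)) (fun i => v i ^+ (p ^ s)) i.
Proof.
by move=> pR; rewrite /cross exprDn_pchar ?pchar_expn // exprNn_pchar ?pchar_expn // !exprMn.
Qed.

(** * The normal vector along the curve as a p^r-th power *)

Section Osculation.
Variables (F : finFieldType) (K : fieldType) (phi : {rmorphism F -> K}).
Variables (d : nat) (f : {mpoly F[3]}) (X : 'I_3 -> K).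
Hypotheses (f_hom : f \is d.-homog) (d_gt1 : (1 < d)%N) (f_nz : f != 0).
Hypothesis vanishP : forall m g, g \is m.-homog ->
  (mmap phi X g = 0 <-> exists h, g = h * f).
Hypothesis grad_nz : exists i, f^`M(i) != 0.
Variables (t : K) (D : nat -> K -> K).
Hypotheses (ht : separating_variable phi t) (hD : is_hasse_derivative phi t D).
Variables (p s eps : nat).
Hypotheses (pF : p \in [pchar F]) (Eq : #|F| = (p ^ s)%N).

Local Notation q := (p ^ s)%N.
Local Notation Xq := (fun i => X i ^+ q).
Local Notation dX j := (fun i => D j (X i)).
Local Notation G i := (mmap phi X f^`M(i)).

Hypotheses (eps_gt1 : (1 < eps)%N) (eps_nz : det X (dX 1) (dX eps) != 0).
Hypothesis eps_min : forall j, (1 < j < eps)%N -> det X (dX 1) (dX j) = 0.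
Hypothesis frob_tangent : det Xq X (dX 1) = 0.

Let pK : p \in [pchar K]. Proof. by rewrite (fmorph_pchar phi). Qed.
Let p_pr : prime p. Proof. exact: pcharf_prime pF. Qed.

Lemma curve_eq : mmap phi X f = 0.
Proof. by apply/(vanishP f_hom); exists 1; rewrite mul1r. Qed.

Lemma cross_deriv_neq0 : exists i, cross X (dX 1) i != 0.
Proof.
apply/existsP; rewrite -negb_forall; apply: contraNN eps_nz => /forallP c0.
have -> : det X (dX 1) (dX eps) = dot (dX eps) (cross X (dX 1)).
  by rewrite /det /dot !crossE; ring.
by rewrite /dot !(eqP (c0 _)) !mulr0 !addr0.
Qed.

Lemma grad_X : dot (fun i => G i) X = 0.
Proof.
have := congr1 (mmap phi X) (euler_homog f_hom).
rewrite raddf_sum raddfMn /= curve_eq mul0rn dotE => E; rewrite -[RHS]E.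
by apply: eq_bigr => i _; rewrite rmorphM /= mmapXU mulrC.
Qed.

Lemma grad_dX : dot (fun i => G i) (dX 1) = 0.
Proof.
rewrite dotE -(@mmap_deriv _ _ _ phi X f (D 1) (hasseD hD 1)).
- by rewrite curve_eq (hasse_at0 hD).
- by move=> a b; rewrite (hasseM hD) big_ord_recl big_ord1 !(hasse0 hD) addrC.
- by move=> c; apply: (hasse_phi hD).
Qed.

(** G is orthogonal to X and to D_1 X, so it is a multiple of the non-zero vector X x D_1 X;
    determinants with these two rows thus become statements about G. *)
Lemma dot_grad_eq0 u : dot (cross X (dX 1)) u = 0 -> dot (fun i => G i) u = 0.
Proof.
have [k ck] := cross_deriv_neq0.
apply: dot_proportional ck => i.
exact: (ortho2 _ _ grad_X grad_dX).
Qed.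

Lemma grad_frob : dot (fun i => G i) Xq = 0.
Proof.
by apply: dot_grad_eq0; rewrite dotC.
Qed.

Lemma grad_osc j : (j < eps)%N -> dot (fun i => G i) (dX j) = 0.
Proof.
case: j => [|[|j]] lt_j.
- by rewrite -[RHS]grad_X; apply: eq_dot => // i; rewrite (hasse0 hD).
- exact: grad_dX.
- apply: dot_grad_eq0; rewrite -[RHS](@eps_min j.+2) //.
  by rewrite /det /dot !crossE; ring.
Qed.

(** This turns Frobenius non-classicality, a property of the generic point, into a polynomial
    identity that can be evaluated at every point over the algebraic closure. *)
Lemma frob_divides : exists h, \sum_i 'X_i ^+ q * f^`M(i) = h * f.
Proof.
have hom : \sum_i 'X_i ^+ q * f^`M(i) \is (q + d.-1).-homog.
  apply: rpred_sum => i _; apply: dhomogM; last exact: mderiv_homog.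
  by rewrite -[X in X.-homog]mul1n; apply: dhomogMn; rewrite dhomogX /= mdeg1.
apply/(vanishP hom); rewrite raddf_sum /= -[RHS]grad_frob dotE.
by apply: eq_bigr => i _; rewrite rmorphM rmorphXn /= mmapXU mulrC.
Qed.

Lemma grad_neq0 : exists i, G i != 0.
Proof.
have [i fi] := grad_nz; exists i.
apply: (mmap_small_neq0 f_hom f_nz vanishP (mderiv_homog i f_hom)) => //.
by rewrite prednK // ltnW.
Qed.

Section Normalized.
Variable j0 : 'I_3.
Hypothesis Gj0 : G j0 != 0.
Local Notation n := (fun i => G i / G j0).

Let dot_n u : dot (fun i => G i) u = 0 -> dot n u = 0.
Proof.
move=> Gu; have -> : dot n u = (G j0)^-1 * dot (fun i => G i) u.
  by rewrite /dot; ring.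
by rewrite Gu mulr0.
Qed.

Let n_j0 : n j0 = 1. Proof. exact: divff. Qed.

(** In the Leibniz sum only the two extreme terms survive, as the intermediate derivatives of u are
    zero. *)
Lemma hasse_dot j (u v : 'I_3 -> K) : (0 < j)%N ->
  (forall l, (0 < l < j)%N -> forall i, D l (u i) = 0) ->
  D j (dot u v) = dot (fun i => D j (u i)) v + dot u (fun i => D j (v i)).
Proof.
move=> j_gt0 Du; rewrite !dotE (hasse_sum hD) -big_split /=.
apply: eq_bigr => i _; rewrite (hasseM hD) big_ord_recr /= subnn.
rewrite !(hasse0 hD) [LHS]addrC; congr (_ + _).
case: j j_gt0 Du => // j _ Du; rewrite big_ord_recl /= subn0 (hasse0 hD).
rewrite big1 ?addr0 // => l _; rewrite Du ?mul0r //.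
by rewrite /bump /= add1n ltnS ltn_ord.
Qed.

(** Differentiating n.X = 0 and n.X^q = 0 shows that D_j n is orthogonal to X and X^q: n.D_j X = 0
    since j < eps, and D_j X^q = 0 since 0 < j < q. So D_j n is a multiple of n, and its coordinate
    [j0] is D_j 1 = 0. *)
Lemma normal_const j i : (0 < j)%N -> (j < eps)%N -> (j < q)%N -> D j (n i) = 0.
Proof.
elim/ltn_ind: j i => j IHj i j_gt0 lt_jeps lt_jq.
have Dn l : (0 < l < j)%N -> forall i, D l (n i) = 0.
  by move=> /andP[l_gt0 lt_lj] i'; apply: IHj => //; apply: ltn_trans lt_lj _.
have DnX : dot (fun i => D j (n i)) X = 0.
  have := hasse_dot X j_gt0 Dn; rewrite (dot_n grad_X) (hasse_at0 hD).
  by rewrite (dot_n (grad_osc lt_jeps)) addr0.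
have DnXq : dot (fun i => D j (n i)) Xq = 0.
  have := hasse_dot Xq j_gt0 Dn; rewrite (dot_n grad_frob) (hasse_at0 hD).
  move=> ->; rewrite [X in _ + X](_ : _ = 0) ?addr0 // dotE big1 // => l _.
  by rewrite (hasse_expp hD pF) gtnNdvd // mulr0.
have [k] := cross_frob_neq0 f_hom d_gt1 f_nz vanishP; rewrite Eq => ck.
have cj0 : cross X Xq j0 != 0.
  have := ortho2 k j0 (dot_n grad_X) (dot_n grad_frob); rewrite n_j0 mul1r => E.
  by apply: contraNneq ck => c0; rewrite -E c0 mulr0.
apply: (mulIf cj0); rewrite mul0r (ortho2 i j0 DnX DnXq) n_j0 (hasse1 hD).
by rewrite eqn0Ngt j_gt0 mul0r.
Qed.

Lemma normal_expp r : (p ^ r <= q)%N -> (forall l, (l < r)%N -> (p ^ l < eps)%N) ->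
  exists2 w : 'I_3 -> K, forall i, n i = w i ^+ (p ^ r) & w j0 = 1.
Proof.
move=> le_rq lt_eps; have p_gt1 := prime_gt1 p_pr.
have [|w Ew] := @fin_all_exists 'I_3 (fun=> K) (fun i u => n i = u ^+ (p ^ r)).
  move=> i; apply: (hasse_kernel ht hD pF) => l lt_lr; apply: normal_const.
  - by rewrite expn_gt0 prime_gt0.
  - exact: lt_eps.
  - by apply: leq_trans le_rq; rewrite ltn_exp2l.
exists w => //; apply: (exp_pchar_inj (s := r) pK) => /=.
by rewrite -Ew n_j0 expr1n.
Qed.

(** It ensures that the bound j < q of [normal_const] does not stop short of a power p^r >= eps. If
    q < eps, then n = w^q for some w, and n.X^q = 0 gives w.X = 0; both cases D_1 w = 0 and D_1 w !=
    0 are contradictory. *)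
Lemma osculation_le_q : (eps <= q)%N.
Proof.
have p_gt1 := prime_gt1 p_pr.
rewrite leqNgt; apply/negP => lt_qe.
have s_gt0 : (0 < s)%N.
  by case: (s) Eq => // F1; have := finNzRing_gt1 F; rewrite F1.
have q_gt1 : (1 < q)%N by rewrite -(exp1n s) ltn_exp2r.
have [|w Ew wj0] := @normal_expp s (leqnn _).
  by move=> l lt_ls; apply: ltn_trans lt_qe; rewrite ltn_exp2l.
have wX : dot w X = 0.
  apply: (exp_pchar_inj (s := s) pK) => /=; rewrite dot_exp // expr0n.
  rewrite eqn0Ngt (ltnW q_gt1) -[RHS](dot_n grad_frob).
  by apply: eq_dot => // i; rewrite Ew.
have Ewq : (fun i => w i ^+ q) =1 n by move=> i; rewrite Ew.
(* If D_1 w = 0, then w is orthogonal to X and D_1 X, like n; being normalised alike, w = n = w^q.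
   So w has entries in F, and the curve would lie on a line. *)
have [/forallP v0|] := boolP [forall i, D 1 (w i) == 0].
  have wdX : dot w (dX 1) = 0.
    have vX : dot (fun i => D 1 (w i)) X = 0.
      by rewrite dotE big1 // => i _; rewrite (eqP (v0 i)) mul0r.
    have := @hasse_dot 1 w X isT; rewrite wX (hasse_at0 hD) vX add0r => E.
    by rewrite -E // => -[|[]].
  have [k ck] := cross_deriv_neq0.
  have cj0 : cross X (dX 1) j0 != 0.
    have := ortho2 k j0 wX wdX; rewrite wj0 mul1r => E.
    by apply: contraNneq ck => c0; rewrite -E c0 mulr0.
  have wF i : w i ^+ #|F| = w i.
    apply: (mulIf cj0); rewrite Eq Ewq (ortho2 i j0 wX wdX) wj0 mul1r.
    by rewrite (ortho2 i j0 (dot_n grad_X) (dot_n grad_dX)) n_j0 mul1r.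
  have [a Ea] := @fin_all_exists 'I_3 (fun=> F) (fun i a => w i = phi a) (fun i => frob_fixed phi (wF i)).
  have aj0 : a j0 != 0.
    by apply/eqP => a0; have := wj0; rewrite Ea a0 rmorph0 => /eqP; rewrite eq_sym oner_eq0.
  have /eqP[] := linear_form_neq0 f_hom d_gt1 f_nz vanishP aj0.
  by rewrite -[RHS]wX dotE; apply: eq_bigr => i _; rewrite Ea.
rewrite negb_forall => /existsP[k vk].
(* Otherwise D_q n = v^q, and D_q (n.X) = 0 gives v^q.X = 0; also w^q.X = 0. Hence X is a scalar
   times the vector (w x v)^q, whose entries D_1 kills, so that D_1 X is parallel to X. *)
pose v i := D 1 (w i).
have vqX : dot (fun i => v i ^+ q) X = 0.
  have := @hasse_dot q n X (ltnW q_gt1); rewrite (dot_n grad_X) (hasse_at0 hD).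
  rewrite (dot_n (grad_osc lt_qe)) addr0 => E; rewrite [RHS]E.
    apply: eq_dot => // i; rewrite Ew (hasse_expp hD pF) dvdnn divnn.
    by rewrite (ltnW q_gt1).
  by move=> l /andP[l0 lq] i; apply: normal_const => //; apply: ltn_trans lt_qe.
have wqX : dot (fun i => w i ^+ q) X = 0.
  by rewrite -[RHS](dot_n grad_X); apply: eq_dot.
have y_nz : exists l, cross w v l != 0.
  apply/existsP; rewrite -negb_forall; apply/negP => /forallP y0.
  have := cross_eq0 (fun i => eqP (y0 i)) j0 k.
  rewrite wj0 mul1r /v wj0 (hasse1 hD) mulr0 => E.
  by rewrite E eqxx in vk.
have [l yl] := y_nz.
have XE i : X i = X l / cross w v l ^+ q * cross w v i ^+ q.
  apply: (mulIf (expf_neq0 q yl)).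
  rewrite mulrAC divfK ?expf_neq0 // !cross_exp //.
  by apply: ortho2; rewrite dotC.
have [i /eqP[]] := cross_deriv_neq0.
rewrite /cross !(XE (i + 1)) !(XE (i + 2)) ![_ / _ * _]mulrC.
rewrite !(hasse_expp_mul hD pF) //; ring.
Qed.

End Normalized.

Hypothesis quotP : forall y, exists (m : nat) (g h : {mpoly F[3]}),
  [/\ g \is m.-homog, h \is m.-homog, mmap phi X h != 0
    & y = mmap phi X g / mmap phi X h].

(** The roots w_i of the entries of n are quotients of forms; B is a common denominator and w_i =
    A_i / B. The relation G_i = G_j0 w_i^(p^r) is then a congruence of forms modulo f. *)
Lemma gradient_expp : exists r m (B : {mpoly F[3]}) (A : 'I_3 -> {mpoly F[3]}) j0,
  [/\ (eps <= p ^ r)%N,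
      B \is m.-homog /\ (forall i, A i \is m.-homog),
      mmap phi X B != 0, G j0 != 0
    & forall i, exists h,
        f^`M(i) * B ^+ (p ^ r) - f^`M(j0) * A i ^+ (p ^ r) = h * f].
Proof.
(* The least r with eps <= p^r, so that p^l < eps for all l < r. *)
have p_gt1 := prime_gt1 p_pr; pose r := up_log p eps.
have [j0 Gj0] := grad_neq0.
have le_rs : (r <= s)%N by apply: up_log_min => //; apply: osculation_le_q Gj0.
have [|l lt_lr|w Ew wj0] := @normal_expp j0 Gj0 r.
- by rewrite leq_exp2l.
- apply: leq_ltn_trans (up_log_gtn p_gt1 eps_gt1).
  by rewrite leq_exp2l // -ltnS prednK // (leq_ltn_trans _ lt_lr).
pose P i (z : nat * ({mpoly F[3]} * {mpoly F[3]})) :=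
  [/\ z.2.1 \is z.1.-homog, z.2.2 \is z.1.-homog, mmap phi X z.2.2 != 0
    & w i = mmap phi X z.2.1 / mmap phi X z.2.2].
have [|z zP] := @fin_all_exists 'I_3 (fun=> _) P.
  by move=> i; have [m [g [h ?]]] := quotP (w i); exists (m, (g, h)).
have prod_homog (S : pred 'I_3) :
    \prod_(i | S i) (z i).2.2 \is (\sum_(i | S i) (z i).1).-homog.
  elim/big_rec2: _ => [|i h m _ h_hom]; first exact: dhomog1.
  by apply: dhomogM => //; case: (zP i).
pose B := \prod_i (z i).2.2.
pose A i := (z i).2.1 * \prod_(l | l != i) (z l).2.2.
have B_nz : mmap phi X B != 0.
  by rewrite rmorph_prod; apply/prodf_neq0 => i _; case: (zP i).
have AE i : mmap phi X (A i) = w i * mmap phi X B.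
  have [_ _ h_nz ->] := zP i.
  by rewrite /A /B [in RHS](bigD1 i) //= !rmorphM /= mulrA divfK.
have B_hom : B \is (\sum_i (z i).1).-homog by exact: prod_homog.
have A_hom i : A i \is (\sum_i (z i).1).-homog.
  by rewrite (bigD1 i) //=; apply: dhomogM; [case: (zP i) | exact: prod_homog].
exists r, (\sum_i (z i).1)%N, B, A, j0; split=> // [|i]; first exact: up_logP.
have hom : f^`M(i) * B ^+ (p ^ r) - f^`M(j0) * A i ^+ (p ^ r)
    \is (d.-1 + (\sum_i (z i).1) * p ^ r).-homog.
  by apply: rpredB; apply: dhomogM; rewrite ?mderiv_homog ?dhomogMn.
apply/(vanishP hom); rewrite rmorphB !rmorphM !rmorphXn /= AE exprMn -Ew.
by field.
Qed.

End Osculation.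

(** * Norms of forms that do not vanish on the curve *)

Section NormKernel.
Variables (A : idomainType) (n : nat) (p : {poly A}).
Hypotheses (p_mon : p \is monic) (p_size : size p = n.+2).

Lemma row0_root_mxX i j : (i <= n)%N ->
  (root_mx n p ^+ i) 0 j = (i == j :> nat)%:R.
Proof.
elim: i j => [|i IHi] j lt_in; first by rewrite expr0 !mxE.
rewrite exprSr mxE (bigD1 (inord i)) //= IHi; last exact: ltnW.
rewrite inordK ?(leqW lt_in) // eqxx mul1r mxE inordK ?(leqW lt_in) //.
rewrite ltn_eqF // big1 ?addr0 // => l li; rewrite IHi; last exact: ltnW.
case: eqP => [E|]; last by rewrite mul0r.
by case/eqP: li; apply: val_inj; rewrite /= inordK ?(leqW lt_in).
Qed.

Lemma row0_horner_root_mx (r : {poly A}) j : (size r <= n.+1)%N ->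
  horner_mx (root_mx n p) r 0 j = r`_j.
Proof.
move=> size_r; rewrite -{1}[r]coefK poly_def rmorph_sum /= summxE.
under eq_bigr do rewrite linearZ /= rmorphXn /= horner_mx_X mxE.
have [lt_j|le_j] := ltnP j (size r); last first.
  rewrite nth_default // big1 // => i _; rewrite row0_root_mxX.
    by rewrite ltn_eqF ?mulr0 // (leq_trans _ le_j).
  by rewrite -ltnS (leq_trans (ltn_ord i)).
rewrite (bigD1 (Ordinal lt_j)) //= row0_root_mxX ?eqxx ?mulr1; last by rewrite -ltnS.
rewrite big1 ?addr0 // => i ij; rewrite row0_root_mxX.
  by move: ij; rewrite -val_eqE /= => /negPf->; rewrite mulr0.
by rewrite -ltnS (leq_trans (ltn_ord i)).
Qed.

(** Over a domain a zero determinant gives a non-zero row vector killed by the matrix of g. Read as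
    a polynomial v of degree at most n, it is row 0 of its own matrix, so row 0 of the matrix of v
    g, the remainder of v g by p, is zero. *)
Lemma nrm_eq0_annihilator g : nrm n p g = 0 ->
  exists2 v : {poly A}, v != 0 /\ (size v <= n.+1)%N & exists h, v * g = h * p.
Proof.
move=> /eqP/det0P[v v_nz vM]; exists (rVpoly v).
  split; last exact: size_poly.
  by apply: contraNneq v_nz => v0; rewrite -[v]rVpolyK v0 linear0.
have Ediv := Pdiv.IdomainMonic.divp_eq p_mon (rVpoly v * g).
set h := (_ %/ p) in Ediv; set r := (_ %% p) in Ediv.
have size_r : (size r <= n.+1)%N.
  by rewrite -ltnS -p_size ltn_modp monic_neq0.
suff r0 : r = 0 by exists h; rewrite Ediv r0 addr0.
apply/polyP => j; rewrite coef0; have [le_j|lt_j] := leqP n.+1 j.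
  by rewrite nth_default // (leq_trans size_r).
have E : horner_mx (root_mx n p) r = horner_mx (root_mx n p) (rVpoly v * g).
  by rewrite Ediv rmorphD rmorphM /= horner_root_mx // mulr0 add0r.
rewrite -(row0_horner_root_mx (Ordinal lt_j) size_r) E rmorphM /=.
have -> : (horner_mx (root_mx n p) (rVpoly v) * horner_mx (root_mx n p) g) 0 (Ordinal lt_j) =
    (v *m horner_mx (root_mx n p) g) 0 (Ordinal lt_j).
  rewrite !mxE; apply: eq_bigr => l _; congr (_ * _).
  by rewrite row0_horner_root_mx ?size_poly // coef_rVpoly_ord.
by rewrite vM mxE.
Qed.

End NormKernel.

Section NormNonzero.
Variables (F : finFieldType) (K : fieldType) (phi : {rmorphism F -> K}).
Variables (n : nat) (f : {mpoly F[3]}) (X : 'I_3 -> K).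
Hypotheses (f_hom : f \is n.+1.-homog) (n_gt0 : (0 < n)%N) (f_nz : f != 0).
Hypothesis vanishP : forall m g, g \is m.-homog ->
  (mmap phi X g = 0 <-> exists h, g = h * f).
Variables (Q V W : 'I_3 -> F).
Hypotheses (fQ : f.@[Q] != 0) (basis : det V W Q != 0).

Local Notation delta := (det V W Q).
Local Notation ev := (along polyC (pencil V W) (polyC \o Q)).

Let form (a : 'I_3 -> F) : {mpoly F[3]} := \sum_i a i *: 'X_i.

Lemma ev_form a : ev (form a) =
  (dot a V)%:P%:P + (dot a W)%:P%:P * 'X%:P + (dot a Q)%:P%:P * 'X.
Proof.
rewrite /form raddf_sum /= sum3E /along !mmapZ !mmapXU /pencil /dot /=.
by rewrite !(polyCD, polyCM); ring.
Qed.

(** The linear forms dual to the basis V, W, Q take the values delta, delta x and delta y at V + x W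
    + y Q. Monomials in the last two are completed by powers of the first to a common degree E. *)
Lemma homogenization (v : {poly {poly F}}) :
  exists E H, H \is [in F[3], E.-homog] /\ ev H = delta%:P%:P ^+ E * v.
Proof.
pose La := form (cross W Q); pose Lb := form (cross Q V); pose Lc := form (cross V W).
have EV : ev La = delta%:P%:P.
  rewrite ev_form (_ : dot _ V = delta); last by rewrite /det /dot !crossE; ring.
  rewrite (_ : dot _ W = 0); last by rewrite /dot !crossE; ring.
  rewrite (_ : dot _ Q = 0); last by rewrite /dot !crossE; ring.
  by rewrite polyC0 !mul0r !addr0.
have EW : ev Lb = delta%:P%:P * 'X%:P.
  rewrite ev_form (_ : dot _ V = 0); last by rewrite /dot !crossE; ring.
  rewrite (_ : dot _ W = delta); last by rewrite /det /dot !crossE; ring.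
  rewrite (_ : dot _ Q = 0); last by rewrite /dot !crossE; ring.
  by rewrite polyC0 !mul0r add0r addr0.
have EQ : ev Lc = delta%:P%:P * 'X.
  rewrite ev_form (_ : dot _ V = 0); last by rewrite /dot !crossE; ring.
  rewrite (_ : dot _ W = 0); last by rewrite /dot !crossE; ring.
  rewrite (_ : dot _ Q = delta); last by rewrite /det /dot !crossE; ring.
  by rewrite polyC0 !mul0r !add0r.
pose N := (\max_(i < size v) size (v`_i)%R)%N; pose E := (size v + N)%N.
pose mono i j := v`_i`_j *: (Lc ^+ i * Lb ^+ j * La ^+ (E - (i + j))).
exists E, (\sum_(i < size v) \sum_(j < size v`_i) mono i j); split.
  apply: rpred_sum => i _; apply: rpred_sum => j _; apply: dhomogZ.
  have le_ij : (i + j <= E)%N.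
    apply: leq_add; first exact: ltnW.
    by apply: leq_trans (ltnW (ltn_ord j)) _; exact: (@leq_bigmax _ (fun i : 'I_(size v) => size (v`_i))).
  rewrite -[X in X.-homog](subnKC le_ij).
  have hom a e : form a ^+ e \is e.-homog.
    by rewrite -[X in X.-homog]mul1n; apply: dhomogMn; apply: linear_form_homog.
  by apply: dhomogM; [apply: dhomogM|]; apply: hom.
rewrite -[v in RHS]coefK poly_def.
rewrite [RHS]big_distrr raddf_sum /=; apply: eq_bigr => i _.
rewrite -[v`_i in RHS]coefK -[_ *: 'X^i]mul_polyC poly_def [in RHS]rmorph_sum /=.
rewrite mulr_suml mulr_sumr.
rewrite raddf_sum /=; apply: eq_bigr => j _.
have le_ij : (i + j <= E)%N.
  apply: leq_add; first exact: ltnW.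
  by apply: leq_trans (ltnW (ltn_ord j)) _; exact: (@leq_bigmax _ (fun i : 'I_(size v) => size (v`_i))).
rewrite /mono -mul_mpolyC !rmorphM !rmorphXn /= EV EW EQ alongC.
rewrite -mul_polyC polyCM -{2}(subnKC le_ij) !exprD !exprMn rmorphXn /=; ring.
Qed.

(* A vanishing norm gives v of degree at most n in y with v B = 0 on the curve,
   so v = 0 on the curve; the homogenization of v is then divisible by f, which
   has degree n + 1 in y. *)
Lemma norm_pencil_neq0 m B : B \is m.-homog -> mmap phi X B != 0 ->
  norm_pencil n f Q V W B != 0.
Proof.
move=> B_hom B_nz; apply/eqP; rewrite /norm_pencil unlock => N0.
have [mon sz] := fiber_eq_monic polyC f_hom fQ (pencil V W).
have [v [v_nz size_v] [h Eh]] := nrm_eq0_annihilator mon sz N0.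
pose La := \sum_i phi (cross W Q i) * X i.
have La_nz : La != 0.
  apply: contraNneq basis => La0; rewrite /det dotE big1 // => i _.
  have [->|/(linear_form_neq0 f_hom _ f_nz vanishP)] := eqVneq (cross W Q i) 0.
    by rewrite mulr0.
  by rewrite -/La La0 eqxx => /(_ n_gt0).
(* The affine coordinates of the generic point: delta X = La (V + a W + b Q). The map [theta]
   substitutes x = a and y = b. *)
pose a := (\sum_i phi (cross Q V i) * X i) / La.
pose b := (\sum_i phi (cross V W i) * X i) / La.
pose theta := horner_eval b \o map_poly (horner_eval a \o map_poly phi).
have thetaM g h' : theta (g * h') = theta g * theta h' by rewrite /theta rmorphM.
have theta_ev e g : g \is e.-homog ->
    theta (ev g) = (phi delta / La) ^+ e * mmap phi X g.
  move=> g_hom; rewrite -(mmap_homog _ _ _ g_hom).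
  rewrite -[theta _]/((map_poly (horner_eval a \o map_poly phi) (ev g)).[b]).
  rewrite map_along horner_along; apply: eq_mmap_morph => [c|i] /=.
    by rewrite /horner_eval /= map_polyC hornerC.
  rewrite /horner_eval /pencil rmorphD rmorphM /= !map_polyC map_polyX.
  rewrite hornerD hornerM !hornerC hornerX /=.
  rewrite /a /b; have E : phi delta * X i = La * phi (V i) +
      (\sum_i phi (cross Q V i) * X i) * phi (W i) +
      (\sum_i phi (cross V W i) * X i) * phi (Q i).
    rewrite /La !sum3E; elim/ord3_ind: i;
    rewrite /det /dot !crossE !(rmorphD, rmorphB, rmorphM) /=; ring.
  by rewrite [RHS]mulrAC E; field.
have v0 : theta v = 0.
  have : theta (v * ev B) = 0.
    rewrite Eh thetaM.
    have -> : theta (fiber_eq f Q polyC (pencil V W)) = 0.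
      rewrite /fiber_eq thetaM (theta_ev _ _ f_hom).
      have -> : mmap phi X f = 0 by apply/(vanishP f_hom); exists 1; rewrite mul1r.
      by rewrite !mulr0.
    by rewrite mulr0.
  rewrite thetaM (theta_ev _ _ B_hom) => /eqP.
  rewrite mulf_eq0 => /orP[/eqP //|]; rewrite mulf_eq0 (negPf B_nz) orbF.
  by rewrite expf_eq0 mulf_eq0 invr_eq0 (negPf La_nz) fmorph_eq0 (negPf basis) andbF.
have [e [H [H_hom evH]]] := homogenization v.
have : mmap phi X H = 0.
  apply: (mulfI (_ : (phi delta / La) ^+ e != 0)).
    by rewrite expf_neq0 // mulf_neq0 ?invr_eq0 ?fmorph_eq0.
  by rewrite -theta_ev // evH thetaM v0 !mulr0.
move=> /(vanishP H_hom)[l El].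
have El' : delta%:P%:P ^+ e * v = ((f.@[Q])%:P%:P * ev l) * fiber_eq f Q polyC (pencil V W).
  rewrite -evH El rmorphM /= /fiber_eq mulrACA -!polyCM divff //.
  by rewrite mul1r.
have delta_nz : delta%:P%:P ^+ e != 0 :> {poly {poly F}}.
  by rewrite expf_neq0 // !polyC_eq0.
have [l0|l_nz] := eqVneq ((f.@[Q])%:P%:P * ev l) 0.
  by move/eqP: El'; rewrite l0 mul0r mulf_eq0 (negPf delta_nz) (negPf v_nz).
have Esz : size v = (size ((f.@[Q])%:P%:P * ev l) + n.+2).-1.
  rewrite -sz -size_Mmonic // -El' -polyC_exp size_Cmul //.
  by rewrite expf_neq0 // polyC_eq0.
move: size_v; rewrite Esz !addnS /= ltnNge => /negP[].
by rewrite -[X in (X < _)%N]add0n ltn_add2r size_poly_gt0.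
Qed.

End NormNonzero.

(** * Geometry over the algebraic closure *)

Section ProjectivePlane.
Variable F : finFieldType.
Implicit Types (P : P2 F) (v : 'rV[F]_3).

Definition rep P : 'rV[F]_3 := xchoose (existsP (valP P)).

Lemma rep_neq0 P : rep P != 0.
Proof. by have /andP[] := xchooseP (existsP (valP P)). Qed.

Lemma val_P2 P : val P = [set a *: rep P | a : F].
Proof. by have /andP[_ /eqP] := xchooseP (existsP (valP P)). Qed.

Lemma rep_in P : rep P \in val P.
Proof. by rewrite val_P2; apply/imsetP; exists 1; rewrite ?scale1r. Qed.

Lemma in_P2 P v : v \in val P -> exists a, v = a *: rep P.
Proof. by rewrite val_P2 => /imsetP[a _ ->]; exists a. Qed.

Lemma scale_span v a : a != 0 -> [set b *: (a *: v) | b : F] = [set b *: v | b : F].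
Proof.
move=> a_nz; apply/setP => w; apply/imsetP/imsetP => [[b _ ->]|[b _ ->]].
  by exists (b * a); rewrite ?scalerA.
by exists (b / a); rewrite ?scalerA ?divfK.
Qed.

Lemma P2_rep v : v != 0 -> exists P a, a != 0 /\ rep P = a *: v.
Proof.
move=> v_nz; have vP : is_point [set a *: v | a : F].
  by apply/existsP; exists v; rewrite v_nz eqxx.
exists (Sub _ vP : P2 F); have := rep_in (Sub _ vP : P2 F).
rewrite SubK => /imsetP[a _ E]; exists a; split=> //.
by apply: contraNneq (rep_neq0 (Sub _ vP : P2 F)) => a0; rewrite E a0 scale0r.
Qed.

Lemma rep_inj P P' a : rep P = a *: rep P' -> P = P'.
Proof.
move=> E; apply/val_inj; rewrite val_P2 [RHS]val_P2 E scale_span //.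
by apply: contraNneq (rep_neq0 P) => a0; rewrite E a0 scale0r.
Qed.

Lemma in_rational_points n (f : {mpoly F[3]}) P : f \is n.-homog -> (0 < n)%N ->
  (P \in rational_points f) = (f.@[rep P 0] == 0).
Proof.
move=> f_hom n_gt0; rewrite inE; apply/forall_inP/idP => [-> //|/eqP fP v].
  exact: rep_in.
move=> /in_P2[a ->]; rewrite (_ : f.@[(a *: rep P) 0] = a ^+ n * f.@[rep P 0]).
  by rewrite fP mulr0.
by rewrite -meval_homog //; apply: meval_eq => i; rewrite !mxE.
Qed.

Lemma in_line (l : 'cV[F]_3) P : (P \in line l) = (rep P *m l == 0).
Proof.
rewrite inE; apply/forall_inP/idP => [-> //|/eqP Pl v]; first exact: rep_in.
by move=> /in_P2[a ->]; rewrite -scalemxAl Pl scaler0.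
Qed.

End ProjectivePlane.

Section MorphVec.
Variables (R A : comNzRingType) (psi : {rmorphism R -> A}).
Implicit Types u v w : 'I_3 -> R.

Lemma rmorph_dot u v : psi (dot u v) = dot (psi \o u) (psi \o v).
Proof. by rewrite /dot !rmorphD !rmorphM. Qed.

Lemma rmorph_cross u v i : psi (cross u v i) = cross (psi \o u) (psi \o v) i.
Proof. by rewrite /cross rmorphB !rmorphM. Qed.

Lemma rmorph_det u v w : psi (det u v w) = det (psi \o u) (psi \o v) (psi \o w).
Proof.
by rewrite /det rmorph_dot; apply: eq_dot => // i; apply: rmorph_cross.
Qed.

End MorphVec.

Lemma map_mpoly_homog (R : nzRingType) (k : nzRingType) (iota : {rmorphism R -> k})
    (m j : nat) (g : {mpoly R[j]}) :
  g \is m.-homog -> map_mpoly iota g \is m.-homog.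
Proof.
move=> /dhomogP g_hom; apply/dhomogP => mm; rewrite mcoeff_msupp mcoeff_map_mpoly => nz.
by apply: g_hom; rewrite mcoeff_msupp; apply: contraNneq nz => ->; rewrite raddf0.
Qed.

Section Geometry.
Variables (F : finFieldType) (k : fieldType) (iota : {rmorphism F -> k}).
Hypothesis closed : alg_closed k.
Variables (p s n : nat) (f0 u0 : {mpoly F[3]}).
Hypotheses (pF : p \in [pchar F]) (cardF : #|F| = (p ^ s)%N).
Hypotheses (f0_hom : f0 \is n.+1.-homog) (n_gt0 : (0 < n)%N).
Local Notation q := (p ^ s)%N.
Hypothesis frob_div : \sum_i 'X_i ^+ q * f0^`M(i) = u0 * f0.

Local Notation f := (map_mpoly iota f0).
Definition grad (v : 'I_3 -> k) : 'I_3 -> k := fun i => f^`M(i).@[v].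

Hypothesis nonsing : forall v, (exists i, v i != 0) -> f.@[v] = 0 ->
  exists i, grad v i != 0.

Definition frob (v : 'I_3 -> k) : 'I_3 -> k := fun i => v i ^+ q.

Let pk : p \in [pchar k]. Proof. by rewrite (fmorph_pchar iota). Qed.
Let p_pr : prime p. Proof. exact: pcharf_prime pF. Qed.

Lemma q_gt1 : (1 < q)%N.
Proof. by rewrite -cardF finNzRing_gt1. Qed.

Lemma f_hom : f \is n.+1.-homog.
Proof. exact: map_mpoly_homog f0_hom. Qed.

Lemma frob_iota (w : 'I_3 -> F) i : frob (iota \o w) i = iota (w i).
Proof. by rewrite /frob /= -cardF frob_phi. Qed.

Lemma frob_inj : injective (fun z : k => z ^+ q).
Proof. exact: exp_pchar_inj. Qed.

Lemma euler_f : dot (fun i => 'X_i) (fun i => f^`M(i)) = f *+ n.+1.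
Proof. by rewrite -(euler_homog f_hom) dotE. Qed.

Lemma frob_div_f : dot (fun i => 'X_i ^+ q) (fun i => f^`M(i)) = map_mpoly iota u0 * f.
Proof.
rewrite -rmorphM -frob_div rmorph_sum dotE; apply: eq_bigr => i _ /=.
by rewrite rmorphM rmorphXn /= map_mpolyX mderiv_map.
Qed.

Lemma grad_self v : f.@[v] = 0 -> dot (grad v) v = 0.
Proof.
move=> fv; have := congr1 (meval v) euler_f.
rewrite mevalMn fv mul0rn rmorph_dot dotC => E; rewrite -[RHS]E.
by apply: eq_dot => // i; rewrite /= mevalXU.
Qed.

Lemma grad_frob_eq0 v : f.@[v] = 0 -> dot (grad v) (frob v) = 0.
Proof.
move=> fv; have := congr1 (meval v) frob_div_f.
rewrite mevalM fv mulr0 rmorph_dot dotC => E; rewrite -[RHS]E.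
by apply: eq_dot => // i; rewrite /= rmorphXn /= mevalXU.
Qed.

Definition polar (c : 'I_3 -> k) : {mpoly k[3]} :=
  dot (fun i => (c i)%:MP) (fun i => f^`M(i)).

(** The form c.(X x X^q): it vanishes at the fixed points of Frobenius and where c is on the line
    joining a point to its Frobenius image. *)
Definition cform (c : 'I_3 -> k) : {mpoly k[3]} :=
  det (fun i => (c i)%:MP) (fun i => 'X_i) (fun i => 'X_i ^+ q).

Lemma meval_polar c v : (polar c).@[v] = dot c (grad v).
Proof.
by rewrite /polar rmorph_dot; apply: eq_dot => i //; rewrite /= mevalC.
Qed.

Lemma meval_cform c v : (cform c).@[v] = det c v (frob v).
Proof.
rewrite /cform rmorph_det; apply: eq_det => i; first by rewrite /= mevalC.
  by rewrite /= mevalXU.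
by rewrite /= rmorphXn /= mevalXU.
Qed.

Lemma polar_hom c : polar c \is n.-homog.
Proof.
rewrite /polar dotE; apply: rpred_sum => i _; rewrite mul_mpolyC; apply: dhomogZ.
exact: (mderiv_homog i f_hom).
Qed.

Lemma cform_hom c : cform c \is q.+1.-homog.
Proof.
rewrite /cform /det dotE; apply: rpred_sum => i _; rewrite mul_mpolyC; apply: dhomogZ.
have X1 j : 'X_j \is [in k[3], 1.-homog] by rewrite dhomogX /= mdeg1.
have Xq j : 'X_j ^+ q \is [in k[3], q.-homog].
  by rewrite -[X in X.-homog]mul1n; apply: dhomogMn.
have X1q a b : ('X_a * 'X_b ^+ q : {mpoly k[3]}) \is q.+1.-homog.
  exact: dhomogM (X1 a) (Xq b).
by apply: rpredB; apply: X1q.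
Qed.

(* [(N.a)(G.b) - (N.b)(G.a) = (N x G).(a x b)] with [N = X x X^q], and
   [N x G = (X.G) X^q - (X^q.G) X]. *)
Lemma cform_polar a b : exists h,
  cform a * polar b = cform b * polar a + h * f.
Proof.
pose C (c : 'I_3 -> k) : 'I_3 -> {mpoly k[3]} := fun i => (c i)%:MP.
pose Xv : 'I_3 -> {mpoly k[3]} := fun i => 'X_i.
pose Xq : 'I_3 -> {mpoly k[3]} := fun i => 'X_i ^+ q.
pose G : 'I_3 -> {mpoly k[3]} := fun i => f^`M(i).
exists (dot (cross (C a) (C b)) Xq *+ n.+1 - dot (cross (C a) (C b)) Xv * map_mpoly iota u0).
rewrite mulrBl -[_ * _ * f]mulrA -frob_div_f mulrnAl -mulrnAr -euler_f.
rewrite /polar /cform -/(C a) -/(C b) -/Xv -/Xq -/G.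
by rewrite /det /dot !crossE; ring.
Qed.

(** The q-th powers in the last row have derivative zero, so only the middle row is
    differentiated. *)
Lemma deriv_along_cform c U D y :
  (along idfun U D (cform c))^`().[y] = det c D (frob (fun i => U i + y * D i)).
Proof.
pose h : 'I_3 -> {poly k} := fun i => (U i)%:P + (D i)%:P * 'X.
have E : along idfun U D (cform c) = det (fun i => (c i)%:P) h (fun i => h i ^+ q).
  rewrite /cform rmorph_det; apply: eq_det => i; first by rewrite /= alongC.
    by rewrite /= /along mmapXU.
  by rewrite /= rmorphXn /= /along mmapXU.
have s_gt0 : (0 < s)%N by have := q_gt1; case: (s).
have hq i : (h i ^+ q)^`() = 0.
  rewrite deriv_exp -mulr_natl (_ : q%:R = 0 :> {poly k}) ?mul0r //.
  apply/eqP; rewrite -(dvdn_pcharf (_ : p \in [pchar {poly k}])) ?pchar_poly //.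
  exact: dvdn_exp.
have hD i : (h i)^`() = (D i)%:P by rewrite /h !derivE mulr1 add0r.
rewrite E; have -> : (det (fun i => (c i)%:P) h (fun i => h i ^+ q))^`() =
    det (fun i => (c i)%:P) (fun i => (D i)%:P) (fun i => h i ^+ q).
  rewrite /det /dot !crossE !(derivD, derivN, derivM, derivC, derivX, hq).
  by ring.
rewrite -[LHS]/(horner_eval y _) rmorph_det; apply: eq_det => i.
- by rewrite /= /horner_eval hornerC.
- by rewrite /= /horner_eval hornerC.
- by rewrite /= /horner_eval /h /frob !hornerE mulrC.
Qed.

Lemma horner_along_id u v (g : {mpoly k[3]}) y :
  (along idfun u v g).[y] = g.@[fun i => u i + y * v i].
Proof. exact: horner_along. Qed.

Lemma deriv_along_f U D y :
  (along idfun U D f)^`().[y] = dot D (grad (fun i => U i + y * D i)).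
Proof.
rewrite deriv_along -[LHS]/(horner_eval y _) rmorph_sum dotE.
by apply: eq_bigr => i _; rewrite rmorphM /= /horner_eval hornerC horner_along.
Qed.

Lemma frobD u v y i : frob (fun i => u i + y * v i) i = frob u i + y ^+ q * frob v i.
Proof. by rewrite /frob exprDn_pchar ?pchar_expn // exprMn. Qed.

(** Frobenius fixes the coefficients of l, so it maps the line l to itself. *)
Lemma dot_iota_frob (l : 'I_3 -> F) v :
  dot (iota \o l) v = 0 -> dot (iota \o l) (frob v) = 0.
Proof.
move=> lv; have := congr1 (fun z => z ^+ q) lv.
rewrite dot_exp // expr0n eqn0Ngt (ltnW q_gt1) => E; rewrite -[RHS]E.
by apply: eq_dot => // i; rewrite -[LHS]frob_iota.
Qed.

Lemma cramer3 (u v w x : 'I_3 -> k) i :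
  det u v w * x i = det x v w * u i + det u x w * v i + det u v x * w i.
Proof. by elim/ord3_ind: i; rewrite /det /dot !crossE; ring. Qed.

Lemma rational_multiple v : (exists i, v i != 0) ->
  (forall i, cross v (frob v) i = 0) ->
  exists c (w : 'I_3 -> F), [/\ c != 0, exists i, w i != 0
    & forall i, v i = c * iota (w i)].
Proof.
move=> [j vj] /cross_eq0 E; exists (v j).
have [i|w Ew] := @fin_all_exists 'I_3 (fun=> F) (fun i a => v i / v j = iota a).
  apply: frob_fixed; rewrite cardF expr_div_n; apply: (mulIf (expf_neq0 q vj)).
  rewrite divfK ?expf_neq0 // mulrAC; apply: (mulIf vj); rewrite divfK //.
  by have := E i j; rewrite /frob => ->; rewrite mulrC.
exists w; split=> // [|i]; last by rewrite -Ew mulrC divfK.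
exists j; apply/eqP => w0; have := Ew j; rewrite w0 rmorph0 divff // => /eqP.
by rewrite oner_eq0.
Qed.

(** The vectors G and u x v are parallel and non-zero, so c is orthogonal to both or to neither. *)
Lemma det_neq0_normal (c G u v : 'I_3 -> k) i : dot G u = 0 -> dot G v = 0 ->
  dot c G != 0 -> cross u v i != 0 -> det c u v != 0.
Proof.
move=> Gu Gv cG; apply: contraNneq => cN.
apply/eqP; apply: (mulfI cG); rewrite mulr0.
have -> : dot c G * cross u v i = G i * det c u v.
  rewrite /det !dotE mulr_suml mulr_sumr; apply: eq_bigr => j _.
  by rewrite -mulrA (ortho2 j i Gu Gv) mulrCA.
by rewrite cN mulr0.
Qed.

(** The line through U and Q has finitely many points on the curve, all with non-zero gradient. This
    yields an auxiliary c whose polar form has non-zero norm at the fiber. *)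
Lemma fiber_gradients Q U : f.@[Q] != 0 ->
  (forall y, exists i, U i + y * Q i != 0) -> exists c : 'I_3 -> k,
  forall y, f.@[fun i => U i + y * Q i] = 0 ->
    dot c (grad (fun i => U i + y * Q i)) != 0.
Proof.
move=> fQ U_nz; have [mon sz] := fiber_eq_monic idfun f_hom fQ U.
have [rs [Ers _]] := closed_split closed mon sz.
have f_rs r : (r \in rs) = (f.@[fun i => U i + r * Q i] == 0).
  by rewrite -root_prod_XsubC -Ers root_fiber_eq.
have [|c cP] := @exists_dot_neq0 k closed
    [seq grad (fun i => U i + r * Q i) | r <- rs].
  move=> j; rewrite size_map => lt_j; rewrite (nth_map 0) //.
  by apply: nonsing (U_nz _) _; apply/eqP; rewrite -f_rs mem_nth.
exists c => y /eqP; rewrite -f_rs => y_rs; have := cP (index y rs).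
by rewrite size_map index_mem (nth_map 0) ?index_mem // nth_index //; apply.
Qed.

Lemma mup_count_mem (g : {poly k}) : g != 0 ->
  exists rs, size g = (size rs).+1 /\ forall a, mup a g = count_mem a rs.
Proof.
move=> g_nz; have [rs Eg] := closed_normal closed g; exists rs.
rewrite {1}Eg size_scale ?lead_coef_eq0 // size_prod_XsubC; split=> // a.
have -> : mup a g = mup a (\prod_(r <- rs) ('X - r%:P)).
  rewrite Eg -mul_polyC mupMr //.
  by rewrite rootC lead_coef_eq0.
elim: rs {Eg} => [|r rs IHrs]; first by rewrite big_nil mupNroot ?root1.
rewrite big_cons mupM ?polyXsubC_eq0 ?monic_neq0 ?monic_prod_XsubC // IHrs.
by rewrite -['X - _]expr1 mup_XsubCX /=; case: (r == a).
Qed.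

Lemma size_by_mup (p1 p2 : {poly k}) (S : seq k) : p1 != 0 -> p2 != 0 -> uniq S ->
  (forall a, mup a p1 = mup a p2 + (a \in S))%N -> size p1 = (size p2 + size S)%N.
Proof.
move=> /mup_count_mem[rs1 [-> E1]] /mup_count_mem[rs2 [-> E2]] uS E.
have : perm_eq rs1 (rs2 ++ S).
  by apply/allP => a _ /=; rewrite count_cat -E1 -E2 E count_uniq_mem.
by move/perm_size; rewrite size_cat => ->.
Qed.

Lemma size_ge_mup (g : {poly k}) (S : seq k) e : g != 0 -> uniq S ->
  {in S, forall a, (e <= mup a g)%N} -> (size S * e < size g)%N.
Proof.
move=> /mup_count_mem[rs [-> E]] uS le_e; rewrite ltnS.
suff : (size S * e <= count (mem S) rs)%N by move/leq_trans; apply; apply: count_size.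
elim: S uS le_e => [|a S IHS] //= /andP[aS uS] le_e.
rewrite mulSn (@eq_count _ _ (predU (pred1 a) (mem S))); last first.
  by move=> x /=; rewrite !inE.
have disj : count (predI (pred1 a) (mem S)) rs = 0%N.
  apply/eqP; rewrite eqn0Ngt -has_count; apply/hasPn => x _ /=.
  by apply/negP => /andP[/eqP->]; apply/negP.
have := count_predUI (pred1 a) (mem S) rs; rewrite disj addn0 => ->.
apply: leq_add; first by rewrite -E; apply: le_e; rewrite mem_head.
by apply: IHS => // x xS; apply: le_e; rewrite inE xS orbT.
Qed.

(** * The number of rational points *)

Section Count.
Variable Q : 'I_3 -> k.
Hypotheses (fQ : f.@[Q] != 0) (moore : det Q (frob Q) (frob (frob Q)) != 0).

Local Notation W := (frob Q).
Local Notation V := (frob (frob Q)).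
Local Notation delta := (det V W Q).
Local Notation pt a y := (fun i => (V i + a * W i) + y * Q i).
Local Notation vec P := (iota \o (rep P 0)).

Lemma delta_neq0 : delta != 0.
Proof.
have -> : delta = - det Q W V by rewrite /det /dot !crossE; ring.
by rewrite oppr_eq0.
Qed.

(** A line over F through Q also contains its Frobenius images Q^q and Q^(q^2), but these three
    points are independent. *)
Lemma not_on_rational_line (l : 'I_3 -> F) :
  (exists i, l i != 0) -> dot (iota \o l) Q != 0.
Proof.
move=> [i li]; apply/eqP => lQ; have lW := dot_iota_frob lQ.
have := ortho3 i lQ lW (dot_iota_frob lW) => /eqP.
by rewrite mulf_eq0 fmorph_eq0 (negPf li) (negPf moore).
Qed.

(** A rational w on the line Q Q^q is also on its Frobenius image, the line Q^q Q^(q^2); so it is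
    their intersection Q^q. Then Q is rational too, hence on a line over F. *)
Lemma rational_not_at_infinity (w : 'I_3 -> F) :
  (exists i, w i != 0) -> det (iota \o w) W Q != 0.
Proof.
move=> [i wi]; apply/eqP => w0.
have cw : dot (iota \o w) (cross W Q) = 0 by [].
have cw' : dot (iota \o w) (cross V W) = 0.
  rewrite -[RHS](dot_iota_frob cw); apply: eq_dot => // j.
  by rewrite /frob cross_exp.
have vW j : iota (w i) * W j = iota (w j) * W i.
  have := ortho2 i j cw cw'.
  have E l : cross (cross W Q) (cross V W) l = - delta * W l.
    by elim/ord3_ind: l; rewrite /det /dot !crossE; ring.
  rewrite !E !mulrA ![_ * - delta]mulrC -!mulrA.
  by apply: mulfI; rewrite oppr_eq0 delta_neq0.
have vQ j : iota (w i) * Q j = iota (w j) * Q i.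
  apply: frob_inj; rewrite /= !exprMn -[iota (w i) ^+ q]/(frob (iota \o w) i).
  by rewrite -[iota (w j) ^+ q]/(frob (iota \o w) j) !frob_iota; exact: vW.
have [j ij] : exists j, j != i by exists (i + 1); elim/ord3_ind: i {wi vW vQ}.
(* The linear form w_i x_j - w_j x_i, which vanishes at Q. *)
pose l l' := (l' == j)%:R * w i - (l' == i)%:R * w j.
have l_nz : exists l', l l' != 0.
  by exists j; rewrite /l eqxx (negPf ij) mul1r mul0r subr0.
have /eqP[] := not_on_rational_line l_nz.
rewrite dotE (bigD1 j) //= (bigD1 i) 1?eq_sym //= big1 => [|l' /andP[/negPf lj /negPf li]].
  rewrite /l !eqxx (negPf ij) eq_sym (negPf ij) !mul1r !mul0r subr0 sub0r addr0.
  by rewrite vQ rmorphN mulNr subrr.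
by rewrite /l li lj !mul0r subrr rmorph0 mul0r.
Qed.

Lemma pt_coords a y : [/\ det (pt a y) W Q = delta,
  det V (pt a y) Q = a * delta & det V W (pt a y) = y * delta].
Proof. by split; rewrite /det /dot !crossE; ring. Qed.

Lemma pt_neq0 a y : exists i, pt a y i != 0.
Proof.
apply/existsP; rewrite -negb_forall; apply: contraNN delta_neq0 => /forallP pt0.
have [<- _ _] := pt_coords a y.
by rewrite /det /dot !(eqP (pt0 _)) !mul0r !addr0.
Qed.

(* The point P lies on the line of the pencil through Q and V + (aval P) W. *)
Definition aval (P : P2 F) : k := det V (vec P) Q / det (vec P) W Q.
Definition bval (P : P2 F) : k := det V W (vec P) / det (vec P) W Q.

Lemma vec_neq0 (P : P2 F) : exists i, rep P 0 i != 0.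
Proof.
apply/existsP; rewrite -negb_forall; apply: contraNN (rep_neq0 P) => /forallP v0.
by apply/eqP/rowP => i; rewrite mxE; apply/eqP.
Qed.

Lemma vec_pt (P : P2 F) : exists2 c, c != 0 &
  forall i, vec P i = c * pt (aval P) (bval P) i.
Proof.
have inf := rational_not_at_infinity (vec_neq0 P).
exists (det (vec P) W Q / delta) => [|i].
  by rewrite mulf_neq0 // invr_eq0 delta_neq0.
apply: (mulfI delta_neq0); rewrite cramer3 mulrA [delta * _]mulrC divfK ?delta_neq0 //.
by rewrite /aval /bval; field.
Qed.

Lemma vec_coords (P : P2 F) a y c : c != 0 -> (forall i, vec P i = c * pt a y i) ->
  aval P = a /\ bval P = y.
Proof.
move=> c_nz E; have [E1 E2 E3] := pt_coords a y.
have D1 : det (vec P) W Q = c * delta.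
  by rewrite -E1 /det /dot !E; ring.
have D2 : det V (vec P) Q = c * (a * delta).
  by rewrite -E2 /det /dot !crossE !E; ring.
have D3 : det V W (vec P) = c * (y * delta).
  by rewrite -E3 /det /dot !crossE !E; ring.
by rewrite /aval /bval D1 D2 D3; have := delta_neq0; split; field; apply/andP.
Qed.

(** Two distinct rational points on one member of the pencil would make it a line over F through
    Q. *)
Lemma aval_inj (P P' : P2 F) : aval P = aval P' -> P = P'.
Proof.
move=> Ea; have [c c_nz Ec] := vec_pt P; have [c' c'_nz Ec'] := vec_pt P'.
have dep : dot (iota \o (cross (rep P 0) (rep P' 0))) Q = 0.
  rewrite (@eq_dot _ _ (cross (vec P) (vec P')) _ Q) //; last first.
    by move=> i; apply: rmorph_cross.
  by rewrite /dot !crossE !Ec !Ec' Ea; ring.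
have c0 i : cross (rep P 0) (rep P' 0) i = 0.
  apply/eqP/negPn/negP => ci.
  by have /eqP[] := not_on_rational_line (ex_intro _ i ci).
have [j vj] := vec_neq0 P'.
apply: (@rep_inj _ _ _ (rep P 0 j / rep P' 0 j)); apply/rowP => i; rewrite mxE.
by rewrite mulrAC -(cross_eq0 c0) mulfK.
Qed.

Lemma frob_infinity y i : frob (fun i => W i + y * Q i) i = V i + y ^+ q * W i.
Proof. exact: frobD. Qed.

(** On the member Q W at infinity, W + y Q has Frobenius image V + y^q W, which is off that line.
    This makes the norms of [cform Q] and [polar Q] non-zero at infinity, so that their degrees are
    exact. *)
Lemma det_infinity y :
  det Q (fun i => W i + y * Q i) (frob (fun i => W i + y * Q i)) != 0.
Proof.
rewrite (@eq_det _ _ Q _ _ _ _ (fun=> erefl) (fun=> erefl) (frob_infinity y)).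
suff -> : det Q (fun i => W i + y * Q i) (fun i => V i + y ^+ q * W i) = - delta.
  by rewrite oppr_eq0 delta_neq0.
by rewrite /det /dot !crossE; ring.
Qed.

Lemma norm_infinity_cform : norm_at n f Q W (cform Q) != 0.
Proof.
apply/eqP => /(norm_at_eq0 closed f_hom fQ)[y [_]].
by rewrite meval_cform => /eqP; rewrite (negPf (det_infinity y)).
Qed.

Lemma norm_infinity_polar : norm_at n f Q W (polar Q) != 0.
Proof.
apply/eqP => /(norm_at_eq0 closed f_hom fQ)[y [fv]].
rewrite meval_polar dotC => Gv.
have v_nz : exists i, W i + y * Q i != 0.
  apply/existsP; rewrite -negb_forall; apply: contraNN (det_infinity y) => /forallP v0.
  by rewrite /det /dot !crossE !(eqP (v0 _)) !mul0r !subrr !mulr0 !addr0.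
have [i Gi] := nonsing v_nz fv.
have /eqP := ortho3 i Gv (grad_self fv) (grad_frob_eq0 fv).
by rewrite mulf_eq0 (negPf Gi) (negPf (det_infinity y)).
Qed.

Lemma size_norm_pencil_exact m g : g \is m.-homog -> norm_at n f Q W g != 0 ->
  size (norm_pencil n f Q V W g) = (n.+1 * m).+1.
Proof.
move=> g_hom g_inf; have [sz co] := size_norm_pencil closed f_hom fQ V W g_hom.
apply/eqP; rewrite eqn_leq sz ltnNge; apply/leq_sizeP => /(_ _ (leqnn _))/eqP.
by rewrite co (negPf g_inf).
Qed.

Lemma fiber_along a g :
  map_poly (horner_eval a) (along polyC (pencil V W) (polyC \o Q) g) =
  along idfun (fun i => V i + a * W i) (idfun \o Q) g.
Proof.
rewrite map_along; apply: eq_mmap_morph => [c|i] /=.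
  by rewrite /horner_eval hornerC.
by rewrite /horner_eval /pencil !hornerE [W i * a]mulrC.
Qed.

Lemma section_along b g :
  (along polyC (pencil V W) (polyC \o Q) g).[b%:P] =
  along idfun (fun i => V i + b * Q i) W g.
Proof.
rewrite horner_along; apply: eq_mmap_morph => // i.
by rewrite /pencil /= polyCD polyCM; ring.
Qed.

Lemma fiber_fiber_eq a :
  map_poly (horner_eval a) (fiber_eq f Q polyC (pencil V W)) =
  fiber_eq f Q idfun (fun i => V i + a * W i).
Proof.
rewrite /fiber_eq rmorphM /= fiber_along map_polyC /=.
by rewrite /horner_eval hornerC.
Qed.

Lemma rational_value (P : P2 F) : f.@[vec P] = iota f0.@[rep P 0].
Proof. by rewrite map_mpoly_mmap mmap_meval. Qed.

Lemma f_rational P : P \in rational_points f0 -> f.@[pt (aval P) (bval P)] = 0.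
Proof.
rewrite (in_rational_points P f0_hom) // => /eqP fP.
have [c c_nz Ec] := vec_pt P; have := rational_value P; rewrite fP rmorph0.
rewrite (meval_eq _ Ec) (meval_homog _ _ f_hom) => /eqP.
by rewrite mulf_eq0 expf_eq0 (negPf c_nz) andbF => /eqP.
Qed.

Lemma rational_of_fixed a y : f.@[pt a y] = 0 ->
  (forall i, cross (pt a y) (frob (pt a y)) i = 0) ->
  exists2 P, P \in rational_points f0 & aval P = a /\ bval P = y.
Proof.
move=> fy /(rational_multiple (pt_neq0 a y))[c [w [c_nz [i wi] Ew]]].
have w_nz : \row_j w j != 0.
  by apply: contraNneq wi => /rowP/(_ i); rewrite !mxE => ->.
have [P [b [b_nz EP]]] := P2_rep w_nz.
have EP' j : vec P j = iota b / c * pt a y j.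
  by rewrite Ew /= EP !mxE rmorphM mulrA divfK.
have bc_nz : iota b / c != 0 by rewrite mulf_neq0 ?invr_eq0 ?fmorph_eq0.
exists P; last exact: vec_coords bc_nz EP'.
rewrite (in_rational_points P f0_hom) // -(fmorph_eq0 iota) -rational_value.
by rewrite (meval_eq _ EP') (meval_homog _ _ f_hom) fy mulr0.
Qed.

(** At a rational point the curve and [cform c] meet transversally, and by the choice of c they have
    no other common point on the fiber; so [mup_nrm_transversal] applies. *)
Lemma mup_cform_rational c P : P \in rational_points f0 ->
  dot c (grad (pt (aval P) (bval P))) != 0 ->
  (forall y, f.@[pt (aval P) y] = 0 -> dot c (grad (pt (aval P) y)) != 0) ->
  mup (aval P) (norm_pencil n f Q V W (cform c)) = 1%N.
Proof.
set a := aval P; set b := bval P => PA cG cG'.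
have fv : f.@[pt a b] = 0 by apply: f_rational.
have [l l_nz El] := vec_pt P; rewrite -/a -/b in El.
set v : 'I_3 -> k := pt a b in El fv cG.
have frob_v i : l ^+ q * frob v i = l * v i.
  by rewrite -El -[RHS]frob_iota /frob /= -exprMn -El.
have Ev : (fun i => V i + a * W i + b * Q i) =1 v by [].
have Ev' : (fun i => V i + b * Q i + a * W i) =1 v by move=> i; rewrite addrAC.
have gradE u : u =1 v -> grad u =1 grad v by move=> E i; apply: meval_eq.
(* The tangent at a rational point has coefficients in F up to a factor, so it misses Q. *)
have QG : dot Q (grad v) != 0.
  have [i Gi] : exists i, grad v i != 0 by apply: nonsing (pt_neq0 a b) fv.
  pose G0 i := (f0^`M(i)).@[rep P 0].
  have EG j : iota (G0 j) = l ^+ n * grad v j.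
    rewrite /G0 -mmap_meval -map_mpoly_mmap -mderiv_map (meval_eq _ El).
    exact: (meval_homog v l (mderiv_homog j f_hom)).
  have G0_nz : exists j, G0 j != 0.
    by exists i; rewrite -(fmorph_eq0 iota) EG mulf_neq0 ?expf_neq0.
  have := not_on_rational_line G0_nz.
  rewrite (@eq_dot _ _ (fun j => l ^+ n * grad v j) _ Q) //.
  by rewrite dotC dotZr mulf_eq0 negb_or => /andP[].
pose mu := l / l ^+ q.
have mu_nz : mu != 0 by rewrite mulf_neq0 ?invr_eq0 ?expf_neq0.
have Fv i : frob v i = mu * v i.
  by apply: (mulfI (expf_neq0 q l_nz)); rewrite frob_v mulrA /mu mulrCA divff ?expf_neq0 ?mulr1.
have det_frob u w : w =1 v -> det c u (frob w) = mu * det c u v.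
  move=> Ew; rewrite (@eq_det _ c c u u _ (fun i => mu * v i)) //.
    by rewrite /det /dot !crossE; ring.
  by move=> i; rewrite /frob Ew -Fv.
rewrite /norm_pencil unlock.
have [mon sz] := fiber_eq_monic polyC f_hom fQ (pencil V W).
have Ep : (fiber_eq f Q polyC (pencil V W)).[b%:P] =
    (f.@[Q]^-1)%:P * along idfun (fun i => V i + b * Q i) W f.
  by rewrite /fiber_eq hornerM hornerC section_along.
have Epy : (map_poly (horner_eval a) (fiber_eq f Q polyC (pencil V W)))^`().[b] =
    f.@[Q]^-1 * dot Q (grad v).
  rewrite fiber_fiber_eq /fiber_eq derivM derivC mul0r add0r hornerM hornerC.
  by rewrite deriv_along_f.
have Egy : (map_poly (horner_eval a) (along polyC (pencil V W) (polyC \o Q) (cform c)))^`().[b] =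
    mu * det c Q v.
  by rewrite fiber_along deriv_along_cform det_frob.
apply: (@mup_nrm_transversal k n a b closed _ _ mon sz).
- by rewrite Ep hornerM hornerC horner_along_id (meval_eq _ Ev') fv mulr0.
- rewrite section_along horner_along_id (meval_eq _ Ev') meval_cform det_frob //.
  by rewrite /det /dot !crossE; ring.
- by rewrite Epy mulf_neq0 ?invr_eq0.
- rewrite Epy Egy Ep derivM derivC mul0r add0r hornerM hornerC deriv_along_f.
  rewrite section_along deriv_along_cform (det_frob _ _ Ev').
  rewrite (eq_dot (fun=> erefl) (gradE _ Ev')).
  (* The tangent direction of the curve at v in the span of Q and W; up to a factor the Jacobian is
     the derivative of [cform c] along T. *)
  pose T i := dot W (grad v) * Q i - dot Q (grad v) * W i.
  have -> : f.@[Q]^-1 * dot W (grad v) * (mu * det c Q v) -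
      f.@[Q]^-1 * dot Q (grad v) * (mu * det c W v) = f.@[Q]^-1 * mu * det c T v.
    by rewrite /T /det /dot !crossE; ring.
  apply: mulf_neq0; first by rewrite mulf_neq0 ?invr_eq0.
  have [i Ti] : exists i, cross T v i != 0.
    apply/existsP; rewrite -negb_forall; apply/negP => /forallP T0.
    have /eqP : dot Q (cross T v) = 0 by rewrite /dot !(eqP (T0 _)) !mulr0 !addr0.
    rewrite (_ : dot Q (cross T v) = - dot Q (grad v) * det Q W v); last first.
      by rewrite /T /det /dot !crossE; ring.
    rewrite (_ : det Q W v = - delta); last by rewrite /v /det /dot !crossE; ring.
    by rewrite mulf_eq0 !oppr_eq0 (negPf QG) (negPf delta_neq0).
  apply: det_neq0_normal cG Ti; last exact: grad_self.
  by rewrite /T /dot; ring.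
(* A common zero on the fiber is fixed by Frobenius, since c is not orthogonal to the gradient
   there; thus it is rational, and [aval_inj] makes it P. *)
- move=> y; rewrite fiber_fiber_eq fiber_along root_fiber_eq // /root horner_along_id.
  rewrite meval_cform => /eqP fy /eqP cy.
  have [|P' P'A [EaP' EbP']] := rational_of_fixed fy.
    move=> i; apply/eqP/negPn/negP => ci; move/eqP: cy; apply/negP.
    apply: (det_neq0_normal _ _ (cG' y fy) ci); first exact: grad_self.
    exact: grad_frob_eq0.
  by rewrite -EbP' (aval_inj EaP').
Qed.

(** For c with [polar c] non-vanishing on the fiber of a, [cform_polar] shows that the two
    multiplicities differ by that of [cform c]: 1 if the fiber has a rational point, and 0
    otherwise. *)
Lemma mup_count a :
  mup a (norm_pencil n f Q V W (cform Q)) =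
  (mup a (norm_pencil n f Q V W (polar Q)) +
   [exists P in rational_points f0, aval P == a])%N.
Proof.
have [c cG] := fiber_gradients fQ (pt_neq0 a).
have nz1 : norm_pencil n f Q V W (cform Q) != 0.
  by rewrite -size_poly_gt0 (size_norm_pencil_exact (cform_hom Q) norm_infinity_cform).
have nz2 : norm_pencil n f Q V W (polar Q) != 0.
  by rewrite -size_poly_gt0 (size_norm_pencil_exact (polar_hom Q) norm_infinity_polar).
have [h Eh] := cform_polar Q c.
have key : norm_pencil n f Q V W (cform Q) * norm_pencil n f Q V W (polar c) =
    norm_pencil n f Q V W (cform c) * norm_pencil n f Q V W (polar Q).
  by rewrite -!norm_pencilM Eh norm_pencil_modr ?f_hom.
have polar_nz : ~~ root (norm_pencil n f Q V W (polar c)) a.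
  rewrite /root horner_norm_pencil; apply/eqP => /(norm_at_eq0 closed f_hom fQ)[y [fy]].
  by rewrite meval_polar => /eqP; rewrite (negPf (cG y fy)).
have nz3 : norm_pencil n f Q V W (cform c) * norm_pencil n f Q V W (polar Q) != 0.
  by rewrite -key mulf_neq0 //; apply: contraNneq polar_nz => ->; rewrite root0.
have := nz3; rewrite mulf_eq0 negb_or => /andP[nz4 _].
rewrite -(mupMl _ polar_nz) key mupM // addnC; congr (_ + _)%N.
have [/exists_inP[P PA /eqP Ea]|noP] :=
  boolP [exists P in rational_points f0, aval P == a].
  by rewrite -Ea; apply: mup_cform_rational => //; rewrite Ea //; apply: cG; rewrite -Ea; apply: f_rational.
apply: mupNroot; rewrite /root horner_norm_pencil.
apply/eqP => /(norm_at_eq0 closed f_hom fQ)[y [fy]].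
rewrite meval_cform => /eqP; apply/negP.
have [/forallP c0|] := boolP [forall i, cross (pt a y) (frob (pt a y)) i == 0].
  have [|P PA [Ea _]] := rational_of_fixed fy; first by move=> i; apply/eqP.
  by case/negP: noP; apply/exists_inP; exists P => //; apply/eqP.
rewrite negb_forall => /existsP[i ci].
by apply: (det_neq0_normal _ _ (cG y fy) ci); [apply: grad_self | apply: grad_frob_eq0].
Qed.

Lemma card_rational_points_aux :
  (#|rational_points f0| + n.+1 * n = n.+1 * q.+1)%N.
Proof.
pose S := [seq aval P | P in rational_points f0].
have uS : uniq S by rewrite map_inj_uniq ?enum_uniq //; exact: aval_inj.
have E := @size_by_mup (norm_pencil n f Q V W (cform Q)) (norm_pencil n f Q V W (polar Q)) S _ _ uS _.
rewrite !(size_norm_pencil_exact (cform_hom Q) norm_infinity_cform) in E.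
rewrite !(size_norm_pencil_exact (polar_hom Q) norm_infinity_polar) in E.
rewrite size_map -cardE in E; rewrite addnC.
apply: succn_inj; rewrite -addSn -E //.
- by rewrite -size_poly_gt0 (size_norm_pencil_exact (cform_hom Q) norm_infinity_cform).
- by rewrite -size_poly_gt0 (size_norm_pencil_exact (polar_hom Q) norm_infinity_polar).
move=> a; rewrite mup_count; congr (_ + nat_of_bool _)%N.
apply/exists_inP/mapP => [[P PA /eqP <-]|[P]]; first by exists P; rewrite ?mem_enum.
by rewrite mem_enum => PA ->; exists P.
Qed.

End Count.

(** * Lines and the curve, and the choice of a generic point *)

Lemma along_eq0_grad U D y : along idfun U D f = 0 ->
  [/\ f.@[fun i => U i + y * D i] = 0,
      dot (grad (fun i => U i + y * D i)) U = 0
    & dot (grad (fun i => U i + y * D i)) D = 0].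
Proof.
move=> fz; set v := fun i => U i + y * D i.
have fv : f.@[v] = 0 by rewrite -horner_along_id fz horner0.
have GD : dot (grad v) D = 0.
  by rewrite dotC -deriv_along_f fz derivC horner0.
split=> //; rewrite (@eq_dot _ _ (grad v) U (fun i => 1 * v i + - y * D i)) //.
  by rewrite dot_combr grad_self // GD !mulr0 addr0.
by move=> i; rewrite /v; ring.
Qed.

(** Along a line contained in the curve the gradient is a non-zero multiple of U x D, so the i-th
    partial derivative has no zero on the line. But this is a form of degree n > 0. *)
Lemma line_not_in_curve U D i : cross U D i != 0 -> along idfun U D f != 0.
Proof.
move=> ci; apply/eqP => fz.
have nz0 y : exists j, U j + y * D j != 0.
  apply/existsP; rewrite -negb_forall; apply: contraNN ci => /forallP v0.
  have E j : U j = - y * D j by apply/eqP; rewrite mulNr -addr_eq0; apply: v0.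
  by apply/eqP; rewrite /cross !E; ring.
have grad_nz v : (exists j, v j != 0) -> f.@[v] = 0 -> dot (grad v) U = 0 ->
    dot (grad v) D = 0 -> grad v i != 0.
  move=> v_nz fv GU GD; have [j Gj] := nonsing v_nz fv.
  apply: contraNneq Gj => Gi; apply/eqP; apply: (mulIf ci).
  by rewrite (ortho2 j i GU GD) Gi !mul0r.
have [u1|/closed[y]] := boolP (size (along idfun U D f^`M(i)) == 1%N); last first.
  rewrite /root horner_along_id; have [fv GU GD] := along_eq0_grad y fz.
  exact/negP/grad_nz.
(* When the partial derivative is constant in y, its zero is the point D at infinity, reached by
   exchanging U and D: its value there is the coefficient of y^n. *)
have [_ top] := along_homog idfun U D (mderiv_homog i f_hom).
have [_ ftop] := along_homog idfun U D f_hom.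
have gz : along idfun D U f = 0.
  apply: (closed_poly_ext closed) => c c_nz; rewrite horner0 horner_along_id.
  rewrite (meval_eq _ (_ : _ =1 (fun i => c * (U i + c^-1 * D i)))).
    by rewrite (meval_homog _ _ f_hom) -horner_along_id fz horner0 mulr0.
  by move=> j; field.
have [fD GD GU] := along_eq0_grad 0 gz.
have DE : (fun j => D j + 0 * U j) =1 D by move=> j; rewrite mul0r addr0.
have D_nz : exists j, D j + 0 * U j != 0.
  apply/existsP; rewrite -negb_forall; apply: contraNN ci => /forallP D0.
  have Dj j : D j = 0 by have := eqP (D0 j); rewrite mul0r addr0.
  by rewrite /cross !Dj !mulr0 subrr.
have /eqP[] := grad_nz _ D_nz fD GU GD.
rewrite /grad (meval_eq _ DE) -[LHS]top nth_default // (eqP u1).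
by case: (n) n_gt0.
Qed.

Lemma exists_off_curve : exists v, f.@[v] != 0.
Proof.
have c_nz : cross (fun i => (i == 0)%:R : k) (fun i => (i == 1)%:R) 2 != 0.
  by rewrite cross2E /= mulr1 mul0r subr0 oner_eq0.
have [y] := exists_nonroot closed (line_not_in_curve c_nz).
by rewrite /root horner_along_id; eexists; eauto.
Qed.

Lemma XqX_neq0 e : (1 < e)%N -> ('X^e - 'X : {poly k}) != 0.
Proof.
move=> e_gt1; rewrite -size_poly_gt0 size_polyDl size_polyXn //.
by rewrite size_polyN size_polyX.
Qed.

(** At (1, w, w^2) the determinant is of Vandermonde type, non-zero for w outside the fields of q
    and q^2 elements. On the line joining this point to one off the curve, neither condition fails
    identically. *)
Lemma exists_generic : exists Q,
  f.@[Q] != 0 /\ det Q (frob Q) (frob (frob Q)) != 0.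
Proof.
have [v1 fv1] := exists_off_curve.
have q2_gt1 : (1 < q * q)%N by rewrite (leq_trans q_gt1) // leq_pmulr // ltnW // q_gt1.
have [w] := exists_nonroot closed (mulf_neq0 (XqX_neq0 q_gt1) (XqX_neq0 q2_gt1)).
rewrite rootM negb_or /root !hornerE !subr_eq0 => /andP[w1 w2].
pose v2 (i : 'I_3) : k := [:: 1; w; w ^+ 2]`_i.
pose M : {mpoly k[3]} := det (fun i => 'X_i) (fun i => 'X_i ^+ q) (fun i => 'X_i ^+ (q * q)).
have ME v : M.@[v] = det v (frob v) (frob (frob v)).
  rewrite /M rmorph_det; apply: eq_det => i; first by rewrite /= mevalXU.
    by rewrite /= rmorphXn /= mevalXU.
  by rewrite /= rmorphXn /= mevalXU /frob exprM.
have Mv2 : M.@[v2] != 0.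
  rewrite ME (_ : det _ _ _ = (w ^+ q - w) * (w ^+ (q * q) - w) * (w ^+ (q * q) - w ^+ q)).
    rewrite !mulf_neq0 ?subr_eq0 // exprM; apply: contra w1 => /eqP E.
    exact/eqP/frob_inj.
  rewrite /det /dot !crossE /frob /v2 /= !expr1n exprM.
  by rewrite -!exprM ![(2 * _)%N]mulnC !exprM; ring.
have nzM : along idfun v2 v1 M != 0.
  apply: contraNneq Mv2 => M0; have := horner_along_id v2 v1 M 0.
  by rewrite M0 horner0 => ->; apply/eqP/meval_eq => i; rewrite mul0r addr0.
have nzf : along idfun v2 v1 f != 0.
  apply: contraNneq fv1 => fz; have [_] := along_homog idfun v2 v1 f_hom.
  by rewrite fz coef0 => ->; apply/eqP/meval_eq.
have [y] := exists_nonroot closed (mulf_neq0 nzf nzM).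
rewrite rootM negb_or /root !horner_along_id ME => /andP[fy My].
by exists (fun i => v2 i + y * v1 i).
Qed.

Lemma card_rational_points :
  (#|rational_points f0| + n.+1 * n = n.+1 * q.+1)%N.
Proof.
by have [Q [fQ moore]] := exists_generic; apply: card_rational_points_aux fQ moore.
Qed.

Lemma cross_basis (R : comNzRingType) (u v w : 'I_3 -> R) i j : det u v w = 0 ->
  cross u v i * w j = cross w v i * u j + cross u w i * v j.
Proof.
move=> d0; have E : cross u v i * w j - cross w v i * u j - cross u w i * v j =
    (i == j)%:R * det u v w.
  elim/ord3_ind: i; elim/ord3_ind: j;
  by rewrite /det /dot !crossE /= ?mul1r ?mul0r; ring.
by apply/eqP; rewrite -subr_eq0 opprD addrA E d0 mulr0.
Qed.


Lemma exists_line_basis (l : 'I_3 -> F) j : l j != 0 ->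
  exists U D c, c != 0 /\ forall i, cross U D i = c * l i.
Proof.
pose vec3 a b c : 'I_3 -> F := fun i => [:: a; b; c]`_i.
elim/ord3_ind: j => lj.
- exists (vec3 (- l 1) (l 0) 0), (vec3 (- l 2) 0 (l 0)), (l 0); split=> //.
  by elim/ord3_ind; rewrite !crossE /vec3 /=; ring.
- exists (vec3 (l 1) (- l 0) 0), (vec3 0 (- l 2) (l 1)), (- l 1).
  by rewrite oppr_eq0; split=> //; elim/ord3_ind; rewrite !crossE /vec3 /=; ring.
- exists (vec3 (l 2) 0 (- l 0)), (vec3 0 (l 2) (- l 1)), (l 2); split=> //.
  by elim/ord3_ind; rewrite !crossE /vec3 /=; ring.
Qed.

Lemma in_line_dot (l : 'cV[F]_3) (P : P2 F) :
  (P \in line l) = (dot (rep P 0) (fun i => l i 0) == 0).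
Proof.
rewrite in_line; apply/eqP/eqP => [/matrixP/(_ 0 0)|E].
  by rewrite !mxE dotE.
by apply/matrixP => i j; rewrite !ord1 !mxE -dotE.
Qed.

(** Points al U + be D of the section with al != 0 correspond to distinct roots be / al of f(U + y
    D). Only the point D has al = 0; if it lies on the curve, the degree of this polynomial drops by
    at least one. *)
Lemma card_line_section (l : 'cV[F]_3) : l != 0 ->
  (#|rational_points f0 :&: line l| <= n.+1)%N.
Proof.
move=> l_nz; pose lv i := l i 0.
have [j lj] : exists j, lv j != 0.
  apply/existsP; rewrite -negb_forall; apply: contraNN l_nz => /forallP l0.
  by apply/eqP/colP => i; rewrite mxE; apply/eqP/l0.
have [U [D [c [c_nz Ec]]]] := exists_line_basis lj.
have i0_nz : cross U D j != 0 by rewrite Ec mulf_neq0.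
pose al (P : P2 F) := cross (rep P 0) D j / cross U D j.
pose be (P : P2 F) := cross U (rep P 0) j / cross U D j.
pose S := rational_points f0 :&: line l.
have repE P : P \in S -> forall i, rep P 0 i = al P * U i + be P * D i.
  rewrite in_setI in_line_dot => /andP[_ /eqP Pl] i.
  have d0 : det U D (rep P 0) = 0.
    rewrite (_ : det _ _ _ = dot (rep P 0) (cross U D)); last first.
      by rewrite /det /dot !crossE; ring.
    rewrite (@eq_dot _ _ (rep P 0) _ (fun i => c * lv i)) // dotZr Pl mulr0 //.
  apply: (mulfI i0_nz); rewrite (cross_basis j i d0) /al /be; field; exact: i0_nz.
pose g := along idfun U D f0.
have gE y : g.[y] = f0.@[fun i => U i + y * D i] by apply: horner_along.
have g_nz : g != 0.
  have c'_nz : cross (iota \o U) (iota \o D) j != 0.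
    by rewrite -rmorph_cross fmorph_eq0.
  apply: contraNneq (line_not_in_curve c'_nz) => g0; apply/eqP.
  transitivity (map_poly iota g); last by rewrite g0 rmorph0.
  by rewrite /g map_along /along mmap_map; apply: eq_mmap_morph.
have [size_g top_g] := along_homog idfun U D f0_hom.
rewrite -/g in size_g top_g.
pose S1 := [set P in S | al P != 0].
have root_g P : P \in S1 -> root g (be P / al P).
  rewrite inE => /andP[PS aP]; have := PS.
  rewrite in_setI (in_rational_points P f0_hom) // => /andP[/eqP fP _].
  apply/eqP; apply: (mulfI (expf_neq0 n.+1 aP)); rewrite mulr0 gE.
  rewrite -(meval_homog _ _ f0_hom) -[RHS]fP; apply: meval_eq => i.
  by rewrite (repE _ PS); field; exact: aP.
have prop P P' b : P \in S -> P' \in S -> al P = b * al P' -> be P = b * be P' -> P = P'.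
  move=> PS PS' Ea Eb; apply: (@rep_inj _ _ _ b); apply/rowP => i.
  by rewrite mxE (repE _ PS) (repE _ PS') Ea Eb; ring.
have card_S1 : (#|S1| < size g)%N.
  have -> : #|S1| = size [seq be P / al P | P in S1] by rewrite size_map -cardE.
  apply: max_poly_roots => //.
    by apply/allP => y /mapP[P]; rewrite mem_enum => PS ->; apply: root_g.
  rewrite map_inj_in_uniq ?enum_uniq // => P P'; rewrite !mem_enum.
  move=> /setIdP[PS aP] /setIdP[PS' aP'] E; apply: (@prop _ _ (al P / al P')) => //.
    by rewrite divfK.
  by rewrite mulrAC -mulrA -E mulrCA divff ?mulr1.
have [SS1|] := boolP (S \subset S1).
  rewrite -ltnS; apply: leq_ltn_trans (subset_leq_card SS1) _.
  exact: leq_trans card_S1 size_g.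
move=> /subsetPn[P0 P0S P0S1].
have al0 P : P \in S -> P \notin S1 -> al P = 0.
  by move=> PS; rewrite inE PS /= negbK => /eqP.
have be_nz P : P \in S -> P \notin S1 -> be P != 0.
  move=> PS PS1; have [i] := vec_neq0 P; apply: contraNneq => be0.
  by rewrite (repE _ PS) (al0 _ PS PS1) be0 !mul0r addr0.
have fD : f0.@[D] = 0.
  have := P0S; rewrite in_setI (in_rational_points P0 f0_hom) // => /andP[/eqP fP _].
  apply: (mulfI (expf_neq0 n.+1 (be_nz _ P0S P0S1))).
  rewrite mulr0 -(meval_homog _ _ f0_hom) -[RHS]fP; apply: meval_eq => i.
  by rewrite (repE _ P0S) (al0 _ P0S P0S1) mul0r add0r.
have size_g' : (size g <= n.+1)%N.
  apply/leq_sizeP => i; rewrite leq_eqVlt => /predU1P[<-|lt_i].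
    by rewrite top_g -[RHS]fD.
  by rewrite nth_default // (leq_trans size_g).
have : S \subset P0 |: S1.
  apply/subsetP => P PS; rewrite in_setU1 orbC.
  have [//|PS1] := boolP (P \in S1); rewrite orFb; apply/eqP.
  apply: (@prop _ _ (be P / be P0)) => //; last by rewrite divfK ?be_nz.
  by rewrite !al0 // mulr0.
move/subset_leq_card/leq_trans; apply; rewrite cardsU1.
apply: leq_trans (leq_trans card_S1 size_g').
exact: (leq_add (leq_b1 _) (leqnn _)).
Qed.

(** * A rational point off the curve that could be added to the arc *)

Section Complete.
Variable P0 : P2 F.
Local Notation Q0 := (rep P0 0).
Local Notation Q := (iota \o Q0).
Hypothesis fQ0 : f0.@[Q0] != 0.
Hypothesis all_tangent : forall l : 'cV[F]_3, l != 0 -> P0 \in line l ->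
  (#|rational_points f0 :&: line l| <= n)%N.

Let fQ : f.@[Q] != 0.
Proof. by rewrite rational_value fmorph_eq0. Qed.

(** Otherwise the line is nowhere tangent to the curve, so that it meets it in n + 1 distinct
    points, all of which turn out to be rational; this contradicts [all_tangent]. *)
Lemma rational_line_tangent (U : 'I_3 -> F) i : cross U Q0 i != 0 ->
  norm_at n f Q (iota \o U) (polar Q) = 0.
Proof.
move=> ci; apply/eqP/negPn/negP => Nnz.
have tang y : f.@[fun i => iota (U i) + y * Q i] = 0 ->
    dot Q (grad (fun i => iota (U i) + y * Q i)) != 0.
  move=> fy; apply: contra Nnz => Gy; apply/eqP/(norm_at_eq0 closed f_hom fQ).
  by exists y; rewrite meval_polar; split=> //; apply/eqP.
have [mon sz] := fiber_eq_monic idfun f_hom fQ (iota \o U).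
have [rs [Ers size_rs]] := closed_split closed mon sz.
have f_rs r : (r \in rs) = (f.@[fun i => iota (U i) + r * Q i] == 0).
  by rewrite -root_prod_XsubC -Ers root_fiber_eq.
have uniq_rs : uniq rs.
  rewrite -separable_prod_XsubC -Ers unlock coprimep_def.
  apply/negPn/negP => /closed[r]; rewrite root_gcd => /andP[].
  rewrite root_fiber_eq // => /eqP fr /eqP.
  rewrite /fiber_eq derivM derivC mul0r add0r hornerM hornerC deriv_along_f => /eqP.
  by rewrite mulf_eq0 invr_eq0 (negPf fQ) (negPf (tang r fr)).
have rs_F r : r \in rs -> exists b, r = iota b.
  rewrite f_rs => /eqP fr; apply: frob_fixed; rewrite cardF.
  set v := fun i => iota (U i) + r * Q i in fr.
  (* As U and Q are rational, v^q = v + (r^q - r) Q. Both v and v^q are orthogonal to the gradient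
     and Q is not, whence r^q = r. *)
  have E : dot (grad v) (frob v) = dot (grad v) v + (r ^+ q - r) * dot Q (grad v).
    have Fv j : frob v j = 1 * v j + (r ^+ q - r) * Q j.
      rewrite /v (frobD (iota \o U) Q) !frob_iota /=; ring.
    by rewrite (eq_dot (fun=> erefl) Fv) dot_combr mul1r [dot Q _]dotC.
  move: E; rewrite grad_self // grad_frob_eq0 // add0r => /esym/eqP.
  by rewrite mulf_eq0 (negPf (tang _ fr)) orbF subr_eq0 => /eqP.
pose T := [set b : F | f0.@[fun i => U i + b * Q0 i] == 0].
have card_T : (n.+1 <= #|T|)%N.
  rewrite -size_rs cardE -(size_map iota); apply: uniq_leq_size => // r r_rs.
  have [b Eb] := rs_F r r_rs; rewrite Eb; apply: map_f; rewrite mem_enum inE.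
  rewrite -(fmorph_eq0 iota) -mmap_meval -map_mpoly_mmap.
  rewrite f_rs Eb in r_rs; rewrite -(eqP r_rs); apply/eqP/meval_eq => j /=.
  by rewrite rmorphD rmorphM.
have v_nz b : \row_j (U j + b * Q0 j) != 0.
  apply: contraNneq ci => /rowP v0; have E j : U j = - b * Q0 j.
    by apply/eqP; rewrite mulNr -addr_eq0; have := v0 j; rewrite !mxE => ->.
  by rewrite /cross !E; apply/eqP; ring.
have [pt Ept] := @fin_all_exists F (fun=> P2 F)
  (fun b P => exists a, a != 0 /\ rep P = a *: \row_j (U j + b * Q0 j)) (fun b => P2_rep (v_nz b)).
have pt_inj : injective pt.
  move=> b b' E; have [a [a_nz Ea]] := Ept b; have [a' [a'_nz Ea']] := Ept b'.
  have Ev j : a * (U j + b * Q0 j) = a' * (U j + b' * Q0 j).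
    have /rowP/(_ j) : rep (pt b) = rep (pt b') by rewrite E.
    by rewrite Ea Ea' !mxE.
  have Eaa : a = a'.
    apply: (mulIf ci); have <- : cross (fun j => a * (U j + b * Q0 j)) Q0 i = a * cross U Q0 i.
      by rewrite /cross; ring.
    by rewrite /cross !Ev; ring.
  have [j Qj] := vec_neq0 P0.
  have := Ev j; rewrite Eaa => /(mulfI a'_nz) /addrI; exact: mulIf.
pose l : 'cV[F]_3 := \col_j cross U Q0 j.
have l_nz : l != 0 by apply: contraNneq ci => /colP/(_ i); rewrite !mxE => ->.
have lE : (fun j => l j 0) =1 cross U Q0 by move=> j; rewrite mxE.
have lP0 : P0 \in line l.
  rewrite in_line_dot (eq_dot (fun=> erefl) lE).
  by rewrite /dot !crossE; apply/eqP; ring.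
have := all_tangent l_nz lP0; rewrite leqNgt => /negP[].
rewrite (leq_trans card_T) // -(card_imset T pt_inj); apply/subset_leq_card/subsetP.
move=> P /imsetP[b]; rewrite inE => /eqP fb ->; have [a [a_nz Ea]] := Ept b.
rewrite in_setI (in_rational_points _ f0_hom) // in_line_dot.
have EP j : rep (pt b) 0 j = a * (U j + b * Q0 j) by rewrite Ea !mxE.
rewrite (meval_eq _ EP) (meval_homog _ _ f0_hom) fb mulr0 eqxx /=.
by rewrite (eq_dot EP lE) /dot !crossE; apply/eqP; ring.
Qed.

Lemma map_norm_pencil (V W : 'I_3 -> F) (g : {mpoly F[3]}) :
  map_poly iota (norm_pencil n f0 Q0 V W g) =
  norm_pencil n f Q (iota \o V) (iota \o W) (map_mpoly iota g).
Proof.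
rewrite /norm_pencil fnorm_map fnorm_base; apply: eq_fnorm => [c|i] /=.
  by rewrite map_polyC.
by rewrite /pencil rmorphD rmorphM /= !map_polyC map_polyX.
Qed.

Lemma norm_pencil_neq0_infinity (V W : 'I_3 -> k) m g : g \is m.-homog ->
  norm_at n f Q W g != 0 -> norm_pencil n f Q V W g != 0.
Proof.
move=> g_hom; apply: contraNneq => g0.
by have [_ <-] := size_norm_pencil closed f_hom fQ V W g_hom; rewrite g0 coef0.
Qed.

Lemma exists_root_exp e (c : k) : (0 < e)%N -> exists x, x ^+ e = c.
Proof.
move=> e_gt0; have [|x] := closed (p := 'X^e - c%:P).
  by rewrite size_XnsubC // eqSS -lt0n.
by rewrite /root !hornerE subr_eq0 => /eqP; exists x.
Qed.

Variables (r m : nat) (B : {mpoly F[3]}) (A : 'I_3 -> {mpoly F[3]}) (j0 : 'I_3).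
Local Notation e := (p ^ r)%N.
Hypotheses (B_hom : B \is m.-homog).
Hypothesis grad_expp : forall i, exists h,
  f0^`M(i) * B ^+ e - f0^`M(j0) * A i ^+ e = h * f0.
Hypothesis B_nz : forall V W, det V W Q0 != 0 -> norm_pencil n f0 Q0 V W B != 0.
Hypothesis G_nz : forall V W, det V W Q0 != 0 ->
  norm_pencil n f0 Q0 V W f0^`M(j0) != 0.

(** The coefficients c_i have e-th roots in k, and e-th powers are additive, so the congruences for
    the single partial derivatives combine into one e-th power. *)
Lemma polar_expp (c : 'I_3 -> k) : exists g h : {mpoly k[3]},
  polar c * map_mpoly iota B ^+ e = f^`M(j0) * g ^+ e + h * f.
Proof.
have e_gt0 : (0 < e)%N by rewrite expn_gt0 prime_gt0.
have [x Ex] := @fin_all_exists 'I_3 (fun=> k) (fun i x => x ^+ e = c i)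
  (fun i => exists_root_exp (c i) e_gt0).
have [h Eh] := @fin_all_exists 'I_3 (fun=> {mpoly F[3]}) _ grad_expp.
pose g := \sum_i (x i)%:MP * map_mpoly iota (A i).
exists g, (\sum_i (c i)%:MP * map_mpoly iota (h i)).
have pkX : p \in [pchar {mpoly k[3]}].
  rewrite inE p_pr /=; have := pk; rewrite inE => /andP[_ /eqP p0].
  by rewrite -mpolyC_nat p0 mpolyC0.
have -> : g ^+ e = \sum_i ((x i)%:MP * map_mpoly iota (A i)) ^+ e.
  exact: sum_exp_pchar.
rewrite [X in _ = X + _]mulr_sumr [X in _ = _ + X]mulr_suml -big_split.
rewrite /polar dotE mulr_suml.
apply: eq_bigr => i _ /=; rewrite exprMn.
have -> : (x i)%:MP_[3] ^+ e = (c i)%:MP by rewrite -Ex rmorphXn.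
have : map_mpoly iota (f0^`M(i) * B ^+ e) =
    map_mpoly iota (f0^`M(j0) * A i ^+ e) + map_mpoly iota (h i) * f.
  by rewrite -rmorphM -Eh -rmorphD /= addrC subrK.
rewrite !rmorphM !rmorphXn /= -!mderiv_map => E.
by rewrite -[LHS]mulrA E mulrDr [X in X + _]mulrCA [X in _ + X]mulrA.
Qed.

(* The norms of [polar Q] and of a form [polar c] that does not vanish on the
   fiber of a differ by an e-th power. *)
Lemma mup_polar (V W : 'I_3 -> k) a :
  norm_at n f Q W (map_mpoly iota B) != 0 -> norm_at n f Q W f^`M(j0) != 0 ->
  norm_at n f Q W (polar Q) != 0 ->
  (forall y, exists i, (V i + a * W i) + y * Q i != 0) ->
  root (norm_pencil n f Q V W (polar Q)) a ->
  (e <= mup a (norm_pencil n f Q V W (polar Q)))%N.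
Proof.
move=> BW GW QW nz aQ; have e_gt0 : (0 < e)%N by rewrite expn_gt0 prime_gt0.
pose N := norm_pencil n f Q V W.
have B_hom' : map_mpoly iota B \is m.-homog by apply: map_mpoly_homog B_hom.
have NB : N (map_mpoly iota B) != 0 by apply: norm_pencil_neq0_infinity B_hom' BW.
have NG : N f^`M(j0) != 0.
  by apply: norm_pencil_neq0_infinity (mderiv_homog j0 f_hom) GW.
have NQ : N (polar Q) != 0 by apply: norm_pencil_neq0_infinity (polar_hom Q) QW.
have [c cG] := fiber_gradients fQ nz.
have ca : ~~ root (N (polar c)) a.
  rewrite /root horner_norm_pencil; apply/eqP => /(norm_at_eq0 closed f_hom fQ)[y [fy]].
  by rewrite meval_polar => /eqP; rewrite (negPf (cG y fy)).
have Nc : N (polar c) != 0 by apply: contraNneq ca => ->; rewrite root0.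
have Nexpp (b : 'I_3 -> k) : exists g,
    N (polar b) * N (map_mpoly iota B) ^+ e = N f^`M(j0) * N g ^+ e.
  have [g [h Eg]] := polar_expp b; exists g.
  by rewrite -!norm_pencilX -!norm_pencilM Eg norm_pencil_modr ?f_hom.
have mupX (g : {poly k}) l : g != 0 -> mup a (g ^+ l) = (l * mup a g)%N.
  move=> g_nz; elim: l => [|l IHl]; first by rewrite mupNroot ?root1.
  by rewrite exprS mupM ?expf_neq0 // IHl mulSn.
(* Modulo e, the multiplicity of the norm of [polar b] is that of the norm of the partial derivative
   [j0], whatever b is; for b = c it is zero. *)
have mupE b : N (polar b) != 0 -> exists l,
    (mup a (N (polar b)) + e * mup a (N (map_mpoly iota B)) =
     mup a (N f^`M(j0)) + e * l)%N.
  move=> Nb; have [g Eg] := Nexpp b; exists (mup a (N g)).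
  have : N f^`M(j0) * N g ^+ e != 0 by rewrite -Eg mulf_neq0 ?expf_neq0.
  rewrite mulf_eq0 negb_or expf_eq0 e_gt0 /= => /andP[_ Ng].
  by rewrite -!mupX // -!mupM ?expf_neq0 // Eg.
have [l El] := mupE Q NQ; have [l' El'] := mupE c Nc.
rewrite (mupNroot ca) add0n in El'.
have : (e %| mup a (N (polar Q)))%N.
  have /dvdn_addl <- : (e %| e * l')%N by apply: dvdn_mulr.
  have -> : (mup a (N (polar Q)) + e * l' = e * l)%N.
    by apply: (@addnI (mup a (N f^`M(j0)))); rewrite addnCA -El'.
  exact: dvdn_mulr.
by move/dvdn_leq; apply; rewrite -XsubC_dvd // dvdp_XsubCl.
Qed.

Lemma exists_complement : exists V W, det V W Q0 != 0.
Proof.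
have [i] := vec_neq0 P0; pose vec3 a b c : 'I_3 -> F := fun i => [:: a; b; c]`_i.
elim/ord3_ind: i => Qi.
- exists (vec3 0 1 0), (vec3 0 0 1); rewrite (_ : det _ _ _ = Q0 0) //.
  by rewrite /det /dot !crossE /vec3 /=; ring.
- exists (vec3 0 0 1), (vec3 1 0 0); rewrite (_ : det _ _ _ = Q0 1) //.
  by rewrite /det /dot !crossE /vec3 /=; ring.
- exists (vec3 1 0 0), (vec3 0 1 0); rewrite (_ : det _ _ _ = Q0 2) //.
  by rewrite /det /dot !crossE /vec3 /=; ring.
Qed.

(** Each of the q + 1 rational lines through Q gives a zero of multiplicity at least e of the norm
    of [polar Q], of degree at most (n + 1) n. For this the member at infinity must not be one of
    these lines. *)
Lemma tangent_bound : (q.+1 * e <= n.+1 * n)%N.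
Proof.
have [V [W basis]] := exists_complement.
have NB := B_nz basis; have NG := G_nz basis.
(* V + w W spans with Q the new member at infinity: w is outside F, so that this line is not
   rational, and it avoids the zeros of the norms of B and of the partial derivative [j0]. *)
have [w] : exists w, ~~ root (('X^q - 'X) *
    (map_poly iota (norm_pencil n f0 Q0 V W B) *
     map_poly iota (norm_pencil n f0 Q0 V W f0^`M(j0)))) w.
  by apply: exists_nonroot closed _ _; rewrite !mulf_neq0 ?map_poly_eq0 ?XqX_neq0 ?q_gt1.
rewrite !rootM !negb_or => /and3P[wF wB wG].
have {wF} wq : w ^+ q != w by move: wF; rewrite /root !hornerE subr_eq0.
pose Wk : 'I_3 -> k := iota \o W; pose Vk : 'I_3 -> k := iota \o V.
pose W0 i := Vk i + w * Wk i.
have BW : norm_at n f Q W0 (map_mpoly iota B) != 0.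
  by move: wB; rewrite /root map_norm_pencil horner_norm_pencil.
have GW : norm_at n f Q W0 f^`M(j0) != 0.
  by move: wG; rewrite /root map_norm_pencil horner_norm_pencil -mderiv_map.
have basis_k : det Vk Wk Q != 0.
  by have := basis; rewrite -(fmorph_eq0 iota) rmorph_det.
(* A point v where this member is tangent would have its gradient orthogonal to v, v^q and Q, which
   are independent because w^q != w. *)
have QW : norm_at n f Q W0 (polar Q) != 0.
  apply/eqP => /(norm_at_eq0 closed f_hom fQ)[y [fv]].
  rewrite meval_polar dotC; set v := fun i => W0 i + y * Q i in fv *.
  have Fv i : frob v i = Vk i + w ^+ q * Wk i + y ^+ q * Q i.
    by rewrite /v frobD /W0 frobD !frob_iota.
  have dv : det v (frob v) Q = (w ^+ q - w) * det Vk Wk Q.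
    rewrite (eq_det (fun=> erefl) Fv (fun=> erefl)) /v /W0 /det /dot !crossE; ring.
  have dv_nz : det v (frob v) Q != 0 by rewrite dv mulf_neq0 ?subr_eq0.
  have v_nz : exists i, v i != 0.
    apply/existsP; rewrite -negb_forall; apply: contraNN dv_nz => /forallP v0.
    by rewrite /det /dot !(eqP (v0 _)) !mul0r !addr0.
  have [i Gi] := nonsing v_nz fv.
  move=> GQ; have /eqP := ortho3 i (grad_self fv) (grad_frob_eq0 fv) GQ.
  by rewrite mulf_eq0 (negPf Gi) (negPf dv_nz).
pose g := norm_pencil n f Q Wk W0 (polar Q).
have g_nz : g != 0 by apply: norm_pencil_neq0_infinity (polar_hom Q) QW.
have [size_g _] := size_norm_pencil closed f_hom fQ Wk W0 (polar_hom Q).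
have iw a : iota a - w != 0.
  rewrite subr_eq0; apply: contraNneq wq => <-.
  by rewrite -cardF frob_phi.
(* The parameters of the rational members: W itself at 0, and W + (b - w)^-1 (V + w W) = (b - w)^-1
   (V + b W) for b in F. *)
pose S := 0 :: [seq (iota a - w)^-1 | a <- enum F].
have size_S : size S = q.+1 by rewrite /= size_map -cardE cardF.
have uniq_S : uniq S.
  rewrite /=; apply/andP; split.
    by apply/mapP => -[a _ /esym/eqP]; rewrite invr_eq0 (negPf (iw a)).
  rewrite map_inj_uniq ?enum_uniq // => a b /invr_inj /addIr.
  exact: fmorph_inj.
have tangent_at (U : 'I_3 -> F) l a : l != 0 -> (exists i, cross U Q0 i != 0) ->
    (forall i, Wk i + a * W0 i = l * iota (U i)) -> (e <= mup a g)%N.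
  move=> l_nz [i ci] E; apply: mup_polar BW GW QW _ _.
    move=> y; apply/existsP; rewrite -negb_forall; apply: contraNN ci => /forallP v0.
    have EU j : iota (U j) = - (y / l) * Q j.
      apply: (mulfI l_nz); rewrite -E; apply/eqP; rewrite -subr_eq0.
      have <- := eqP (v0 j); apply/eqP; field; exact: l_nz.
    rewrite -(fmorph_eq0 iota) rmorph_cross /cross /= !EU; apply/eqP => /=; ring.
  rewrite /root horner_norm_pencil (eq_norm_at _ _ _ _ E).
  rewrite (norm_at_scale closed f_hom fQ _ l_nz (polar_hom Q)).
  by rewrite (rational_line_tangent ci) mulr0.
have : (size S * e < size g)%N.
  apply: size_ge_mup => // a; rewrite /S in_cons => /orP[/eqP->|/mapP[b _ ->]].
    apply: (tangent_at W 1) => [||i]; [exact: oner_neq0 | | by rewrite mul0r mul1r addr0].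
    apply/existsP; rewrite -negb_forall; apply: contraNN basis => /forallP c0.
    by rewrite /det /dot !(eqP (c0 _)) !mulr0 !addr0.
  apply: (tangent_at (fun i => V i + b * W i) (iota b - w)^-1) => [||i].
    by rewrite invr_eq0.
    apply/existsP; rewrite -negb_forall; apply: contraNN basis => /forallP c0.
    rewrite (_ : det V W Q0 = - dot W (cross (fun i => V i + b * W i) Q0)).
      by rewrite /dot !(eqP (c0 _)) !mulr0 !addr0 oppr0.
    by rewrite /det /dot !crossE; ring.
  rewrite /W0 /Vk /Wk rmorphD rmorphM /=; field; exact: iw.
by rewrite size_S => /leq_trans/(_ size_g); rewrite ltnS.
Qed.

End Complete.

End Geometry.

(** * The theorem *)

Lemma card_pchar (F : finFieldType) p : p \in [pchar F] -> exists s, #|F| = (p ^ s)%N.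
Proof.
move=> pF; have := abelem_pgroup (fin_ring_pchar_abelem pF).
by rewrite /pgroup cardsT => /p_natP[s Es]; exists s.
Qed.

Lemma exists_curve_point (k : fieldType) (n : nat) (f : {mpoly k[3]}) :
  alg_closed k -> f \is n.+1.-homog ->
  exists2 v : 'I_3 -> k, exists i, v i != 0 & f.@[v] = 0.
Proof.
move=> closed f_hom; pose b j : 'I_3 -> k := fun i => (i == j)%:R.
have b_nz j : b j j != 0 by rewrite /b eqxx oner_eq0.
have [sz1|/closed[y fy]] := boolP (size (along idfun (b 0) (b 1) f) == 1%N).
  have [_ top] := along_homog idfun (b 0) (b 1) f_hom.
  exists (b 1); first by exists 1.
  by rewrite -[LHS]top nth_default // (eqP sz1).
exists (fun i => b 0 i + y * b 1 i); last by rewrite -horner_along_id; apply/eqP.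
by exists 0; rewrite /b /= mulr0 addr0 oner_eq0.
Qed.

Section Main.
Variables (F : finFieldType) (k : fieldType) (iota : {rmorphism F -> k}).
Hypothesis closed : alg_closed k.
Variables (n : nat) (f : {mpoly F[3]}).
Hypotheses (f_hom : f \is n.+1.-homog) (n_gt0 : (0 < n)%N) (f_nz : f != 0).
Hypothesis nonsing : forall v : 'I_3 -> k, (exists i, v i != 0) ->
  (map_mpoly iota f).@[v] = 0 ->
  exists i, (map_mpoly iota f)^`M(i).@[v] != 0.
Variables (K : fieldType) (phi : {rmorphism F -> K}) (X : 'I_3 -> K).
Hypothesis vanishP : forall m g, g \is m.-homog ->
  (mmap phi X g = 0 <-> exists h, g = h * f).
Hypothesis quotP : forall y, exists (m : nat) (g h : {mpoly F[3]}),
  [/\ g \is m.-homog, h \is m.-homog, mmap phi X h != 0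
    & y = mmap phi X g / mmap phi X h].
Variables (t : K) (D : nat -> K -> K).
Hypotheses (ht : separating_variable phi t) (hD : is_hasse_derivative phi t D).
Variable eps : nat.
Local Notation dX j := (fun i => D j (X i)).
Hypotheses (eps_gt1 : (1 < eps)%N) (eps_nz : det X (dX 1) (dX eps) != 0).
Hypothesis eps_min : forall j, (1 < j < eps)%N -> det X (dX 1) (dX j) = 0.
Hypothesis frob_tangent : det (fun i => X i ^+ #|F|) X (dX 1) = 0.
Hypothesis small_degree : (n.+1 * n < #|F|.+1 * eps)%N.

Let grad_nz : exists i, f^`M(i) != 0.
Proof.
have f_hom' : map_mpoly iota f \is n.+1.-homog by apply: (map_mpoly_homog _ f_hom).
have [v v_nz fv] := exists_curve_point closed f_hom'.
have [i Gi] := nonsing v_nz fv; exists i; apply: contraNneq Gi => fi.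
by rewrite mderiv_map fi raddf0 meval0.
Qed.

Theorem complete_arc :
  is_complete_arc #|rational_points f| n.+1 (rational_points f) /\
  (#|rational_points f| + n.+1 * n = n.+1 * #|F|.+1)%N.
Proof.
have [p p_pr pF] := finPcharP F; have [s cardF] := card_pchar pF.
have tangent := frob_tangent; have small := small_degree; rewrite cardF in tangent small *.
have [u frob_div] := frob_divides f_hom vanishP hD eps_nz tangent.
split; last exact: (card_rational_points closed pF cardF f_hom n_gt0 frob_div nonsing).
split; first by split=> // l l_nz; exact: (card_line_section closed f_hom n_gt0 nonsing).
move=> [S [[card_S arc_S] AS]].
have [P0 P0S P0A] : exists2 P0, P0 \in S & P0 \notin rational_points f.
  by apply/subsetPn; apply/negP => /subset_leq_card; rewrite card_S ltnn.
have fP0 : f.@[rep P0 0] != 0.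
  by rewrite (in_rational_points P0 f_hom) in P0A.
(* A line through P0 has at most n + 1 points of S, one of which is P0, off the curve. *)
have all_tangent (l : 'cV[F]_3) : l != 0 -> P0 \in line l ->
    (#|rational_points f :&: line l| <= n)%N.
  move=> l_nz P0l; rewrite -ltnS; apply: leq_trans (arc_S l l_nz).
  rewrite (cardsD1 P0 (S :&: _)) in_setI P0S P0l ltnS.
  apply/subset_leq_card/subsetP => P; rewrite !inE => /andP[PA ->].
  rewrite andbT; apply/andP; split; last by apply: (subsetP AS); rewrite inE.
  by apply: contraNneq P0A => <-; rewrite inE.
have d_gt1 : (1 < n.+1)%N by [].
have [r [m [B [A [j0 [le_eps [B_hom _] B_nz G_nz expp]]]]]] :=
  gradient_expp f_hom d_gt1 f_nz vanishP grad_nz ht hD pF cardF eps_gt1 eps_nz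
    eps_min tangent quotP.
have := @tangent_bound F k iota closed p s n f u pF cardF f_hom frob_div nonsing
  P0 fP0 all_tangent r m B A j0 B_hom expp.
have norm_nz m' g : g \is m'.-homog -> mmap phi X g != 0 -> forall V W,
    det V W (rep P0 0) != 0 -> norm_pencil n f (rep P0 0) V W g != 0.
  by move=> g_hom g_nz V W basis; apply: (norm_pencil_neq0 f_hom n_gt0 f_nz vanishP fP0 basis g_hom).
move=> /(_ (norm_nz _ _ B_hom B_nz) (norm_nz _ _ (mderiv_homog j0 f_hom) G_nz)).
(* As eps <= p^r, the bound (q + 1) p^r <= d (d - 1) contradicts d (d - 1) < (q + 1) eps. *)
rewrite leqNgt => /negP; apply; apply: leq_trans small _.
by rewrite leq_mul2l le_eps orbT.
Qed.

End Main.

Theorem theorem1p2 (F : finFieldType) (q : nat) (hq : #|F| = q)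
  (Fbar : closedFieldType) (iota : {rmorphism F -> Fbar})
  (hFbar : is_algebraic_closure iota)
  (d : nat) (f : {mpoly F[3]})
  (hf : f \is d.-homog) (hd : (1 < d)%N)
  (hirr : irreducible_curve iota f) (hns : nonsingular_curve iota f)
  (K : fieldType) (phi : {rmorphism F -> K}) (x : 'rV[K]_3)
  (hK : is_function_field phi f x)
  (t : K) (ht : separating_variable phi t)
  (D : nat -> K -> K) (hD : is_hasse_derivative phi t D)
  (eps : nat) (heps : is_epsilon D x eps)
  (hfnc : frobenius_nonclassical q D x)
  (hdeg : (d * (d - 1) < (q + 1) * eps)%N) :
  is_complete_arc #|rational_points f| d (rational_points f) /\
  (#|rational_points f|)%:Z = d%:Z * (q%:Z - d%:Z + 2).
Proof.
move: hq hd hf hdeg hfnc => <-; case: d => // n; rewrite ltnS => n_gt0 f_hom hdeg hfnc.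
have closed : alg_closed Fbar by move=> g; apply/closed_rootP.
have evalE (E : fieldType) (psi : {rmorphism F -> E}) g (v : 'rV[E]_3) :
    evalf psi g v = mmap psi (v 0) g by apply: map_mpoly_mmap.
have nonsing v : (exists i, v i != 0) -> (map_mpoly iota f).@[v] = 0 ->
    exists i, (map_mpoly iota f)^`M(i).@[v] != 0.
  move=> [i vi] fv; have vE : (\row_j v j) 0 =1 v by move=> j; rewrite mxE.
  have [||l fl] := hns (\row_j v j).
  - by apply: contraNneq vi => /rowP/(_ i); rewrite !mxE => ->.
  - by rewrite /evalf (meval_eq _ vE).
  by exists l; rewrite mderiv_map -(meval_eq _ vE).
have f_nz : f != 0.
  by have [nz _ _] := hirr; apply: contraNneq nz => ->; rewrite raddf0.
have detE a b : det3 x (map_mx (D a) x) (map_mx (D b) x) =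
    det (x 0) (fun i => D a (x 0 i)) (fun i => D b (x 0 i)).
  by rewrite det3E; apply: eq_det => // i; rewrite mxE.
have [[eps_gt1 eps_nz] eps_min] := heps.
have [nu [eps' [[[nu_gt0 _] nu_min] [[eps'_gt1 _] _] Enu]]] := hfnc.
have [vanish quot] := hK.
have [||||||arc card] := @complete_arc F Fbar iota closed n f f_hom n_gt0 f_nz nonsing K phi (x 0) _ _ t D ht hD eps eps_gt1 _ _ _ _.
- by move=> m g g_hom; rewrite -evalE; exact: (vanish m g g_hom).
- move=> y; have [m [g [h [g_hom h_hom h_nz ->]]]] := quot y.
  by exists m, g, h; rewrite -!evalE.
- by rewrite -detE.
- move=> j /andP[j_gt1 lt_j]; rewrite -detE; apply/eqP/negPn/negP => nz.
  by have := eps_min j (conj j_gt1 nz); rewrite leqNgt lt_j.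
(* As nu = eps' > 1, minimality of nu makes the Frobenius determinant of order 1 vanish. *)
- have : ~~ (0 < 1)%N || (det3 (map_mx (fun z => z ^+ #|F|) x) x (map_mx (D 1) x) == 0).
    apply/negPn/negP; rewrite /= => nz.
    by have := nu_min 1%N (conj isT nz); rewrite Enu leqNgt eps'_gt1.
  rewrite /= det3E => /eqP E; rewrite -[RHS]E.
  by apply: eq_det => // i; rewrite mxE.
- by move: hdeg; rewrite subSS subn0 addn1.
(* The count was obtained without subtraction, as k + d (d - 1) = d (q + 1); it is solved for k in
   the integers. *)
split=> //; move: card => /(congr1 Posz); rewrite PoszD !PoszM => E.
rewrite -[LHS](addrK (n.+1%:Z * n%:Z)) E.
by rewrite !intS; ring.
Qed.
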